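(* Let $R\ge 0$, let $\nu$ be a probability measure on $\mathbb{R}^d$ with $\mathrm{diam}(\mathrm{supp}(\nu))\le R$, and let $\mu=\gamma_d\star\nu$. Then, for the heat-flow transport map $\varphi^{\mathrm{flow}}:\mathbb{R}^d\to\mathbb{R}^d$ of $\mu$ (defined in the context), which is well-defined and satisfies $\varphi^{\mathrm{flow}}_*\gamma_d=\mu$, $$\|\nabla\varphi^{\mathrm{flow}}(x)\|_{\mathrm{op}}\le e^{\frac{R^2}{8}}\quad\text{for almost every }x\in\mathbb{R}^d.$$ Further, the Lipschitz bound is sharp: for $d=1$ and $\nu=\frac12\delta_{-\frac R2}+\frac12\delta_{\frac R2}$, the optimal Lipschitz constant of $\varphi^{\mathrm{flow}}$ is exactly $e^{\frac{R^2}{8}}$.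
   Context: $\gamma_d$ is the standard Gaussian measure on $\mathbb{R}^d$, $\star$ denotes convolution of measures, $\|\cdot\|_{\mathrm{op}}$ is the operator norm, and $\varphi_*\eta$ is the push-forward of $\eta$ by $\varphi$. Heat-flow transport map. Let $f:=\frac{d\mu}{d\gamma_d}$, and let $Q_tf(x)=\int_{\mathbb{R}^d}f(e^{-t}x+\sqrt{1-e^{-2t}}\,y)\,d\gamma_d(y)$, $t\ge 0$, be the Ornstein–Uhlenbeck semigroup. Put $\mu_t:=(Q_tf)\gamma_d$ and $V_t:=-\nabla\log Q_tf$. For $x\in\mathbb{R}^d$ let $S_t(x)$ solve $\frac{d}{dt}S_t(x)=V_t(S_t(x))$, $S_0(x)=x$. The map $S_t$ is a diffeomorphism transporting $\mu$ to $\mu_t$; its inverse $T_t:=S_t^{-1}$ transports $\mu_t$ to $\mu$. Then $\varphi^{\mathrm{flow}}:=T:=\lim_{t\to\infty}T_t$. As in the paper, $T$ being well-defined means that for some sequence $t_k\to\infty$ the limit $T(x)=\lim_k T_{t_k}(x)$ exists for $\gamma_d$-almost every $x$ and $T_*\gamma_d=\mu$; $T$ is identified, up to a null set, with a Lipschitz representative, so that its Jacobian matrix $\nabla\varphi^{\mathrm{flow}}(x)$ exists for almost every $x$. *)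

(* Defs.v *)
From HB Require Import structures.
From mathcomp Require Import all_boot all_order all_algebra.
From mathcomp Require Import all_classical all_reals all_analysis.
From mathcomp Require Import measurable_realfun.

Set Implicit Arguments.
Unset Strict Implicit.
Unset Printing Implicit Defensive.

Import Order.TTheory GRing.Theory Num.Theory.
Import numFieldNormedType.Exports.

Local Open Scope classical_set_scope.
Local Open Scope ring_scope.

(** Points of R^n are row vectors.  The library norm on ['rV[R]_n] is the sup
    norm; it induces the same topology and the same Frechet derivative as the
    Euclidean norm [enorm] below, which is the one used in all metric notions. *)

Section EuclideanNorm.
Context {R : realType}.

Definition enorm n (x : 'rV[R]_n) : R := Num.sqrt (\sum_(i < n) x 0 i ^+ 2).

(** A matrix acts on row vectors by [v *m A], which is also the convention of
    the library Jacobian: ['d f x v = v *m 'J f x]. *)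
Definition opnorm m n (A : 'M[R]_(m, n)) : R :=
  sup [set enorm (v *m A) | v in [set v : 'rV[R]_m | enorm v <= 1]].

Definition elipschitz m n (L : R) (f : 'rV[R]_m -> 'rV[R]_n) : Prop :=
  forall x y, enorm (f x - f y) <= L * enorm (x - y).

Definition is_optimal_lipschitz m n (L : R) (f : 'rV[R]_m -> 'rV[R]_n) : Prop :=
  elipschitz L f /\ forall L', elipschitz L' f -> L <= L'.

Definition ediam n (A : set 'rV[R]_n) : \bar R :=
  ereal_sup [set (enorm (p.1 - p.2))%:E | p in A `*` A].

Definition gradient n (g : 'rV[R]_n -> R) (x : 'rV[R]_n) : 'rV[R]_n :=
  \row_(i < n) 'D_(delta_mx 0 i) g x.

End EuclideanNorm.

(** ['rV[R]_n] carries the product sigma-algebra (generated by the coordinates),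
    i.e. the Borel sigma-algebra of R^n. *)

Definition rV_display : measure_display. Proof. exact: default_measure_display. Qed.

Section MeasurableRV.
Context {R : realType} (n : nat).

Let coors : 'I_n -> 'rV[R]_n -> R := fun i x => x 0 i.

Let rV_set0 : g_sigma_preimage coors set0.
Proof. exact: sigma_algebra0. Qed.

Let rV_setC A : g_sigma_preimage coors A -> g_sigma_preimage coors (~` A).
Proof. exact: sigma_algebraC. Qed.

Let rV_bigcup (F : (set 'rV[R]_n)^nat) :
  (forall i, g_sigma_preimage coors (F i)) ->
  g_sigma_preimage coors (\bigcup_i (F i)).
Proof. exact: sigma_algebra_bigcup. Qed.

HB.instance Definition _ := @isMeasurable.Build rV_display
  'rV[R]_n (g_sigma_preimage coors) rV_set0 rV_setC rV_bigcup.

Lemma measurable_coord (i : 'I_n) :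
  measurable_fun [set: 'rV[R]_n] (fun x : 'rV[R]_n => x 0 i : R).
Proof.
move=> _ Y mY; rewrite setTI; apply: sub_sigma_algebra => /=.
rewrite -bigcup_seq/=; exists i => /=; first by rewrite mem_index_enum.
by exists Y => //; rewrite setTI.
Qed.

Lemma measurable_fun_coordP d (T : measurableType d) (f : T -> 'rV[R]_n) :
  (forall i, measurable_fun [set: T] (fun t => f t 0 i : R)) ->
  measurable_fun [set: T] f.
Proof.
move=> mf; apply: (@measurability _ _ _ _ setT f
  (\big[setU/set0]_(i < n) preimage_set_system setT (coors i) measurable)) => //.
move=> _ [B + <-]; rewrite -bigcup_seq /= => -[i _ [Y mY <-]].
by rewrite !setTI -[X in measurable X]setTI; exact: (mf i).
Qed.

End MeasurableRV.

Section PowerMeasure.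
Context {R : realType}.

Definition rV_cons n (p : R * 'rV[R]_n) : 'rV[R]_n.+1 :=
  \row_(i < n.+1) (if unlift ord0 i is Some j then p.2 0 j else p.1).

Lemma measurable_rV_cons n :
  measurable_fun [set: measurableTypeR R * 'rV[R]_n] (@rV_cons n).
Proof.
apply: measurable_fun_coordP => i.
case: (unliftP ord0 i) => [j ->|->].
  apply: (eq_measurable_fun (fun p : measurableTypeR R * 'rV[R]_n => p.2 0 j : R)).
    by move=> p _; rewrite mxE liftK.
  exact: (measurableT_comp (measurable_coord j) measurable_snd).
apply: (eq_measurable_fun (fun p : measurableTypeR R * 'rV[R]_n => p.1 : R)).
  by move=> p _; rewrite mxE unlift_none.
exact: measurable_fst.
Qed.

HB.instance Definition _ n := isMeasurableFun.Build _ _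
  (measurableTypeR R * 'rV[R]_n)%type 'rV[R]_n.+1 (@rV_cons n)
  (@measurable_rV_cons n).

Lemma measurable_rV_uncons n :
  measurable_fun [set: 'rV[R]_n.+1]
    (fun x => (x 0 ord0, \row_j x 0 (lift ord0 j)) :
       measurableTypeR R * 'rV[R]_n).
Proof.
apply: measurable_fun_pair => /=; first exact: measurable_coord.
apply: measurable_fun_coordP => i.
by under eq_fun do rewrite mxE; exact: measurable_coord.
Qed.

Definition rV_cons_measure n
    (m1 : {sigma_finite_measure set (measurableTypeR R) -> \bar R})
    (m2 : {sigma_finite_measure set 'rV[R]_n -> \bar R}) :
    set 'rV[R]_n.+1 -> \bar R :=
  pushforward (m1 \x m2)%E (@rV_cons n).

Section ConsMeasure.
Variables (n : nat)
  (m1 : {sigma_finite_measure set (measurableTypeR R) -> \bar R})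
  (m2 : {sigma_finite_measure set 'rV[R]_n -> \bar R}).

Let cons0 : rV_cons_measure m1 m2 set0 = 0%E.
Proof. by rewrite /rV_cons_measure /pushforward preimage_set0 measure0. Qed.

Let cons_ge0 A : (0 <= rV_cons_measure m1 m2 A)%E.
Proof. exact: (measure_ge0 (m1 \x m2)%E). Qed.

Let cons_sigma_additive : semi_sigma_additive (rV_cons_measure m1 m2).
Proof.
move=> F mF tF mUF; rewrite /rV_cons_measure /pushforward preimage_bigcup.
apply: (@measure_semi_sigma_additive _ _ _ (m1 \x m2)%E) => [k||].
- by rewrite -[X in measurable X]setTI; exact: measurable_rV_cons.
- apply/trivIsetP => /= i j _ _ ij; rewrite -preimage_setI.
  by move/trivIsetP : tF => /(_ _ _ _ _ ij) ->//; rewrite preimage_set0.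
- rewrite -preimage_bigcup -[X in measurable X]setTI.
  exact: measurable_rV_cons.
Qed.

HB.instance Definition _ := isMeasure.Build _ _ _ (rV_cons_measure m1 m2)
  cons0 cons_ge0 cons_sigma_additive.

Let cons_sigma_finite : sigma_finite setT (rV_cons_measure m1 m2).
Proof.
have /sigma_finiteP[F [FT ndF Foo]] := sigma_finiteT m1.
have /sigma_finiteP[G [GT ndG Goo]] := sigma_finiteT m2.
pose g (x : 'rV[R]_n.+1) : measurableTypeR R * 'rV[R]_n :=
  (x 0 ord0, \row_j x 0 (lift ord0 j)).
have gK : cancel (@rV_cons n) g.
  case=> a v; rewrite /g mxE unlift_none; congr pair; apply/rowP => j.
  by rewrite !mxE liftK.
exists (fun k => g @^-1` (F k `*` G k)).
  rewrite -preimage_bigcup; apply/esym; rewrite -subTset => x _ /=.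
  have [/= i _ Fi] : (\bigcup_i F i) (g x).1 by rewrite -FT.
  have [/= j _ Gj] : (\bigcup_i G i) (g x).2 by rewrite -GT.
  exists (maxn i j) => //; split.
    exact: (subsetPset _ _ (ndF _ _ (leq_maxl i j))).
  exact: (subsetPset _ _ (ndG _ _ (leq_maxr i j))).
move=> k; have [mF Fk] := Foo k; have [mG Gk] := Goo k; split.
  rewrite -[X in measurable X]setTI.
  by apply: measurable_rV_uncons => //; exact: measurableX.
rewrite /rV_cons_measure /pushforward -comp_preimage.
rewrite (_ : g \o _ = id); last by apply/funext => p; exact: gK.
by rewrite preimage_id product_measure1E// lte_mul_pinfty// ge0_fin_numE.
Qed.

HB.instance Definition _ := Measure_isSigmaFinite.Build _ _ _
  (rV_cons_measure m1 m2) cons_sigma_finite.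

End ConsMeasure.

(** [power_measure m n] is the product measure m ^ n on R^n. *)
Fixpoint power_measure
    (m : {sigma_finite_measure set (measurableTypeR R) -> \bar R}) (n : nat) :
    {sigma_finite_measure set 'rV[R]_n -> \bar R} :=
  if n is n'.+1 then rV_cons_measure m (power_measure m n')
  else (dirac (0 : 'rV[R]_0)).

Definition lebesgue_rV (n : nat) :
    {sigma_finite_measure set 'rV[R]_n -> \bar R} :=
  power_measure (@lebesgue_measure R) n.

Definition gaussian (n : nat) : set 'rV[R]_n -> \bar R :=
  power_measure (normal_prob (0 : R) 1) n.
Arguments gaussian n _ : clear implicits.

HB.instance Definition _ n := Measure.on (gaussian n).

Let gaussian_setT n : gaussian n [set: 'rV[R]_n] = 1%E.
Proof.
rewrite /gaussian; elim: n => [|n IHn]; first by rewrite /= diracT.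
rewrite /= /rV_cons_measure /pushforward preimage_setT -setXTT.
rewrite product_measure1E// IHn mule1.
exact: (probability_setT (normal_prob (0 : R) 1)).
Qed.

HB.instance Definition _ n := Measure_isProbability.Build _ _ _
  (gaussian n) (gaussian_setT n).

End PowerMeasure.
Arguments lebesgue_rV R n : clear implicits.
Arguments gaussian R n _ : clear implicits.

Section Probability.
Context {R : realType} (n : nat).

Definition rV_add (p : 'rV[R]_n * 'rV[R]_n) : 'rV[R]_n := p.1 + p.2.

Lemma measurable_rV_add : measurable_fun setT rV_add.
Proof.
apply: measurable_fun_coordP => i; rewrite /rV_add.
under eq_fun do rewrite mxE.
apply: measurable_funD.
  exact: (measurableT_comp (measurable_coord i) measurable_fst).
exact: (measurableT_comp (measurable_coord i) measurable_snd).
Qed.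

HB.instance Definition _ := isMeasurableFun.Build _ _ _ _ rV_add measurable_rV_add.

Definition convolution (P Q : probability 'rV[R]_n R) :
    probability 'rV[R]_n R :=
  distribution (P \x Q)%E rV_add.

Definition msupport (P : probability 'rV[R]_n R) : set 'rV[R]_n :=
  [set x | forall U, open U -> U x -> (0 < P U)%E].

Definition two_point (a b : 'rV[R]_n) : set 'rV[R]_n -> \bar R :=
  measure_add (mscale (2^-1)%:nng \d_a) (mscale (2^-1)%:nng \d_b).

HB.instance Definition _ a b := Measure.on (two_point a b).

Let two_point_setT a b : two_point a b [set: 'rV[R]_n] = 1%E.
Proof.
rewrite /two_point measure_addE.
transitivity ((2^-1)%:E * \d_a [set: 'rV[R]_n] +
              (2^-1)%:E * \d_b [set: 'rV[R]_n] : \bar R)%E => //.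
by rewrite !diracT !mule1 -EFinD -[2^-1]div1r -splitr.
Qed.

HB.instance Definition _ a b := Measure_isProbability.Build _ _ _
  (two_point a b) (two_point_setT a b).

End Probability.

Section HeatFlow.
Context {R : realType} (n : nat).
Implicit Types (f : 'rV[R]_n -> R) (S T : R -> 'rV[R]_n -> 'rV[R]_n).

(** The Radon-Nikodym derivative is only determined up to a null set, whereas
    the velocity field at time 0 involves pointwise derivatives of [f]: [f] is
    the continuous version, which is unique. *)
Definition gaussian_density (mu : probability 'rV[R]_n R) f : Prop :=
  continuous f /\
  ae_eq (gaussian R n) setT
    (Radon_Nikodym (charge_of_finite_measure mu) (gaussian R n)) (EFin \o f).

Definition ou_semigroup (t : R) f (x : 'rV[R]_n) : R :=
  \int[gaussian R n]_y
    f (expR (- t) *: x + Num.sqrt (1 - expR (- (2 * t))) *: y).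

Definition velocity f (t : R) (x : 'rV[R]_n) : 'rV[R]_n :=
  - gradient (fun z => ln (ou_semigroup t f z)) x.

(** The flow lives on [0, +oo[, hence a one-sided derivative at time 0. *)
Definition is_flow (V : R -> 'rV[R]_n -> 'rV[R]_n) S : Prop :=
  forall x, [/\ S 0 x = x,
    h^-1 *: (S h x - S 0 x) @[h --> 0^'+] --> V 0 (S 0 x) &
    forall t : R, 0 < t -> is_derive t (1 : R) (fun s : R => S s x) (V t (S t x))].

(** [phi] is a Lipschitz representative of the limit of [T_ t = (S_ t)^-1] along
    some sequence of times tending to infinity. *)
Definition heat_flow_map (mu : probability 'rV[R]_n R)
    (phi : 'rV[R]_n -> 'rV[R]_n) : Prop :=
  exists f S T (t_ : R^nat),
    [/\ gaussian_density mu f,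
        is_flow (velocity f) S,
        forall t : R, 0 <= t -> cancel (S t) (T t) /\ cancel (T t) (S t) &
        [/\ t_ @ \oo --> +oo,
            {ae gaussian R n, forall x, T (t_ k) x @[k --> \oo] --> phi x} &
            exists L, elipschitz L phi]].

End HeatFlow.

(* Main.v *)
Require Import Defs.
From HB Require Import structures.
From mathcomp Require Import all_boot all_order all_algebra.
From mathcomp Require Import all_classical all_reals all_analysis.
From mathcomp Require Import measurable_realfun.
From mathcomp Require Import ring lra.

Set Implicit Arguments.
Unset Strict Implicit.
Unset Printing Implicit Defensive.

Import Order.TTheory GRing.Theory Num.Theory.
Import numFieldNormedType.Exports.

Local Open Scope classical_set_scope.
Local Open Scope ring_scope.

(** Substitute s = exp(-t).  If Z is a standard Gaussian vector, Y has law nu and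
    F_s is the density of the law of Z + sY with respect to gamma, then
    Q_t F_1 = F_s, and grad log F_s (x) = s E_q[Y] =: s W(s, x), where E_q is the
    expectation under the law of Y tilted by exp(s <x, Y> - s^2 |Y|^2 / 2).
    Hence the inverse heat flow from time t to time 0 is the flow Phi of
    dX/ds = W(s, X) from s to 1, and the transport map is Phi from 0 to 1.

    The derivative of W(s, .) is s times a covariance matrix of a vector taking its
    values in a set of diameter R, so by Popoviciu's inequality it is at most
    s R^2 / 4, and Gronwall's lemma over [0, 1] gives the Lipschitz constant
    exp(R^2 / 8).  As W is smooth, Phi is differentiable at every point.

    Phi from 0 to 1 pushes gamma to mu because, for test functions k with a Lipschitz
    gradient, U(s) = E k(Phi_{s -> 1}(Z + sY)) satisfies |U(t) - U(s)| <= C (t - s)^2: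
    the first-order terms cancel since W(s, x) = E[Y | Z + sY = x].

    For the symmetric two-point law X = 0 is a trajectory, along which the variance
    is exactly R^2 / 4: the derivative of Phi at 0 is exp(R^2 / 8). *)

(** The variable s = exp(-t) also carries t = +oo to the regular time s = 0, so the limit that
    defines the transport map becomes continuity of the flow at s = 0. The obstacle is the
    pushforward identity. Neither a continuity equation nor a change of variables is used, only
    second-order remainders with constants uniform in time: a reweighted expectation expands in its
    exponent with an explicit quadratic error; hence W, and then its flow, have such expansions in
    space; hence test functions composed with the flow stay in one class with fixed constants. The
    same expansions give the differential at every point and the lower bound in the sharp case, and
    nothing is differentiated under an integral. Every map satisfying [heat_flow_map] is concerned,
    so uniqueness is needed too. Gaussian null sets contain no nonempty open set, which determines
    the continuous density and the Lipschitz limit at every point; in between, Gronwall's lemma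
    determines the flow. *)

(** * Euclidean norm and differential inequalities *)

Section EuclideanSpace.
Context {R : realType} (n : nat).
Implicit Types (x y z : 'rV[R]_n) (c : R).

Definition dot x y : R := \sum_(i < n) x 0 i * y 0 i.

Lemma dotC x y : dot x y = dot y x.
Proof. by apply: eq_bigr => i _; rewrite mulrC. Qed.

Lemma dotDl x y z : dot (x + y) z = dot x z + dot y z.
Proof. by rewrite -big_split; apply: eq_bigr => i _; rewrite mxE mulrDl. Qed.

Lemma dotZl c x y : dot (c *: x) y = c * dot x y.
Proof. by rewrite mulr_sumr; apply: eq_bigr => i _; rewrite mxE mulrA. Qed.

Lemma dotNl x y : dot (- x) y = - dot x y.
Proof. by rewrite -scaleN1r dotZl mulN1r. Qed.

Lemma dotDr x y z : dot x (y + z) = dot x y + dot x z.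
Proof. by rewrite dotC dotDl !(dotC x). Qed.

Lemma dotZr c x y : dot x (c *: y) = c * dot x y.
Proof. by rewrite dotC dotZl dotC. Qed.

Lemma dotNr x y : dot x (- y) = - dot x y.
Proof. by rewrite dotC dotNl dotC. Qed.

Lemma dot_enorm x : dot x x = enorm x ^+ 2.
Proof.
rewrite sqr_sqrtr; last by apply: sumr_ge0 => i _; exact: sqr_ge0.
by apply: eq_bigr => i _; rewrite expr2.
Qed.

Lemma enorm_ge0 x : 0 <= enorm x.
Proof. exact: sqrtr_ge0. Qed.

Lemma enormZ c x : enorm (c *: x) = `|c| * enorm x.
Proof.
apply/eqP; rewrite -(@eqrXn2 _ 2) ?mulr_ge0 ?enorm_ge0//.
by rewrite exprMn -!dot_enorm dotZl dotZr mulrA -expr2 real_normK ?num_real.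
Qed.

Lemma enorm0 : enorm (0 : 'rV[R]_n) = 0.
Proof. by rewrite -(scale0r (0 : 'rV[R]_n)) enormZ normr0 mul0r. Qed.

Lemma enormN x : enorm (- x) = enorm x.
Proof. by rewrite -scaleN1r enormZ normrN normr1 mul1r. Qed.

Lemma ler_coord_enorm x i : `|x 0 i| <= enorm x.
Proof.
rewrite -sqrtr_sqr ler_wsqrtr// (bigD1 i)//= lerDl.
by apply: sumr_ge0 => j _; exact: sqr_ge0.
Qed.

Lemma enorm_eq0 x : enorm x = 0 -> x = 0.
Proof.
move=> x0; apply/rowP => i; rewrite mxE; apply/eqP; rewrite -normr_le0 -x0.
exact: ler_coord_enorm.
Qed.

Lemma CauchySchwarz_dot x y : `|dot x y| <= enorm x * enorm y.
Proof.
have [y0|y0] := eqVneq (enorm y) 0.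
  rewrite y0 mulr0 (enorm_eq0 y0) dotC -(scale0r (0 : 'rV[R]_n)) dotZl mul0r.
  by rewrite normr0.
have yp : 0 < enorm y ^+ 2 by rewrite exprn_gt0// lt_def y0 enorm_ge0.
rewrite -ler_sqr ?nnegrE ?mulr_ge0 ?enorm_ge0//.
rewrite real_normK ?num_real// exprMn.
(* This vector is |y|^2 times the component of x orthogonal to y; its squared norm is |y|^2 (|x|^2
   |y|^2 - <x,y>^2). *)
have : 0 <= enorm (enorm y ^+ 2 *: x - dot x y *: y) ^+ 2 by exact: sqr_ge0.
rewrite -dot_enorm !(dotDl, dotDr, dotZl, dotZr, dotNl, dotNr) !dot_enorm.
rewrite (dotC y x) => h.
rewrite -(ler_pM2l yp); move: h; nra.
Qed.

Lemma ler_enormD x y : enorm (x + y) <= enorm x + enorm y.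
Proof.
rewrite -ler_sqr ?nnegrE ?addr_ge0 ?enorm_ge0//.
rewrite -dot_enorm !(dotDl, dotDr) !dot_enorm (dotC y x).
have := le_trans (ler_norm _) (CauchySchwarz_dot x y); nra.
Qed.

Lemma enormB x y : enorm (x - y) = enorm (y - x).
Proof. by rewrite -enormN opprB. Qed.

Lemma ler_coord_norm x i : `|x 0 i| <= `|x|.
Proof. by rewrite [leRHS]/Num.norm/= mx_normrE; exact: (le_bigmax _ _ (0, i)). Qed.

Lemma norm_le_coord x c : 0 <= c -> (forall i, `|x 0 i| <= c) -> `|x| <= c.
Proof.
move=> c0 xc; rewrite [leLHS]/Num.norm/= mx_normrE; apply: bigmax_le => //.
by case=> i j _; rewrite ord1.
Qed.

Lemma ler_norm_enorm x : `|x| <= enorm x.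
Proof. by apply: norm_le_coord (enorm_ge0 _) (ler_coord_enorm _). Qed.

(** The factor n, cruder than sqrt n, is harmless: dimension-dependent factors enter only the
    regularity constants, never the sharp Lipschitz bound. *)
Lemma enorm_le_coord x c : 0 <= c -> (forall i, `|x 0 i| <= c) ->
  enorm x <= n%:R * c.
Proof.
move=> c0 xc.
rewrite -ler_sqr ?nnegrE ?mulr_ge0 ?enorm_ge0//.
rewrite -dot_enorm; apply: (@le_trans _ _ (\sum_(i < n) c ^+ 2)).
  apply: ler_sum => i _; rewrite -expr2 -[leLHS]real_normK ?num_real//.
  by rewrite ler_sqr ?nnegrE.
rewrite sumr_const card_ord exprMn -[leLHS]mulr_natl; apply: ler_wpM2r.
  exact: sqr_ge0.
case: (n) => [|m]; first by rewrite expr0n.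
by rewrite -natrX ler_nat expnS leq_pmulr// expn_gt0.
Qed.

Lemma ler_enorm_norm x : enorm x <= n%:R * `|x|.
Proof. by apply: enorm_le_coord => // i; exact: ler_coord_norm. Qed.

End EuclideanSpace.

(** * Comparison principles and antiderivatives on the line *)

Section RealComparison.
Context {R : realType}.

Lemma is_derive_comp1 (f g : R -> R) (x df dg : R) :
  is_derive (g x) (1 : R) f df -> is_derive x (1 : R) g dg ->
  is_derive x (1 : R) (fun y => f (g y)) (df * dg).
Proof. by move=> hf hg; exact: (@is_derive1_comp _ f g x _ _ hf hg). Qed.

Lemma is_derive_mul (f g : R -> R) (x df dg : R) :
  is_derive x (1 : R) f df -> is_derive x (1 : R) g dg ->
  is_derive x (1 : R) (fun y => f y * g y) (df * g x + f x * dg).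
Proof.
move=> hf hg; have := is_deriveM hf hg.
by rewrite /GRing.scale/= addrC [g x * df]mulrC.
Qed.

Lemma is_derive_add (f g : R -> R) (x df dg : R) :
  is_derive x (1 : R) f df -> is_derive x (1 : R) g dg ->
  is_derive x (1 : R) (fun y => f y + g y) (df + dg).
Proof. by move=> hf hg; exact: is_deriveD. Qed.

Lemma is_derive_continuous (V : normedModType R) (f : R -> V) (x : R) (df : V) :
  is_derive x (1 : R) f df -> {for x, continuous f}.
Proof.
by move=> [h _]; apply: differentiable_continuous; apply/derivable1_diffP.
Qed.

Lemma is_derive_expR_comp (K : R -> R) (s k : R) : is_derive s (1 : R) K k ->
  is_derive s (1 : R) (fun x => expR (K x)) (k * expR (K s)).
Proof.
move=> dK; rewrite mulrC.
exact: is_derive_comp1 (is_derive_expR _) dK.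
Qed.

(** The product u exp(-K) is nonincreasing. Derivatives are asked for only inside the interval
    because [flow_velocity_unique] starts at time 0, where only a one-sided derivative is given; the
    variable rate k produces the exponent of the Lipschitz bound as an integral. *)
Lemma Gronwall (u u' k K : R -> R) (a b : R) : a <= b ->
  {within `[a, b], continuous u} ->
  (forall s, a < s < b -> is_derive s (1 : R) u (u' s)) ->
  (forall s, is_derive s (1 : R) K (k s)) ->
  (forall s, a < s < b -> u' s <= k s * u s) ->
  u b <= u a * expR (K b - K a).
Proof.
move=> ab cu du dK u'k.
pose g s := u s * expR (- K s).
have dE s : is_derive s (1 : R) (fun x => expR (- K x)) (- k s * expR (- K s)).
  have dN : is_derive s (1 : R) (fun x => - K x) (- k s) by exact: is_deriveN.
  exact: is_derive_expR_comp.
have dg s : a < s < b ->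
    is_derive s (1 : R) g ((u' s - k s * u s) * expR (- K s)).
  move=> sab; apply: is_derive_eq; first exact: is_deriveM (du s sab) (dE s).
  by rewrite /GRing.scale/=; ring.
have cg : {within `[a, b], continuous g}.
  move=> x; apply: cvgM; first exact: cu.
  apply: (continuous_subspaceT (f := fun x => expR (- K x))) => y.
  exact: is_derive_continuous (dE y).
have : g b <= g a.
  apply: (@ler0_derive1_le_cc _ g a b) => //; rewrite ?in_itv/= ?lexx ?ab//.
    by move=> s; rewrite in_itv/= => /dg[].
  move=> s; rewrite in_itv/= => sab; rewrite derive1E.
  have [_ ->] := dg s sab.
  by rewrite mulr_le0_ge0 ?expR_ge0// subr_le0 u'k.
rewrite /g !expRN expRD expRN => h.
have e0 := expR_gt0 (K b).
by rewrite mulrCA mulrC -ler_pdivrMr.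
Qed.

Lemma ler_is_derive (u u' v v' : R -> R) (a b : R) : a <= b ->
  (forall s, is_derive s (1 : R) u (u' s)) ->
  (forall s, is_derive s (1 : R) v (v' s)) ->
  (forall s, a <= s <= b -> u' s <= v' s) ->
  u b - u a <= v b - v a.
Proof.
move=> ab du dv uv.
have dw s : is_derive s (1 : R) (v - u) (v' s - u' s) by exact: is_deriveB.
have cw : {within `[a, b], continuous (v - u)}.
  by apply: continuous_subspaceT => s; exact: is_derive_continuous (dw s).
have [c] := MVT_segment ab (fun s _ => dw s) cw.
rewrite in_itv/= => cab; rewrite !fctE => e.
rewrite -subr_ge0 (_ : _ - _ = v b - u b - (v a - u a)); last by ring.
by rewrite e mulr_ge0 ?subr_ge0// uv.
Qed.

Lemma ler_norm_is_derive (u u' : R -> R) (a b c : R) : a <= b ->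
  (forall s, is_derive s (1 : R) u (u' s)) ->
  (forall s, a <= s <= b -> `|u' s| <= c) ->
  `|u b - u a| <= c * (b - a).
Proof.
move=> ab du u'c.
have dv s : is_derive s (1 : R) (fun s : R => c * s) c.
  by have := is_deriveZ c (is_derive_id s (1 : R)); rewrite /GRing.scale/= mulr1.
have dN s : is_derive s (1 : R) (fun s => - u s) (- u' s) by exact: is_deriveN.
have h1 := ler_is_derive ab du dv.
have h2 := ler_is_derive ab dN dv.
rewrite mulrBr ler_norml; apply/andP; split.
  rewrite lerNl; apply: le_trans (h2 _); first by rewrite opprB opprK addrC.
  by move=> s /u'c; rewrite ler_norml => /andP[? _]; rewrite lerNl.
by apply: h1 => s /u'c; rewrite ler_norml => /andP[].
Qed.

(** Integration gains a factor 1/c in the norm weighted by exp(- c |s - a|); this is the contraction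
    behind Picard iteration. Times before a are reduced to times after a by the reflection x -> 2 a
    - x. *)
Lemma ler_norm_is_derive_expR (u u' : R -> R) (c K a s : R) : 0 < c ->
  u a = 0 ->
  (forall s, is_derive s (1 : R) u (u' s)) ->
  (forall s, `|u' s| <= K * c * expR (c * `|s - a|)) ->
  `|u s| <= K * expR (c * `|s - a|).
Proof.
move=> c0.
suff right (v v' : R -> R) (t : R) : a <= t -> v a = 0 ->
    (forall s, is_derive s (1 : R) v (v' s)) ->
    (forall s, `|v' s| <= K * c * expR (c * `|s - a|)) ->
    `|v t| <= K * expR (c * `|t - a|).
  move=> u0 du u'K; have [sa|sa] := leP a s; first exact: right du u'K.
  have dr x : is_derive x (1 : R) (fun x => u (2 * a - x)) (- u' (2 * a - x)).
    have dx : is_derive x (1 : R) (fun x => 2 * a - x) (- 1).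
      have h := is_deriveB (is_derive_cst (2 * a) x 1) (is_derive_id x 1).
      by rewrite -[-1]sub0r; exact: h.
    by rewrite -mulrN1; exact: is_derive_comp1 (du _) dx.
  have -> : u s = u (2 * a - (2 * a - s)) by congr u; ring.
  have -> : `|s - a| = `|2 * a - s - a|.
    by rewrite -normrN; congr (`|_|); ring.
  apply: (right (fun x => u (2 * a - x)) (fun x => - u' (2 * a - x))) => //.
  - by rewrite lerBrDr mulr_natl mulr2n lerD2l ltW.
  - by rewrite (_ : _ - _ = a)//; ring.
  - move=> x; rewrite normrN (le_trans (u'K _))//.
    by rewrite (_ : 2 * a - x - a = - (x - a)) ?normrN//; ring.
move=> at_ v0 dv v'K.
have K0 : 0 <= K.
  have := le_trans (normr_ge0 _) (v'K a).
  by rewrite subrr normr0 mulr0 expR0 mulr1 pmulr_lge0.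
have dE x : is_derive x (1 : R) (fun x => K * expR (c * (x - a)))
    (K * c * expR (c * (x - a))).
  have d1 : is_derive x (1 : R) (fun x => c * (x - a)) c.
    have h := is_deriveB (is_derive_id x (1 : R)) (is_derive_cst a x 1).
    by have := is_deriveZ c h; rewrite subr0 /GRing.scale/= mulr1.
  have d2 := is_derive_expR_comp d1.
  by have := is_deriveZ K d2; rewrite /GRing.scale/= mulrA.
have bnd x : a <= x <= t -> `|v' x| <= K * c * expR (c * (x - a)).
  by move=> /andP[ax _]; have := v'K x; rewrite (ger0_norm (_ : 0 <= x - a)) ?subr_ge0.
have e0 : K * expR (c * (a - a)) = K by rewrite subrr mulr0 expR0 mulr1.
rewrite [X in expR (_ * X)]ger0_norm ?subr_ge0// ler_norml; apply/andP; split.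
  have dN x : is_derive x (1 : R) (fun x => - v x) (- v' x) by exact: is_deriveN.
  have bN x : a <= x <= t -> - v' x <= K * c * expR (c * (x - a)).
    by move=> /bnd; rewrite ler_norml => /andP[? _]; rewrite lerNl.
  by have := ler_is_derive at_ dN dE bN; rewrite v0 e0; lra.
have bP x : a <= x <= t -> v' x <= K * c * expR (c * (x - a)).
  by move=> /bnd; rewrite ler_norml => /andP[].
by have := ler_is_derive at_ dv dE bP; rewrite v0 e0; lra.
Qed.

(** The intervals centred at u k with half-length 2 A / 2^k are nested, and the supremum of their
    left ends lies in all of them. *)
Lemma cvg_geometric_increments (u : nat -> R) (A : R) :
  (forall k, `|u k.+1 - u k| <= A / 2 ^+ k) ->
  exists l, forall k, `|l - u k| <= 2 * A / 2 ^+ k.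
Proof.
move=> uA.
pose a k := u k - 2 * A / 2 ^+ k; pose b k := u k + 2 * A / 2 ^+ k.
have half k : A / 2 ^+ k.+1 = A / 2 ^+ k / 2.
  by rewrite exprSr invfM mulrA.
have ndA k j : a k <= a (k + j)%N.
  elim: j => [|j]; first by rewrite addn0.
  move/le_trans; apply; rewrite addnS /a -!mulrA half.
  have := uA (k + j)%N; rewrite ler_norml => /andP[]; lra.
have niB k j : b (k + j)%N <= b k.
  elim: j => [|j]; first by rewrite addn0.
  apply: le_trans; rewrite addnS /b -!mulrA half.
  have := uA (k + j)%N; rewrite ler_norml => /andP[]; lra.
have A0 k : 0 <= A / 2 ^+ k by exact: le_trans (normr_ge0 _) (uA k).
have ab k j : a k <= b j.
  apply: (le_trans (ndA k j)); apply: le_trans (niB j k); rewrite addnC /a /b.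
  by have := A0 (j + k)%N; lra.
exists (sup (range a)) => k; rewrite ler_norml; apply/andP; split.
  rewrite lerBrDr addrC; apply: ub_le_sup; last by exists k.
  by exists (b 0%N) => _ [j _ <-].
rewrite lerBlDl; apply: ge_sup; first by exists (a 0%N), 0%N.
by move=> _ [j _ <-]; exact: ab.
Qed.

Lemma antiderivative (g : R -> R) (a : R) : continuous g ->
  exists2 G : R -> R, G a = 0 & forall s, is_derive s (1 : R) G (g s).
Proof.
move=> cg.
have ig (x y : R) : (@lebesgue_measure R).-integrable `[x, y] (EFin \o g).
  apply: continuous_compact_integrable; first exact: segment_compact.
  exact: continuous_subspaceT.
pose H b s := \int[lebesgue_measure]_(t in `[b, s]) g t.
have HB (b c s : R) : b <= c -> c <= s ->
    H b s - H b c = \int[lebesgue_measure]_(t in `]c, s]) g t.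
  by move=> bc cs; rewrite /H Rintegral_itvB ?bnd_simp.
have dH (b s : R) : b < s -> is_derive s (1 : R) (H b) (g s).
  move=> bs; have s1 : s < s + 1 by rewrite ltrDl.
  have [d e] := continuous_FTC1_closed s1 (ig b _) bs (cg s).
  by apply: DeriveDef; [exact: d|rewrite -derive1E].
(* The integral from a base point is differentiated only to the right of that point, so the base
   moves with s and stays below both a and s. The difference of two integrals from the same base
   does not depend on the base. *)
pose b s := a - `|s - a| - 1.
have ba s : b s < a.
  by rewrite /b ltrBlDr (@le_lt_trans _ _ a) ?gerBl// ltrDl.
have bs s : b s < s.
  have := ler_norm (- (s - a)); rewrite normrN /b; lra.
exists (fun s => H (b s) s - H (b s) a); first by rewrite subrr.
(* For t within distance 1 of s, c is below b t, so near s the moving base can be replaced by the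
   fixed base c. *)
move=> s; pose c := b s - 1.
have dc : is_derive s (1 : R) (fun t => H c t - H c a) (g s).
  rewrite -[g s]subr0; apply: is_deriveB; apply: dH.
  by rewrite /c ltrBlDr ltr_wpDr// ltW.
apply: near_eq_is_derive dc.
near=> t.
have tb : c <= b t.
  have : `|t - s| <= 1 by near: t; exists 1 => //= y; rewrite distrC => /ltW.
  rewrite /c /b; have := ler_normD (t - s) (s - a).
  by rewrite subrKA; lra.
have e1 := HB c (b t) t tb (ltW (bs t)).
have e2 := HB c (b t) a tb (ltW (ba t)).
have e3 := HB (b t) (b t) t (lexx _) (ltW (bs t)).
have e4 := HB (b t) (b t) a (lexx _) (ltW (ba t)).
by lra.
Unshelve. all: by end_near. Qed.

End RealComparison.

(** * Curves in R^n and the Cauchy problem *)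

Section Curves.
Context {R : realType} {n : nat}.
Implicit Types (X Y : R -> 'rV[R]_n).

Lemma is_derive_coordP X (s : R) (dX : 'rV[R]_n) :
  is_derive s (1 : R) X dX <->
  forall i, is_derive s (1 : R) (fun t => X t 0 i) (dX 0 i).
Proof.
split=> [[dXs <-] i|dXs].
  apply: DeriveDef; first exact: (derivable_mxP X s 1).1 dXs 0 i.
  by rewrite derive_mx// mxE.
have dX' : derivable X s 1 by apply/derivable_mxP => i j; rewrite ord1; case: (dXs j).
apply: DeriveDef => //; rewrite derive_mx//; apply/matrixP => i j.
by rewrite mxE ord1; case: (dXs j).
Qed.

Lemma cvg_coordP (T : Type) (F : set_system T) (FF : Filter F)
    (f : T -> 'rV[R]_n) (l : 'rV[R]_n) :
  f @ F --> l <-> forall i, f x 0 i @[x --> F] --> l 0 i.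
Proof.
split=> [fl i|fl]; first exact: (cvg_comp _ _ fl (@coord_continuous _ _ _ 0 i l)).
apply/cvgrPdist_le => e e0.
have : \forall t \near F, forall i, `|l 0 i - f t 0 i| <= e.
  by apply: filter_forall => i; exact: (cvgrPdist_le _ _).1 (fl i) e e0.
apply: filterS => t le; apply: norm_le_coord; first exact: ltW.
by move=> i; rewrite !mxE.
Qed.

Lemma is_derive_dot X Y (s : R) (dX dY : 'rV[R]_n) :
  is_derive s (1 : R) X dX -> is_derive s (1 : R) Y dY ->
  is_derive s (1 : R) (fun t => dot (X t) (Y t)) (dot dX (Y s) + dot (X s) dY).
Proof.
move=> /is_derive_coordP hX /is_derive_coordP hY.
have h i : is_derive s (1 : R) (fun t => X t 0 i * Y t 0 i)
    (dX 0 i * Y s 0 i + X s 0 i * dY 0 i).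
  exact: is_derive_mul (hX i) (hY i).
have := is_derive_sum (h := fun i t => X t 0 i * Y t 0 i) h.
rewrite big_split/=; congr (is_derive _ _ _ _).
by apply/funext => t; rewrite fct_sumE.
Qed.

Lemma Picard_step (W : R -> 'rV[R]_n -> 'rV[R]_n) (L s0 : R) (x0 : 'rV[R]_n) :
  (forall x, continuous (W ^~ x)) ->
  (forall s x y, `|W s x - W s y| <= L * `|x - y|) ->
  forall X, continuous X -> exists Y : R -> 'rV[R]_n,
    Y s0 = x0 /\ forall s, is_derive s (1 : R) Y (W s (X s)).
Proof.
move=> cW lipW X cX.
have L0 : 0 <= `|L| + 1 by rewrite addr_ge0.
have c i : continuous (fun s => W s (X s) 0 i).
  move=> s; apply: (cvg_coordP _ _ _).1; apply/cvgrPdist_le => e e0.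
  near=> t.
  have -> : W s (X s) - W t (X t) =
      (W s (X s) - W t (X s)) + (W t (X s) - W t (X t)) by rewrite subrKA.
  rewrite (le_trans (ler_normD _ _))// (splitr e) lerD//.
    near: t; have := (cvgrPdist_le _ _).1 (cW (X s) s) (e / 2).
    by apply; rewrite divr_gt0.
  rewrite (le_trans (lipW _ _ _))//.
  rewrite (@le_trans _ _ ((`|L| + 1) * `|X s - X t|))//.
    by rewrite ler_wpM2r// (le_trans (ler_norm _))// lerDl.
  rewrite -ler_pdivlMl; last by rewrite ltr_wpDl.
  near: t; apply: (cvgrPdist_le _ _).1 (cX s) _ _.
  by rewrite mulr_gt0 ?invr_gt0 ?divr_gt0// ltr_wpDl.
have /choice[G /all_and2[G0 dG]] i : exists G : R -> R, G s0 = 0 /\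
    forall s, is_derive s (1 : R) G (W s (X s) 0 i).
  by have [G] := antiderivative s0 (c i); exists G.
exists (fun s => \row_i (x0 0 i + G i s)); split.
  by apply/rowP => i; rewrite mxE G0 addr0.
move=> s; apply/is_derive_coordP => i.
under eq_fun do rewrite mxE.
rewrite -[W s (X s) 0 i]add0r.
exact: is_derive_add (is_derive_cst (x0 0 i) s 1) (dG i s).
Unshelve. all: by end_near. Qed.

(** A global Lipschitz bound in space gives solutions on the whole line, so no maximal interval of
    existence has to be tracked. Boundedness in time at the initial point controls the first Picard
    increment in the weighted norm. *)
Theorem Picard_Lindelof (W : R -> 'rV[R]_n -> 'rV[R]_n) (L : R) : 0 < L ->
  (forall x, continuous (W ^~ x)) ->
  (forall s x y, `|W s x - W s y| <= L * `|x - y|) ->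
  (forall x, exists C, forall s, `|W s x| <= C) ->
  forall s0 x0, exists X : R -> 'rV[R]_n,
    X s0 = x0 /\ forall s, is_derive s (1 : R) X (W s (X s)).
Proof.
move=> L0 cW lipW bW s0 x0.
(* The Picard map must be total to be iterated; its values at discontinuous curves are arbitrary. *)
have /choice[P HP] : forall X, exists Y : R -> 'rV[R]_n, continuous X ->
    Y s0 = x0 /\ forall s, is_derive s (1 : R) Y (W s (X s)).
  move=> X; have [cX|ncX] := pselect (continuous X); last by exists X.
  by have [Y HY] := Picard_step s0 x0 cW lipW cX; exists Y.
have cP X : continuous X -> continuous (P X).
  by move=> /HP[_ d] s; exact: is_derive_continuous (d s).
pose Z k := iter k P (cst x0).
have cZ k : continuous (Z k).
  by elim: k => [|k IH]; [exact: cst_continuous|exact: cP].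
have Zs0 k : Z k s0 = x0 by case: k => // k; have [] := HP _ (cZ k).
have dZ k s : is_derive s (1 : R) (Z k.+1) (W s (Z k s)).
  by have [_] := HP _ (cZ k).
(* For the norm sup_s |X s| exp(- 2 L |s - s0|) the Picard map contracts by 1/2. *)
pose c := 2 * L.
have c0 : 0 < c by rewrite mulr_gt0.
pose E s := expR (c * `|s - s0|).
have E1 s : 1 <= E s by rewrite -[1]expR0 ler_expR mulr_ge0// ltW.
have E0 s : 0 <= E s := expR_ge0 _.
have [C hC] := bW x0.
have C0 : 0 <= C := le_trans (normr_ge0 _) (hC s0).
(* K bounds the first increment: its derivative is at most C, and integrating against the weight
   divides by c. *)
have [K K0 CK] : exists2 K, 0 <= K & C = K * c.
  by exists (C / c); [apply: divr_ge0 => //; exact: ltW|rewrite divfK ?gt_eqF].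
have step (X Y X' Y' : R -> 'rV[R]_n) A : X s0 = Y s0 ->
    (forall s, is_derive s (1 : R) X (X' s)) ->
    (forall s, is_derive s (1 : R) Y (Y' s)) ->
    (forall s, `|X' s - Y' s| <= A * c * E s) ->
    forall s, `|X s - Y s| <= A * E s.
  move=> XY dX dY XYA s.
  have A0 : 0 <= A.
    have := le_trans (normr_ge0 _) (XYA s0).
    by rewrite /E subrr normr0 mulr0 expR0 mulr1 pmulr_lge0.
  apply: norm_le_coord; first by rewrite mulr_ge0.
  move=> i; rewrite !mxE.
  apply: (@ler_norm_is_derive_expR _ (fun s => X s 0 i - Y s 0 i)
    (fun s => X' s 0 i - Y' s 0 i)) => //.
  - by rewrite XY subrr.
  - move=> t; apply: is_deriveB.
      exact: (is_derive_coordP _ _ _).1 (dX t) i.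
    exact: (is_derive_coordP _ _ _).1 (dY t) i.
  - move=> t; apply: le_trans (XYA t).
    by have := ler_coord_norm (X' t - Y' t) i; rewrite !mxE.
have ZZ k s : `|Z k.+1 s - Z k s| <= K / 2 ^+ k * E s.
  elim: k s => [|k IH].
    rewrite expr0 divr1; apply: (step _ _ (fun s => W s x0) (fun=> 0)) => //.
    move=> s; rewrite subr0 -CK (le_trans (hC s))//.
    by rewrite ler_peMr.
  apply: (step _ _ _ _ _ _ (dZ k.+1) (dZ k)); first by rewrite !Zs0.
  move=> s; rewrite (le_trans (lipW _ _ _))//.
  rewrite (le_trans (ler_wpM2l (ltW L0) (IH s)))// exprS invfM /c.
  by rewrite le_eqVlt; apply/orP; left; apply/eqP; field; rewrite expf_neq0.
have /choice[X hX] s : exists x : 'rV[R]_n, forall k,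
    `|x - Z k s| <= 2 * K / 2 ^+ k * E s.
  have /choice[l hl] i : exists l, forall k,
      `|l - Z k s 0 i| <= 2 * (K * E s) / 2 ^+ k.
    apply: (@cvg_geometric_increments _ (fun k => Z k s 0 i)) => k.
    rewrite mulrAC; apply: le_trans (ZZ k s).
    by have := ler_coord_norm (Z k.+1 s - Z k s) i; rewrite !mxE.
  exists (\row_i l i) => k; apply: norm_le_coord.
    apply: mulr_ge0 (E0 s); apply: divr_ge0; last exact: exprn_ge0.
    exact: mulr_ge0.
  by move=> i; rewrite !mxE (le_trans (hl i k))// mulrA mulrAC.
have small (A e : R) : 0 <= A -> 0 < e -> exists k, A / 2 ^+ k <= e.
  move=> A0 e0; exists (Num.bound (A / e)).
  rewrite ler_pdivrMr ?exprn_gt0// mulrC -ler_pdivrMr//.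
  have /ltW/le_trans := archi_boundP (divr_ge0 A0 (ltW e0)); apply.
  rewrite -natrX ler_nat ltnW//; exact: ltn_expl.
have cX : continuous X.
  move=> s; apply/cvgrPdist_le => e e0.
  pose M := expR (c * (`|s - s0| + 1)).
  have [k hk] : exists k, 2 * K * M / 2 ^+ k <= e / 3.
    apply: small; last by rewrite divr_gt0.
    by apply: mulr_ge0 (expR_ge0 _); exact: mulr_ge0.
  near=> t.
  have Xt u : `|u - s| <= 1 -> `|X u - Z k u| <= e / 3.
    move=> us; apply: le_trans hk; rewrite (le_trans (hX u k))// mulrAC.
    rewrite ler_wpM2r ?invr_ge0 ?exprn_ge0// ler_wpM2l ?mulr_ge0//.
    rewrite ler_expR ler_pM2l//.
    by have := ler_normD (u - s) (s - s0); rewrite subrKA; lra.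
  have -> : X s - X t = (X s - Z k s) + (Z k s - Z k t) - (X t - Z k t).
    by rewrite opprB !subrKA.
  rewrite (le_trans (ler_normB _ _))// (le_trans (lerD (ler_normD _ _) (lexx _)))//.
  have -> : e = e / 3 + e / 3 + e / 3 by field.
  rewrite !lerD//.
  - by apply: Xt; rewrite subrr normr0.
  - near: t; apply: (cvgrPdist_le _ _).1 (cZ k s) _ _.
    by rewrite divr_gt0.
  - by apply: Xt; near: t; exists 1 => //= y; rewrite distrC => /ltW.
have [Ys0 dY] := HP _ cX.
(* A continuous fixed point of P solves the equation, and at each time X and [P X] are both within
   O(2^-k) of the iterate [Z k.+1]. *)
suff XE : X = P X by exists X; rewrite {1}XE; split=> // s; rewrite {1}XE.
apply/funext => s; apply/eqP; rewrite -subr_eq0 -normr_le0.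
apply/ler_addgt0Pl => e e0; rewrite addr0.
have [k hk] : exists k, 2 * K * E s / 2 ^+ k <= e.
  by apply: small => //; apply: mulr_ge0 (E0 s); exact: mulr_ge0.
apply: le_trans hk.
have YZ : `|P X s - Z k.+1 s| <= K / 2 ^+ k * E s.
  apply: (step _ _ _ _ _ _ dY (dZ k)); first by rewrite Ys0 Zs0.
  move=> t; rewrite (le_trans (lipW _ _ _))//.
  rewrite (le_trans (ler_wpM2l (ltW L0) (hX t k)))// /c.
  rewrite le_eqVlt; apply/orP; left; apply/eqP; field; exact: expf_neq0.
have -> : X s - P X s = (X s - Z k.+1 s) - (P X s - Z k.+1 s).
  by rewrite opprB subrKA.
rewrite (le_trans (ler_normB _ _))// (le_trans (lerD (hX s k.+1) YZ))//.
rewrite exprS invfM le_eqVlt; apply/orP; left; apply/eqP; field.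
exact: expf_neq0.
Unshelve. all: by end_near. Qed.

(** Gronwall's lemma is applied to the squared Euclidean distance, which is differentiable, unlike
    the sup norm of the hypothesis; comparing the norms costs a factor n. Times before s0 are
    handled by time reversal. *)
Lemma ODE_unique (W : R -> 'rV[R]_n -> 'rV[R]_n) (L s0 : R) X Y :
  (forall s x y, `|W s x - W s y| <= L * `|x - y|) ->
  (forall s, is_derive s (1 : R) X (W s (X s))) ->
  (forall s, is_derive s (1 : R) Y (W s (Y s))) ->
  X s0 = Y s0 -> X = Y.
Proof.
move=> lipW dX dY XY.
have L0 : 0 <= `|L| + 1 by rewrite addr_ge0.
pose c := 2 * n%:R * (`|L| + 1) : R.
pose u s := dot (X s - Y s) (X s - Y s).
pose u' s := 2 * dot (X s - Y s) (W s (X s) - W s (Y s)).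
have du s : is_derive s (1 : R) u (u' s).
  have d := is_deriveB (dX s) (dY s).
  apply: is_derive_eq; first exact: (is_derive_dot d d).
  by rewrite dotC -mulr2n -mulr_natl.
have u'u s : `|u' s| <= c * u s.
  rewrite /u' normrM ger0_norm// /c -!mulrA ler_pM2l// /u dot_enorm.
  rewrite (le_trans (CauchySchwarz_dot _ _))//.
  have h : enorm (W s (X s) - W s (Y s)) <= n%:R * ((`|L| + 1) * enorm (X s - Y s)).
    rewrite (le_trans (ler_enorm_norm _))// ler_wpM2l//.
    rewrite (le_trans (lipW _ _ _))//.
    rewrite (@le_trans _ _ ((`|L| + 1) * `|X s - Y s|))//.
      by rewrite ler_wpM2r// (le_trans (ler_norm _))// lerDl.
    by rewrite ler_wpM2l// ler_norm_enorm.
  by rewrite (le_trans (ler_wpM2l (enorm_ge0 _) h))// expr2; lra.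
have us0 : u s0 = 0 by rewrite /u XY subrr dot_enorm enorm0 expr0n.
have dlin (s k : R) : is_derive s (1 : R) (fun t => k * t) k.
  by have := is_deriveZ k (is_derive_id s (1 : R)); rewrite /GRing.scale/= mulr1.
apply/funext => s; apply/eqP; rewrite -subr_eq0; apply/eqP/enorm_eq0/eqP.
rewrite -sqrf_eq0 -dot_enorm; apply/eqP/le_anti/andP; split; last first.
  by rewrite dot_enorm sqr_ge0.
rewrite -/(u s).
have [ss|ss] := leP s0 s.
  have := @Gronwall _ u u' (fun=> c) (fun t => c * t) s0 s ss.
  rewrite us0 mul0r; apply => //.
  - by apply: continuous_subspaceT => t; exact: is_derive_continuous (du t).
  - by move=> t _; exact: le_trans (ler_norm _) (u'u t).
have dr (t : R) : is_derive t (1 : R) (fun t => u (- t)) (- u' (- t)).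
  have dN : is_derive t (1 : R) (fun t => - t) (- 1).
    exact: is_deriveN (is_derive_id t (1 : R)).
  by rewrite -mulrN1; exact: is_derive_comp1 (du _) dN.
have ss' : - s0 <= - s by rewrite lerN2 ltW.
have := @Gronwall _ (fun t => u (- t)) (fun t => - u' (- t)) (fun=> c)
  (fun t => c * t) _ _ ss'.
rewrite !opprK us0 mul0r; apply => //.
- by apply: continuous_subspaceT => t; exact: is_derive_continuous (dr t).
- by move=> t _; rewrite (le_trans (ler_norm _))// normrN u'u.
Qed.

End Curves.

(** * Flows of one-sided Lipschitz vector fields *)

Section Flow.
Context {R : realType} {n : nat}.
Variables (W : R -> 'rV[R]_n -> 'rV[R]_n) (L : R).
Hypothesis L_gt0 : 0 < L.
Hypothesis cW : forall x, continuous (W ^~ x).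
Hypothesis lipW : forall s x y, `|W s x - W s y| <= L * `|x - y|.
Hypothesis bW : forall x, exists C, forall s, `|W s x| <= C.

Definition flow (s0 s : R) (x : 'rV[R]_n) : 'rV[R]_n :=
  projT1 (cid (Picard_Lindelof L_gt0 cW lipW bW s0 x)) s.

Lemma flow_id s x : flow s s x = x.
Proof. by rewrite /flow; case: cid => X []. Qed.

Lemma is_derive_flow s0 s x : is_derive s (1 : R) (flow s0 ^~ x) (W s (flow s0 s x)).
Proof. by rewrite /flow; case: cid => X []. Qed.

Lemma flow_unique (X : R -> 'rV[R]_n) s0 :
  (forall s, is_derive s (1 : R) X (W s (X s))) -> flow s0 ^~ (X s0) = X.
Proof.
move=> dX; apply: (ODE_unique lipW _ dX (s0 := s0)); last exact: flow_id.
by move=> s; exact: is_derive_flow.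
Qed.

Lemma flow_comp s0 s1 s2 x : flow s1 s2 (flow s0 s1 x) = flow s0 s2 x.
Proof.
have := @flow_unique (flow s0 ^~ x) s1 (fun s => is_derive_flow s0 s x).
by move=> /(congr1 (fun f => f s2)).
Qed.

Lemma continuous_flow_time s0 x : continuous (flow s0 ^~ x).
Proof. by move=> s; exact: is_derive_continuous (is_derive_flow s0 s x). Qed.

Section Lipschitz.
Variable kappa : R.
Hypothesis kappa_ge0 : 0 <= kappa.
Hypothesis oslW : forall s x v, 0 <= s <= 1 ->
  dot v (W s (x + v) - W s x) <= s * kappa * enorm v ^+ 2.

(** The squared distance of two trajectories grows at rate at most 2 t kappa, whose integral over a
    subinterval of [0, 1] is at most kappa; the square root halves the exponent. Only the one-sided
    bound enters, so the constant does not involve L or n. *)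
Lemma flow_lipschitz s0 s : 0 <= s0 -> s0 <= s -> s <= 1 ->
  elipschitz (expR (kappa / 2)) (flow s0 s).
Proof.
move=> s00 s0s s1 x y.
pose u t := dot (flow s0 t x - flow s0 t y) (flow s0 t x - flow s0 t y).
pose u' t := 2 * dot (flow s0 t x - flow s0 t y)
  (W t (flow s0 t x) - W t (flow s0 t y)).
have du t : is_derive t (1 : R) u (u' t).
  have d := is_deriveB (is_derive_flow s0 t x) (is_derive_flow s0 t y).
  apply: is_derive_eq; first exact: (is_derive_dot d d).
  by rewrite dotC -mulr2n -mulr_natl.
have dK (t : R) : is_derive t (1 : R) (fun t => kappa * (t * t)) (2 * (t * kappa)).
  have d := is_derive_mul (is_derive_id t (1 : R)) (is_derive_id t (1 : R)).
  have := is_deriveZ kappa d; rewrite /GRing.scale/= mul1r mulr1.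
  by rewrite (_ : kappa * _ = 2 * (t * kappa))//; ring.
have := @Gronwall _ u u' (fun t => 2 * (t * kappa)) (fun t => kappa * (t * t))
  s0 s s0s.
have -> : u s0 = enorm (x - y) ^+ 2 by rewrite /u !flow_id dot_enorm.
have -> : u s = enorm (flow s0 s x - flow s0 s y) ^+ 2 by rewrite /u dot_enorm.
move=> h.
rewrite -ler_sqr ?nnegrE ?mulr_ge0 ?enorm_ge0 ?expR_ge0//.
apply: (le_trans (h _ _ dK _)) => //.
- by apply: continuous_subspaceT => t; exact: is_derive_continuous (du t).
- move=> t /andP[s0t ts].
  have := @oslW t (flow s0 t y) (flow s0 t x - flow s0 t y).
  rewrite [flow s0 t y + _]addrC subrK => osl.
  rewrite /u' /u -mulrA ler_pM2l// dot_enorm; apply: osl.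
  by rewrite (le_trans s00) ?(ltW s0t)//= (le_trans (ltW ts)).
- rewrite exprMn mulrC ler_wpM2r ?sqr_ge0// -expRM_natr ler_expR.
  have : kappa * (s * s - s0 * s0) <= kappa * 1.
    by rewrite ler_wpM2l//; nra.
  by lra.
Qed.

Section Linearization.
Variables (B : R -> 'rV[R]_n -> 'M[R]_n) (C : R).
Hypothesis C_ge0 : 0 <= C.
Hypothesis W_taylor : forall s x v,
  enorm (W s (x + v) - W s x - v *m B s x) <= C * enorm v ^+ 2.
Hypothesis B_bound : forall s x v, enorm (v *m B s x) <= C * enorm v.

Definition flow_taylor_cst := C * expR kappa * expR ((1 + 2 * C) / 2).

(** The error e between the displacement of the trajectory and the solution a of the variational
    equation satisfies |e'| <= c + C |e| and e(s0) = 0, where c = C exp(kappa) |v|^2 is the Taylor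
    remainder of W along a displacement of size at most exp(kappa / 2) |v|. *)
Lemma flow_linearization s0 s x v (a : R -> 'rV[R]_n) :
  0 <= s0 -> s0 <= s -> s <= 1 ->
  a s0 = v ->
  (forall t, is_derive t (1 : R) a (a t *m B t (flow s0 t x))) ->
  enorm (flow s0 s (x + v) - flow s0 s x - a s) <= flow_taylor_cst * enorm v ^+ 2.
Proof.
move=> s00 s0s s1 av da.
pose D t := flow s0 t (x + v) - flow s0 t x.
pose e t := D t - a t.
pose e' t := W t (flow s0 t (x + v)) - W t (flow s0 t x) - a t *m B t (flow s0 t x).
have de t : is_derive t (1 : R) e (e' t).
  have d := is_deriveB (is_derive_flow s0 t (x + v)) (is_derive_flow s0 t x).
  exact: is_deriveB d (da t).
pose c := C * expR kappa * enorm v ^+ 2.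
have De t : s0 < t < s -> enorm (e' t) <= c + C * enorm (e t).
  move=> /andP[s0t ts].
  have -> : e' t = (W t (flow s0 t x + D t) - W t (flow s0 t x) -
      D t *m B t (flow s0 t x)) + e t *m B t (flow s0 t x).
    by rewrite /e' /e (mulmxBl (D t) (a t)) subrKA /D [flow s0 t x + _]addrC subrK.
  rewrite (le_trans (ler_enormD _ _))// lerD//.
  rewrite (le_trans (W_taylor _ _ _))// /c -mulrA ler_wpM2l//.
  have := flow_lipschitz s00 (ltW s0t) (le_trans (ltW ts) s1) (x + v) x.
  rewrite addrAC subrr add0r -/(D t) => Dt.
  rewrite (_ : expR kappa = expR (kappa / 2) ^+ 2); last first.
    by rewrite -expRM_natr divfK.
  by rewrite -exprMn ler_sqr ?nnegrE ?mulr_ge0 ?enorm_ge0 ?expR_ge0.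
(* Adding c^2 absorbs the cross term 2 c |e| <= |e|^2 + c^2, so u' <= (1 + 2 C) u; this is the
   origin of the last factor of [flow_taylor_cst]. *)
pose u t := dot (e t) (e t) + c ^+ 2.
have du t : is_derive t (1 : R) u (2 * dot (e t) (e' t)).
  have d : is_derive t (1 : R) (fun t => dot (e t) (e t)) (2 * dot (e t) (e' t)).
    apply: is_derive_eq; first exact: (is_derive_dot (de t) (de t)).
    by rewrite (dotC (e' t)) [RHS]mulr_natl mulr2n.
  by have := is_derive_add d (is_derive_cst (c ^+ 2) t (1 : R)); rewrite addr0.
have dK (t : R) : is_derive t (1 : R) (fun t => (1 + 2 * C) * t) (1 + 2 * C).
  have := is_deriveZ (1 + 2 * C) (is_derive_id t (1 : R)).
  by rewrite /GRing.scale/= mulr1.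
have := @Gronwall _ u _ (fun t => 1 + 2 * C) _ s0 s s0s _ (fun t _ => du t) dK.
have -> : u s0 = c ^+ 2.
  have e0 : e s0 = 0 by rewrite /e /D !flow_id av [x + v]addrC addrK subrr.
  by rewrite /u e0 dot_enorm enorm0 expr0n add0r.
have -> : u s = enorm (e s) ^+ 2 + c ^+ 2 by rewrite /u dot_enorm.
have c0 : 0 <= c := mulr_ge0 (mulr_ge0 C_ge0 (expR_ge0 _)) (sqr_ge0 _).
move=> h; rewrite -/(D s) -/(e s) /flow_taylor_cst.
rewrite mulrAC -/c.
rewrite -ler_sqr ?nnegrE ?mulr_ge0 ?enorm_ge0 ?expR_ge0//.
apply: (@le_trans _ _ (c ^+ 2 * expR ((1 + 2 * C) * s - (1 + 2 * C) * s0))).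
  rewrite (le_trans _ (h _ _)) ?lerDl ?sqr_ge0//.
    by apply: continuous_subspaceT => t; exact: is_derive_continuous (du t).
  move=> t ts; have := De t ts => ee.
  have := le_trans (ler_norm _) (CauchySchwarz_dot (e t) (e' t)).
  rewrite /u dot_enorm; have := ler_wpM2l (enorm_ge0 (e t)) ee.
  by have := mulr_ge0 C_ge0 (sqr_ge0 c); have := sqr_ge0 (enorm (e t) - c); nra.
rewrite [leRHS]exprMn ler_wpM2l ?sqr_ge0// -expRM_natr ler_expR divfK// -mulrBr.
by rewrite ler_piMr ?addr_ge0 ?mulr_ge0//; lra.
Qed.

Hypothesis cB : forall (X : R -> 'rV[R]_n) (v : 'rV[R]_n), continuous X -> continuous (fun s => v *m B s (X s)).

(** The matrix is the fundamental solution of the variational equation: its row i is the solution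
    that starts from the i-th basis vector. It exists because the linear equation has bounded
    coefficients, continuous in time along the trajectory. *)
Lemma flow_taylor s0 s x : 0 <= s0 -> s0 <= s -> s <= 1 ->
  exists A : 'M[R]_n, forall v,
    enorm (flow s0 s (x + v) - flow s0 s x - v *m A) <= flow_taylor_cst * enorm v ^+ 2.
Proof.
move=> s00 s0s s1.
pose W' t (a : 'rV[R]_n) := a *m B t (flow s0 t x).
have cW' a : continuous (W' ^~ a) by apply: cB; exact: continuous_flow_time.
pose L' := C * n%:R + 1.
have L'0 : 0 < L' by rewrite ltr_wpDl// mulr_ge0.
have bW' t a : `|W' t a| <= L' * `|a|.
  rewrite (le_trans (ler_norm_enorm _))// (le_trans (B_bound _ _ _))//.
  rewrite (le_trans (ler_wpM2l C_ge0 (ler_enorm_norm a)))// mulrA ler_wpM2r//.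
  by rewrite lerDl.
have lipW' t a b : `|W' t a - W' t b| <= L' * `|a - b|.
  by rewrite /W' -mulmxBl bW'.
have bW'' a : exists C', forall t, `|W' t a| <= C' by exists (L' * `|a|).
have /choice[a /all_and2[a0 da]] i :=
  Picard_Lindelof L'0 cW' lipW' bW'' s0 (delta_mx 0 i : 'rV[R]_n).
exists (\matrix_(i, j) a i s 0 j) => v.
apply: (@flow_linearization s0 s x v (fun t => v *m \matrix_(i, j) a i t 0 j)) => //.
  rewrite -[RHS]mulmx1; congr (_ *m _); apply/matrixP => i j.
  by rewrite !mxE a0 mxE eqxx/= eq_sym.
move=> t; apply/is_derive_coordP => j.
have d i : is_derive t (1 : R) (fun t => v 0 i * a i t 0 j)
    (v 0 i * (a i t *m B t (flow s0 t x)) 0 j).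
  have /is_derive_coordP/(_ j) h := da i t.
  by have := is_deriveZ (v 0 i) h.
have := is_derive_sum (h := fun i t => v 0 i * a i t 0 j) d.
congr (is_derive _ _ _ _).
  by apply/funext => z; rewrite fct_sumE mxE; apply: eq_bigr => i _; rewrite mxE.
rewrite -mulmxA mxE; apply: eq_bigr => i _; congr (_ * _).
by rewrite !mxE; apply: eq_bigr => k _; rewrite mxE.
Qed.

End Linearization.
End Lipschitz.

Section TimeRegularity.
Variable M : R.
Hypothesis M_bound : forall s x, enorm (W s x) <= M.

Let M_ge0 : 0 <= M := le_trans (enorm_ge0 _) (M_bound 0 0).

Lemma flow_time_lipschitz s0 s x : s0 <= s ->
  `|flow s0 s x - x| <= M * (s - s0).
Proof.
move=> s0s; apply: norm_le_coord => [|i]; first by rewrite mulr_ge0 ?subr_ge0.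
have du t := (is_derive_coordP _ _ _).1 (is_derive_flow s0 t x) i.
have -> : (flow s0 s x - x) 0 i = flow s0 s x 0 i - flow s0 s0 x 0 i.
  by rewrite flow_id !mxE.
apply: (ler_norm_is_derive s0s du) => t _.
exact: le_trans (ler_coord_enorm _ _) (M_bound _ _).
Qed.

(** The growth factor 1 + |x| is inherited from the variation of W in time, which is linear in x; a
    first Gaussian moment absorbs it later. *)
Lemma flow_time_taylor (C : R) s0 s x : 0 <= C -> s0 <= s ->
  (forall t, enorm (W t x - W s0 x) <= C * (1 + enorm x) * `|t - s0|) ->
  enorm (flow s0 s x - x - (s - s0) *: W s0 x) <=
    n%:R * (L * M + C) * (1 + enorm x) * (s - s0) ^+ 2.
Proof.
move=> C0 s0s WC.
have x1 : 1 <= 1 + enorm x by rewrite lerDl enorm_ge0.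
have x0 : 0 <= 1 + enorm x by rewrite (le_trans _ x1).
rewrite -!mulrA; apply: enorm_le_coord.
  apply: mulr_ge0; last by apply: mulr_ge0 (sqr_ge0 _).
  by apply: addr_ge0 => //; apply: mulr_ge0 => //; exact: ltW.
move=> i; rewrite !mxE.
pose u t := flow s0 t x 0 i + (- W s0 x 0 i) * t.
have du t : is_derive t (1 : R) u (W t (flow s0 t x) 0 i + (- W s0 x 0 i)).
  apply: is_derive_add.
    exact: (is_derive_coordP _ _ _).1 (is_derive_flow s0 t x) i.
  have := is_deriveZ (- W s0 x 0 i) (is_derive_id t (1 : R)).
  by rewrite /GRing.scale/= mulr1.
have -> : flow s0 s x 0 i - x 0 i - (s - s0) * W s0 x 0 i = u s - u s0.
  by rewrite /u flow_id; ring.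
rewrite expr2 !mulrA; apply: (ler_norm_is_derive s0s du) => t /andP[s0t ts].
have -> : W t (flow s0 t x) 0 i + (- W s0 x 0 i) =
    (W t (flow s0 t x) - W t x) 0 i + (W t x - W s0 x) 0 i.
  by rewrite !mxE subrKA.
rewrite (le_trans (ler_normD _ _))//.
have h1 : `|(W t (flow s0 t x) - W t x) 0 i| <= L * (M * (s - s0)).
  rewrite (le_trans (ler_coord_norm _ _))// (le_trans (lipW _ _ _))//.
  rewrite ler_pM2l// (le_trans (flow_time_lipschitz _ s0t))//.
  by rewrite ler_wpM2l// lerD2r.
have h2 : `|(W t x - W s0 x) 0 i| <= C * (1 + enorm x) * (s - s0).
  rewrite (le_trans (ler_coord_enorm _ _))// (le_trans (WC t))//.
  by rewrite ler_wpM2l ?mulr_ge0// ger0_norm ?subr_ge0// lerD2r.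
have h3 : L * (M * (s - s0)) <= L * (M * (s - s0)) * (1 + enorm x).
  by rewrite ler_peMr// !mulr_ge0 ?subr_ge0// ltW.
have -> : (L * M + C) * (1 + enorm x) * (s - s0) =
  L * (M * (s - s0)) * (1 + enorm x) + C * (1 + enorm x) * (s - s0) by ring.
by rewrite lerD// (le_trans h1).
Qed.

End TimeRegularity.
End Flow.

(** * Exponentially tilted expectations *)

Section ExponentialBounds.
Context {R : realType}.

Lemma expR_le_inv (u : R) : u < 1 -> expR u <= (1 - u)^-1.
Proof.
move=> u1; rewrite -[u in expR u]opprK expRN lef_pV2 ?posrE ?expR_gt0 ?subr_gt0//.
exact: expR_ge1Dx.
Qed.

(** From e^u <= 1 / (1 - u) and (1 - u)(1 + u + 2 u^2) = 1 + u^2 (1 - 2 u) >= 1. *)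
Lemma expR_quad (u : R) : `|u| <= 2^-1 -> `|expR u - 1 - u| <= 2 * u ^+ 2.
Proof.
rewrite ler_norml => /andP[u1 u2].
have e1 := expR_ge1Dx u.
have p : 0 < 1 - u by lra.
rewrite ger0_norm; last by lra.
have -> : expR u - 1 - u <= 2 * u ^+ 2 = (expR u <= 1 + u + 2 * u ^+ 2) by lra.
rewrite (le_trans (expR_le_inv _))//; first by lra.
rewrite -(ler_pM2r p) mulVf ?gt_eqF//; nra.
Qed.

Lemma expR_lin (u : R) : `|u| <= 2^-1 -> `|expR u - 1| <= 2 * `|u|.
Proof.
move=> u1; have -> : expR u - 1 = (expR u - 1 - u) + u by ring.
rewrite (le_trans (ler_normD _ _))// (le_trans (lerD (expR_quad u1) (lexx _)))//.
rewrite -[u ^+ 2]real_normK ?num_real//.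
by have := normr_ge0 u; nra.
Qed.

(** Turns an explicit quadratic remainder into a derivative; it replaces differentiation under the
    integral sign for tilted means and for the density. *)
Lemma is_derive_quadratic (f : R -> R) (x l C e : R) : 0 < e ->
  (forall h, `|h| <= e -> `|f (x + h) - f x - h * l| <= C * h ^+ 2) ->
  is_derive x (1 : R) f l.
Proof.
move=> e0 fC.
suff cv : h^-1 *: (f (h *: (1 : R) + x) - f x) @[h --> 0^'] --> l.
  apply: DeriveDef; last exact: cvg_lim cv.
  by apply/cvg_ex; exists l.
apply/cvgrPdist_le => eps eps0.
near=> h.
have h0 : h != 0 by near: h; exact: nbhs_dnbhs_neq.
have he : `|h| <= e.
  by near: h; exact: dnbhs0_le.
have hC : `|h| * (`|C| + 1) <= eps.
  rewrite -ler_pdivlMr ?ltr_wpDl//; near: h; apply: dnbhs0_le.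
  by rewrite divr_gt0// ltr_wpDl.
have -> : l - h^-1 *: (f (h *: (1 : R) + x) - f x) =
    - (h^-1 * (f (x + h) - f x - h * l)).
  rewrite /GRing.scale/= mulr1 [h + x]addrC; field.
  exact: h0.
rewrite normrN normrM normfV ler_pdivrMl ?normr_gt0//.
apply: (le_trans (fC h he)).
rewrite -[h ^+ 2]real_normK ?num_real//.
have := ler_norm C; have := normr_ge0 h; have := normr_ge0 C; nra.
Unshelve. all: by end_near. Qed.

End ExponentialBounds.

(** * Bounded measurable functions and their expectations *)

Section BoundedMeasurable.
Context {d : measure_display} {T : measurableType d} {R : realType}.
Implicit Types (f g h : T -> R).

(** A class stable under the operations used here and integrable for every probability measure, so
    that linearity and monotonicity of expectations leave no separate integrability conditions. *)
Definition bmeas h : Prop :=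
  measurable_fun [set: T] h /\ exists M, forall w, `|h w| <= M.

Lemma bmeas_cst (c : R) : bmeas (fun=> c).
Proof. by split; [exact: measurable_cst|exists `|c|]. Qed.

Lemma bmeasD f g : bmeas f -> bmeas g -> bmeas (fun w => f w + g w).
Proof.
move=> [mf [M fM]] [mg [N gN]]; split; first exact: measurable_funD.
by exists (M + N) => w; rewrite (le_trans (ler_normD _ _))// lerD.
Qed.

Lemma bmeasM f g : bmeas f -> bmeas g -> bmeas (fun w => f w * g w).
Proof.
move=> [mf [M fM]] [mg [N gN]]; split; first exact: measurable_funM.
by exists (M * N) => w; rewrite normrM ler_pM.
Qed.

Lemma bmeasZ (c : R) f : bmeas f -> bmeas (fun w => c * f w).
Proof. exact: bmeasM (bmeas_cst c). Qed.

Lemma bmeasN f : bmeas f -> bmeas (fun w => - f w).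
Proof.
move=> /(bmeasZ (-1)); rewrite (_ : (fun w => -1 * f w) = fun w => - f w)//.
by apply/funext => w; rewrite mulN1r.
Qed.

Lemma bmeasB f g : bmeas f -> bmeas g -> bmeas (fun w => f w - g w).
Proof. by move=> mf /bmeasN; exact: bmeasD. Qed.

Lemma bmeas_expR f : bmeas f -> bmeas (fun w => expR (f w)).
Proof.
move=> [mf [M fM]]; split; first exact: measurableT_comp.
exists (expR M) => w; rewrite ger0_norm ?expR_ge0// ler_expR.
exact: le_trans (ler_norm _) (fM w).
Qed.

Lemma bmeas_sum n (f : 'I_n -> T -> R) : (forall i, bmeas (f i)) ->
  bmeas (fun w => \sum_(i < n) f i w).
Proof.
elim: n f => [|n IH] f mf.
  rewrite (_ : (fun _ => _) = fun=> 0); first exact: bmeas_cst.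
  by apply/funext => w; rewrite big_ord0.
rewrite (_ : (fun _ => _) = fun w => f ord0 w + \sum_(i < n) f (lift ord0 i) w).
  by apply: bmeasD => //; exact: IH.
by apply/funext => w; rewrite big_ord_recl.
Qed.

Variable P : probability T R.

Lemma bmeas_integrable f : bmeas f -> P.-integrable [set: T] (EFin \o f).
Proof.
move=> [mf [M fM]]; apply: (@le_integrable _ _ _ _ _ _ _ (EFin \o cst M)) => //.
- exact/measurable_EFinP.
- by move=> w _ /=; rewrite lee_fin (le_trans (fM w))// ler_norm.
- exact: finite_measure_integrable_cst.
Qed.

Definition Ex h : R := \int[P]_w h w.

Lemma Ex_cst (c : R) : Ex (fun=> c) = c.
Proof. by rewrite /Ex Rintegral_cst//= [P _]probability_setT mulr1. Qed.

Lemma ExD f g : bmeas f -> bmeas g -> Ex (fun w => f w + g w) = Ex f + Ex g.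
Proof. by move=> mf mg; rewrite /Ex RintegralD//; exact: bmeas_integrable. Qed.

Lemma ExZ (c : R) f : bmeas f -> Ex (fun w => c * f w) = c * Ex f.
Proof. by move=> mf; rewrite /Ex RintegralZl//; exact: bmeas_integrable. Qed.

Lemma ExB f g : bmeas f -> bmeas g -> Ex (fun w => f w - g w) = Ex f - Ex g.
Proof. by move=> mf mg; rewrite /Ex RintegralB//; exact: bmeas_integrable. Qed.

Lemma ler_Ex f g : bmeas f -> bmeas g -> (forall w, f w <= g w) -> Ex f <= Ex g.
Proof. by move=> mf mg fg; apply: le_Rintegral => //; exact: bmeas_integrable. Qed.

End BoundedMeasurable.

(** * Expectations reweighted by exp(q), and their dependence on q *)

Section Tilt.
Context {d : measure_display} {T : measurableType d} {R : realType}.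
Variable P : probability T R.
Implicit Types (q u h : T -> R).

Definition partition_fun q : R := Ex P (fun w => expR (q w)).

Definition tilt q h : R :=
  Ex P (fun w => h w * expR (q w)) / partition_fun q.

Lemma partition_fun_gt0 q : bmeas q -> 0 < partition_fun q.
Proof.
move=> mq; have [_ [M qM]] := mq.
apply: (@lt_le_trans _ _ (expR (- M))); first exact: expR_gt0.
rewrite -[leLHS](Ex_cst P); apply: ler_Ex; [exact: bmeas_cst|exact: bmeas_expR|].
by move=> w; rewrite ler_expR; have := qM w; rewrite ler_norml => /andP[].
Qed.

Section FixedWeight.
Variable q : T -> R.
Hypothesis mq : bmeas q.

Let pf0 : partition_fun q != 0.
Proof. by rewrite gt_eqF// partition_fun_gt0. Qed.

Let bm h : bmeas h -> bmeas (fun w => h w * expR (q w)).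
Proof. by move=> mh; apply: bmeasM => //; exact: bmeas_expR. Qed.

Lemma tilt_cst (c : R) : tilt q (fun=> c) = c.
Proof. by rewrite /tilt ExZ ?mulfK//; exact: bmeas_expR. Qed.

Lemma tiltD f g : bmeas f -> bmeas g ->
  tilt q (fun w => f w + g w) = tilt q f + tilt q g.
Proof.
move=> mf mg; rewrite /tilt -mulrDl -ExD; [|exact: bm|exact: bm].
by congr (Ex P _ / _); apply/funext => w; rewrite mulrDl.
Qed.

Lemma tiltZ (c : R) f : bmeas f -> tilt q (fun w => c * f w) = c * tilt q f.
Proof.
move=> mf; rewrite /tilt mulrA -ExZ; last exact: bm.
by congr (Ex P _ / _); apply/funext => w; rewrite mulrA.
Qed.

Lemma tiltB f g : bmeas f -> bmeas g ->
  tilt q (fun w => f w - g w) = tilt q f - tilt q g.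
Proof.
move=> mf mg; rewrite /tilt -mulrBl -ExB; [|exact: bm|exact: bm].
by congr (Ex P _ / _); apply/funext => w; rewrite mulrBl.
Qed.

Lemma ler_tilt f g : bmeas f -> bmeas g -> (forall w, f w <= g w) ->
  tilt q f <= tilt q g.
Proof.
move=> mf mg fg; rewrite ler_pM2r ?invr_gt0 ?partition_fun_gt0//.
by apply: ler_Ex; [exact: bm|exact: bm|move=> w; rewrite ler_wpM2r ?expR_ge0].
Qed.

Lemma ler_norm_tilt f M : bmeas f -> (forall w, `|f w| <= M) ->
  `|tilt q f| <= M.
Proof.
move=> mf fM; rewrite ler_norml; apply/andP; split.
  rewrite -(tilt_cst (- M)); apply: ler_tilt => //; first exact: bmeas_cst.
  by move=> w; have := fM w; rewrite ler_norml => /andP[].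
rewrite -(tilt_cst M); apply: ler_tilt => //; first exact: bmeas_cst.
by move=> w; have := fM w; rewrite ler_norml => /andP[].
Qed.

Lemma partition_fun_shift u : bmeas u ->
  partition_fun (fun w => q w + u w) = partition_fun q * tilt q (fun w => expR (u w)).
Proof.
move=> mu; rewrite /tilt mulrC divfK//; congr (Ex P _).
by apply/funext => w; rewrite expRD mulrC.
Qed.

Lemma tilt_shift u h : bmeas u -> bmeas h ->
  tilt (fun w => q w + u w) h =
  tilt q (fun w => h w * expR (u w)) / tilt q (fun w => expR (u w)).
Proof.
move=> mu mh; rewrite {1}/tilt partition_fun_shift// invfM mulrA.
suff -> : (fun w => h w * expR (q w + u w)) =
    (fun w => h w * expR (u w) * expR (q w)) by [].
by apply/funext => w; rewrite expRD [expR (q w) * _]mulrC mulrA.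
Qed.

Definition tilt_cov h u := tilt q (fun w => h w * u w) - tilt q h * tilt q u.

Lemma tilt_covE h u : bmeas h -> bmeas u ->
  tilt_cov h u = tilt q (fun w => (h w - tilt q h) * u w).
Proof.
move=> mh mu; rewrite /tilt_cov -tiltZ// -tiltB; [|exact: bmeasM|exact: bmeasZ].
by congr (tilt q _); apply/funext => w; rewrite mulrBl.
Qed.

Section Perturbation.
Variables (u h : T -> R) (M e : R).
Hypotheses (mu : bmeas u) (mh : bmeas h).
Hypotheses (hM : forall w, `|h w| <= M) (ue : forall w, `|u w| <= e).

Let M0 : 0 <= M.
Proof.
by have := ler_norm_tilt mh hM; exact: le_trans (normr_ge0 _).
Qed.

Let e0 : 0 <= e.
Proof.
by have := ler_norm_tilt mu ue; exact: le_trans (normr_ge0 _).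
Qed.

Let m := tilt q h.

Let hm w : `|h w - m| <= 2 * M.
Proof.
rewrite (le_trans (ler_normB _ _))// mulr_natl mulr2n lerD//.
exact: ler_norm_tilt.
Qed.

Let mhm : bmeas (fun w => h w - m).
Proof. by apply: bmeasB => //; exact: bmeas_cst. Qed.

Let meu : bmeas (fun w => expR (u w)). Proof. exact: bmeas_expR. Qed.

Let me1 : bmeas (fun w => expR (u w) - 1).
Proof. by apply: bmeasB => //; exact: bmeas_cst. Qed.

Let mqu : bmeas (fun w => q w + u w). Proof. exact: bmeasD. Qed.

Lemma ler_norm_tilt_cov : `|tilt_cov h u| <= 2 * M * e.
Proof.
rewrite tilt_covE//; apply: ler_norm_tilt; first exact: bmeasM.
by move=> w; rewrite normrM ler_pM.
Qed.

Section SmallPerturbation.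
Hypothesis e_small : e <= 2^-1.

Let us w : `|u w| <= 2^-1. Proof. exact: le_trans (ue w) e_small. Qed.

Let D := tilt q (fun w => expR (u w)).

Let D_ge : 2^-1 <= D.
Proof.
rewrite -[leLHS]tilt_cst; apply: ler_tilt => //; first exact: bmeas_cst.
move=> w; apply: le_trans (expR_ge1Dx _).
by have := us w; rewrite ler_norml => /andP[]; lra.
Qed.

Let D0 : D != 0.
Proof. by rewrite gt_eqF// (lt_le_trans _ D_ge). Qed.

(** Since h - m has tilted mean 0, e^u may be replaced by e^u - 1, which is of the order of u. *)
Let diffE : tilt (fun w => q w + u w) h - m =
  tilt q (fun w => (h w - m) * (expR (u w) - 1)) / D.
Proof.
rewrite tilt_shift// -/D; apply: (mulIf D0); rewrite mulrBl !divfK//.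
have -> : (fun w => (h w - m) * (expR (u w) - 1)) =
    (fun w => (h w * expR (u w) - m * expR (u w)) - (h w - m)).
  by apply/funext => w; ring.
rewrite tiltB//; last by apply: bmeasB; [exact: bmeasM|exact: bmeasZ].
rewrite (tiltB (bmeasM mh meu) (bmeasZ m meu)).
rewrite tiltZ// tiltB//; last exact: bmeas_cst.
by rewrite tilt_cst -/m -/D subrr subr0.
Qed.

(** The integrand in [diffE] is at most 2 M * 2 e, and D >= 1/2 because e^u >= 1 + u. *)
Lemma tilt_lipschitz_small : `|tilt (fun w => q w + u w) h - tilt q h| <= 8 * M * e.
Proof.
rewrite -/m diffE normrM normfV ler_pdivrMr ?normr_gt0//.
apply: (@le_trans _ _ (2 * M * (2 * e))).
  apply: ler_norm_tilt; first exact: bmeasM.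
  move=> w; rewrite normrM ler_pM// (le_trans (expR_lin (us w)))//.
  by rewrite ler_pM2l.
have := le_trans D_ge (ler_norm D); have := mulr_ge0 M0 e0; nra.
Qed.

(** Split e^u - 1 = u + rho with |rho| <= 2 e^2. The part rho and the replacement of the denominator
    D by 1 contribute 4 M e^2 each, and dividing by D >= 1/2 at most doubles the sum. *)
Lemma tilt_taylor_small :
  `|tilt (fun w => q w + u w) h - tilt q h - tilt_cov h u| <= 16 * M * e ^+ 2.
Proof.
rewrite -/m; pose rho w := expR (u w) - 1 - u w.
have mrho : bmeas rho by exact: bmeasB.
pose r := tilt q (fun w => (h w - m) * rho w).
have -> : tilt (fun w => q w + u w) h - m - tilt_cov h u =
    (r + tilt_cov h u * (1 - D)) / D.
  apply: (mulIf D0); rewrite diffE mulrBl !divfK//.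
  have -> : tilt q (fun w => (h w - m) * (expR (u w) - 1)) = tilt_cov h u + r.
    rewrite tilt_covE// -tiltD; [|exact: bmeasM|exact: bmeasM].
    by congr (tilt q _); apply/funext => w; rewrite -/m /rho; ring.
  by ring.
rewrite normrM normfV ler_pdivrMr ?normr_gt0//.
have rb : `|r| <= 2 * M * (2 * e ^+ 2).
  apply: ler_norm_tilt; first exact: bmeasM.
  move=> w; rewrite normrM ler_pM// (le_trans (expR_quad (us w)))//.
  rewrite ler_pM2l// -[leLHS]real_normK ?num_real//.
  by rewrite ler_sqr ?nnegrE.
have Db : `|1 - D| <= 2 * e.
  rewrite distrC -[X in D - X]tilt_cst -tiltB//; last exact: bmeas_cst.
  apply: ler_norm_tilt => // w.
  by rewrite (le_trans (expR_lin (us w)))// ler_pM2l.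
have cb := ler_norm_tilt_cov.
rewrite (le_trans (ler_normD _ _))// (normrM (tilt_cov h u)).
apply: (@le_trans _ _ (2 * M * (2 * e ^+ 2) + 2 * M * e * (2 * e))).
  by rewrite lerD// ler_pM.
have := le_trans D_ge (ler_norm D); have := mulr_ge0 M0 (sqr_ge0 e); nra.
Qed.

End SmallPerturbation.

End Perturbation.
End FixedWeight.

Lemma tilt_lipschitz q u h M e : bmeas q -> bmeas u -> bmeas h ->
  (forall w, `|h w| <= M) -> (forall w, `|u w| <= e) ->
  `|tilt (fun w => q w + u w) h - tilt q h| <= 8 * M * e.
Proof.
move=> mq mu mh hM ue.
have [es|es] := leP e 2^-1; first exact: tilt_lipschitz_small.
rewrite (le_trans (ler_normB _ _))//.
have := ler_norm_tilt mq mh hM; have := ler_norm_tilt (bmeasD mq mu) mh hM.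
by have := normr_ge0 (tilt q h); nra.
Qed.

(** For e > 1/2 the trivial bound 2 M + 2 M e is already below 16 M e^2. Removing the smallness
    condition makes the expansion of the field valid for all displacements, as [C11] and
    [flow_linearization] require. *)
Lemma tilt_taylor q u h M e : bmeas q -> bmeas u -> bmeas h ->
  (forall w, `|h w| <= M) -> (forall w, `|u w| <= e) ->
  `|tilt (fun w => q w + u w) h - tilt q h - tilt_cov q h u| <= 16 * M * e ^+ 2.
Proof.
move=> mq mu mh hM ue.
have [es|es] := leP e 2^-1; first exact: tilt_taylor_small.
have h1 := ler_norm_tilt mq mh hM.
have h2 := ler_norm_tilt (bmeasD mq mu) mh hM.
have h3 := ler_norm_tilt_cov mq mu mh hM ue.
rewrite (le_trans (ler_normB _ _))// (le_trans (lerD (ler_normB _ _) h3))//.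
have M0 : 0 <= M := le_trans (normr_ge0 _) h1.
have : M * e <= M * (2 * e ^+ 2) by apply: ler_wpM2l => //; nra.
have : M <= M * (4 * e ^+ 2) by rewrite ler_peMr//; nra.
by lra.
Qed.

(* Popoviciu's inequality *)
Lemma tilt_var_le q h rho : bmeas q -> bmeas h ->
  (forall w w', `|h w - h w'| <= rho) -> tilt_cov q h h <= rho ^+ 2 / 4.
Proof.
move=> mq mh hrho.
have [_ [M hM]] := mh.
pose S := range h.
have [w0 _] : [set: T] !=set0.
  apply/set0P/eqP => T0; have := probability_setT P.
  by rewrite T0 measure0 => /eqP; rewrite eqe eq_sym oner_eq0.
have S0 : S !=set0 by exists (h w0), w0.
have ubS : has_ubound S by exists M => _ [w _ <-]; exact: le_trans (ler_norm _) (hM w).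
have lbS : has_lbound S.
  by exists (- M) => _ [w _ <-]; have := hM w; rewrite ler_norml => /andP[].
(* The variance is at most the second moment about the midpoint c of the range, from which h
   deviates by at most rho / 2. *)
pose c := (sup S + inf S) / 2.
have osc : sup S - inf S <= rho.
  rewrite lerBlDr; apply: ge_sup => // _ [w _ <-].
  rewrite -lerBlDl; apply: lb_le_inf => // _ [w' _ <-].
  by rewrite lerBlDl -lerBlDr (le_trans (ler_norm _)).
have hc w : `|h w - c| <= rho / 2.
  have h1 : h w <= sup S by apply: ub_le_sup => //; exists w.
  have h2 : inf S <= h w by apply: ge_inf => //; exists w.
  rewrite ler_norml /c; apply/andP; split; lra.
have mhc : bmeas (fun w => h w - c) by apply: bmeasB => //; exact: bmeas_cst.
have -> : tilt_cov q h h = tilt q (fun w => (h w - c) * (h w - c)) -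
    tilt q (fun w => h w - c) ^+ 2.
  have -> : (fun w => (h w - c) * (h w - c)) =
      (fun w => (h w * h w - 2 * c * h w) + c ^+ 2).
    by apply/funext => w; ring.
  have mhh : bmeas (fun w => h w * h w) by exact: bmeasM.
  have mch : bmeas (fun w => 2 * c * h w) by exact: bmeasZ.
  rewrite (tiltD mq (bmeasB mhh mch) (bmeas_cst (c ^+ 2))) (tiltB mq mhh mch).
  rewrite (tiltZ mq) // (tiltB mq mh (bmeas_cst c)) !(tilt_cst mq) /tilt_cov; ring.
apply: (@le_trans _ _ (tilt q (fun w => (h w - c) * (h w - c)))).
  by rewrite gerBl sqr_ge0.
rewrite (le_trans (ler_norm _))//; apply: ler_norm_tilt => //; first exact: bmeasM.
move=> w; rewrite normrM (_ : rho ^+ 2 / 4 = rho / 2 * (rho / 2)); last by field.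
by rewrite ler_pM.
Qed.

(* The derivative of the tilted mean is the tilted variance. *)
Lemma tilt_monotone q h rho s : bmeas q -> bmeas h -> 0 <= s ->
  (forall w w', `|h w - h w'| <= rho) ->
  tilt (fun w => q w + s * h w) h - tilt q h <= s * (rho ^+ 2 / 4).
Proof.
move=> mq mh s0 hrho.
have [_ [M hM]] := mh.
pose phi t := tilt (fun w => q w + t * h w) h.
have mqt t : bmeas (fun w => q w + t * h w) by apply: bmeasD => //; exact: bmeasZ.
have dphi (t : R) : is_derive t (1 : R) phi (tilt_cov (fun w => q w + t * h w) h h).
  apply: (@is_derive_quadratic _ _ _ _ (16 * M * M ^+ 2) 1) => // k _.
  have mk : bmeas (fun w => k * h w) by exact: bmeasZ.
  have kM w : `|k * h w| <= `|k| * M by rewrite normrM ler_wpM2l.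
  have := tilt_taylor (mqt t) mk mh hM kM.
  rewrite /phi exprMn real_normK ?num_real//.
  have -> : (fun w => q w + t * h w + k * h w) = (fun w => q w + (t + k) * h w).
    by apply/funext => w; ring.
  have -> : tilt_cov (fun w => q w + t * h w) h (fun w => k * h w) =
      k * tilt_cov (fun w => q w + t * h w) h h.
    have E : (fun w => h w * (k * h w)) = (fun w => k * (h w * h w)).
      by apply/funext => w; ring.
    by rewrite /tilt_cov E (tiltZ (mqt t) k (bmeasM mh mh)) (tiltZ (mqt t))//; ring.
  by rewrite (_ : 16 * M * (k ^+ 2 * M ^+ 2) = 16 * M * M ^+ 2 * k ^+ 2)//; ring.
have dv (t : R) : is_derive t (1 : R) (fun t : R => rho ^+ 2 / 4 * t) (rho ^+ 2 / 4).
  have := is_deriveZ (rho ^+ 2 / 4) (is_derive_id t (1 : R)).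
  by rewrite /GRing.scale/= mulr1.
have := ler_is_derive s0 dphi dv.
have q0 : (fun w => q w + 0 * h w) = q by apply/funext => w; rewrite mul0r addr0.
rewrite /phi q0 mulr0 subr0 => h1; rewrite [s * _]mulrC.
by apply: h1 => t _; exact: tilt_var_le.
Qed.

Lemma partition_fun_taylor q u e : bmeas q -> bmeas u ->
  (forall w, `|u w| <= e) -> e <= 2^-1 ->
  `|partition_fun (fun w => q w + u w) - partition_fun q -
    partition_fun q * tilt q u| <= 2 * partition_fun q * e ^+ 2.
Proof.
move=> mq mu ue e2.
have Z0 := partition_fun_gt0 mq.
have e0 : 0 <= e by have := ler_norm_tilt mq mu ue; exact: le_trans (normr_ge0 _).
rewrite partition_fun_shift//.
have mE := bmeas_expR mu.
have -> : partition_fun q * tilt q (fun w => expR (u w)) - partition_fun q -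
    partition_fun q * tilt q u =
    partition_fun q * tilt q (fun w => expR (u w) - 1 - u w).
  rewrite (tiltB mq (bmeasB mE (bmeas_cst 1)) mu) (tiltB mq mE (bmeas_cst 1)).
  by rewrite tilt_cst//; ring.
rewrite normrM gtr0_norm// mulrAC mulrC ler_pM2r//.
apply: ler_norm_tilt => //.
  by apply: bmeasB => //; apply: bmeasB => //; exact: bmeas_cst.
move=> w; rewrite (le_trans (expR_quad _))//; first by rewrite (le_trans (ue w)).
by rewrite ler_pM2l// -[leLHS]real_normK ?num_real// ler_sqr ?nnegrE.
Qed.

End Tilt.

(** * The velocity field in the variable s = exp(-t) *)

Section Clamp.
Context {R : realType}.
Implicit Types s t : R.

Definition clamp s : R := Num.max 0 (Num.min s 1).

Lemma clamp_itv s : 0 <= clamp s <= 1.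
Proof. by rewrite /clamp le_max lexx/= ge_max ler01 ge_min lexx orbT. Qed.

Lemma clamp_id s : 0 <= s <= 1 -> clamp s = s.
Proof. by move=> /andP[s0 s1]; rewrite /clamp min_l// max_r. Qed.

Lemma clampP s : [\/ clamp s = 0 /\ s <= 0, clamp s = s /\ 0 <= s <= 1 |
  clamp s = 1 /\ 1 <= s].
Proof.
rewrite /clamp; case: (leP s 1) => s1.
  by case: (leP 0 s) => s0; [constructor 2|constructor 1; split=> //; exact: ltW].
by constructor 3; rewrite max_r// ltW.
Qed.

Lemma clamp_lipschitz s t : `|clamp s - clamp t| <= `|s - t|.
Proof.
wlog st : s t / s <= t => [wl|].
  have [/wl//|/ltW/wl] := leP s t.
  by rewrite !(distrC t) (distrC (clamp t)).
rewrite (distrC s t) [leRHS]ger0_norm ?subr_ge0// ler_norml.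
by have [[-> ?]|[-> ?]|[-> ?]] := clampP s;
  have [[-> ?]|[-> ?]|[-> ?]] := clampP t; lra.
Qed.

Lemma continuous_clamp : continuous clamp.
Proof.
move=> s; apply/cvgrPdist_le => e e0; exists e => //= t /ltW.
exact: le_trans (clamp_lipschitz _ _).
Qed.

End Clamp.

Lemma dot_delta (R : realType) n (i : 'I_n) (x : 'rV[R]_n) :
  dot (delta_mx 0 i) x = x 0 i.
Proof.
rewrite /dot (bigD1 i)//= big1 => [|j ji]; first by rewrite mxE !eqxx mul1r addr0.
by rewrite mxE eqxx/= (negbTE ji) mul0r.
Qed.

Lemma is_derive_line (R : realType) n (f : 'rV[R]_n -> R) (x v : 'rV[R]_n) (l : R) :
  is_derive (0 : R) (1 : R) (fun h => f (x + h *: v)) l -> is_derive x v f l.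
Proof.
pose g (h : R) := f (x + h *: v).
have E : (fun h => h^-1 *: ((f \o shift x) (h *: v) - f x)) =
    (fun h => h^-1 *: ((g \o shift 0) (h *: (1 : R)) - g 0)).
  apply/funext => h; rewrite /g /= addr0 scale0r addr0 [h *: v + x]addrC.
  by rewrite /GRing.scale/= mulr1.
move=> [d e]; apply: DeriveDef; first by rewrite /derivable E.
by rewrite -e /derive E.
Qed.

(** * The field of a bounded random vector Y on an arbitrary probability space *)

Section TiltedField.
Context {d : measure_display} {T : measurableType d} {R : realType} {n : nat}.
Variables (P : probability T R) (Y : T -> 'rV[R]_n) (M : R).
Hypothesis mY : forall i, measurable_fun [set: T] (fun w => Y w 0 i).
Hypothesis YM : forall w, enorm (Y w) <= M.

Lemma bound_ge0 : 0 <= M.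
Proof.
have [w0 _] : [set: T] !=set0.
  apply/set0P/eqP => T0; have := probability_setT P.
  by rewrite T0 measure0 => /eqP; rewrite eqe eq_sym oner_eq0.
exact: le_trans (enorm_ge0 _) (YM w0).
Qed.
Let M0 := bound_ge0.

Lemma ler_coord_bound w i : `|Y w 0 i| <= M.
Proof. exact: le_trans (ler_coord_enorm _ _) (YM w). Qed.

Lemma bmeas_coord i : bmeas (fun w => Y w 0 i).
Proof. by split => //; exists M => w; exact: ler_coord_bound. Qed.

Lemma ler_dot_bound x w : `|dot x (Y w)| <= M * enorm x.
Proof.
rewrite (le_trans (CauchySchwarz_dot _ _))// mulrC ler_wpM2r ?enorm_ge0//.
Qed.

Lemma bmeas_dot x : bmeas (fun w => dot x (Y w)).
Proof. by apply: bmeas_sum => i; apply: bmeasZ; exact: bmeas_coord. Qed.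

Lemma bmeas_sq : bmeas (fun w => dot (Y w) (Y w)).
Proof. by apply: bmeas_sum => i; apply: bmeasM; exact: bmeas_coord. Qed.

(** The logarithm, at x, of the density of the Gaussian law centred at s Y(w) with respect to the
    standard one. *)
Definition wt (s : R) (x : 'rV[R]_n) (w : T) : R :=
  s * dot x (Y w) - s ^+ 2 / 2 * dot (Y w) (Y w).

Lemma bmeas_wt s x : bmeas (wt s x).
Proof.
apply: bmeasB; apply: bmeasZ; [exact: bmeas_dot|exact: bmeas_sq].
Qed.

Lemma wtD s x v : wt s (x + v) = fun w => wt s x w + s * dot v (Y w).
Proof. by apply/funext => w; rewrite /wt dotDl; ring. Qed.

(** The two exponents differ by a bounded function, so [tilt_lipschitz] applies. A change of time
    costs M |x| + M^2 per unit because the time derivative of [wt] is <x, Y> - s |Y|^2. *)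
Lemma tilt_wt_lipschitz (h : T -> R) N s t x y : bmeas h ->
  (forall w, `|h w| <= N) -> 0 <= s <= 1 -> 0 <= t <= 1 ->
  `|tilt P (wt t y) h - tilt P (wt s x) h| <=
    8 * N * (M * enorm (y - x) + `|t - s| * (M * enorm x + M ^+ 2)).
Proof.
move=> mh hN /andP[s0 s1] /andP[t0 t1].
pose u w := t * dot (y - x) (Y w) + (t - s) * dot x (Y w) -
  (t ^+ 2 - s ^+ 2) / 2 * dot (Y w) (Y w).
have mu : bmeas u.
  apply: bmeasB; last by apply: bmeasZ; exact: bmeas_sq.
  by apply: bmeasD; apply: bmeasZ; exact: bmeas_dot.
have -> : wt t y = fun w => wt s x w + u w.
  by apply/funext => w; rewrite /wt /u dotDl dotNl; field.
apply: tilt_lipschitz => //; first exact: bmeas_wt.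
move=> w; rewrite /u (le_trans (ler_normB _ _))//.
rewrite (le_trans (lerD (ler_normD _ _) (lexx _)))//.
have -> : M * enorm (y - x) + `|t - s| * (M * enorm x + M ^+ 2) =
  M * enorm (y - x) + `|t - s| * (M * enorm x) + `|t - s| * M ^+ 2 by ring.
rewrite !normrM lerD//.
  rewrite lerD ?ler_wpM2l ?ler_dot_bound//.
  rewrite (le_trans (ler_wpM2l (normr_ge0 t) (ler_dot_bound _ _)))//.
  by rewrite ler_piMl ?ger0_norm// mulr_ge0 ?enorm_ge0.
rewrite dot_enorm (ger0_norm (sqr_ge0 (enorm (Y w)))) (ger0_norm (_ : 0 <= 2^-1))//.
have -> : t ^+ 2 - s ^+ 2 = (t - s) * (t + s) by ring.
rewrite normrM [`|t + s|]ger0_norm ?addr_ge0// -[_ / 2]mulrA -mulrA ler_wpM2l//.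
have : enorm (Y w) ^+ 2 <= M ^+ 2 by rewrite ler_sqr ?nnegrE ?enorm_ge0.
by have := sqr_ge0 (enorm (Y w)); nra.
Qed.

Definition field0 (s : R) (x : 'rV[R]_n) : 'rV[R]_n :=
  \row_i tilt P (wt s x) (fun w => Y w 0 i).

(* Clamping the time makes the field globally Lipschitz in x and bounded in time,
   hence its flow global; only times in [0, 1] matter. *)
Definition field (s : R) (x : 'rV[R]_n) : 'rV[R]_n := field0 (clamp s) x.

Definition dfield (s : R) (x : 'rV[R]_n) : 'M[R]_n :=
  \matrix_(i, j) (clamp s *
    tilt_cov P (wt (clamp s) x) (fun w => Y w 0 j) (fun w => Y w 0 i)).

Lemma tilt_sum q m (f : 'I_m -> T -> R) : bmeas q -> (forall i, bmeas (f i)) ->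
  tilt P q (fun w => \sum_(i < m) f i w) = \sum_(i < m) tilt P q (f i).
Proof.
move=> mq; elim: m f => [|m IH] f mf.
  rewrite big_ord0 -[RHS](tilt_cst P mq).
  by congr (tilt P q _); apply/funext => w; rewrite big_ord0.
rewrite big_ord_recl -IH// -tiltD//; last exact: bmeas_sum.
by congr (tilt P q _); apply/funext => w; rewrite big_ord_recl.
Qed.

Lemma tilt_dot q v : bmeas q -> tilt P q (fun w => dot v (Y w)) =
  \sum_(i < n) v 0 i * tilt P q (fun w => Y w 0 i).
Proof.
move=> mq; rewrite tilt_sum//; last by move=> i; apply: bmeasZ; exact: bmeas_coord.
by apply: eq_bigr => i _; rewrite tiltZ//; exact: bmeas_coord.
Qed.

Lemma dot_field0 s x v :
  dot v (field0 s x) = tilt P (wt s x) (fun w => dot v (Y w)).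
Proof.
rewrite tilt_dot; last exact: bmeas_wt.
by apply: eq_bigr => i _; rewrite mxE.
Qed.

Lemma mul_dfield s x v j : (v *m dfield s x) 0 j =
  tilt_cov P (wt (clamp s) x) (fun w => Y w 0 j) (fun w => clamp s * dot v (Y w)).
Proof.
have mq := bmeas_wt (clamp s) x; have mj := bmeas_coord j.
rewrite /tilt_cov (tiltZ P mq)//; last exact: bmeas_dot.
rewrite tilt_dot//.
have -> : (fun w => Y w 0 j * (clamp s * dot v (Y w))) =
    (fun w => \sum_(i < n) clamp s * v 0 i * (Y w 0 j * Y w 0 i)).
  apply/funext => w; rewrite /dot !mulr_sumr; apply: eq_bigr => i _; ring.
have mji i : bmeas (fun w => Y w 0 j * Y w 0 i).
  by apply: bmeasM => //; exact: bmeas_coord.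
rewrite tilt_sum//; last by move=> i; exact: bmeasZ.
rewrite !mulr_sumr -sumrB mxE; apply: eq_bigr => i _.
by rewrite mxE /tilt_cov (tiltZ P mq)//; ring.
Qed.

Lemma field_lipschitz s t x y :
  enorm (field t y - field s x) <=
    n%:R * (8 * M * (M * enorm (y - x) + `|t - s| * (M * enorm x + M ^+ 2))).
Proof.
have b : 0 <= M * enorm x + M ^+ 2.
  by rewrite addr_ge0 ?sqr_ge0// mulr_ge0 ?enorm_ge0.
apply: enorm_le_coord => [|i].
  by rewrite mulr_ge0 ?mulr_ge0 ?addr_ge0// mulr_ge0 ?enorm_ge0.
rewrite !mxE; apply: le_trans
  (tilt_wt_lipschitz x y (bmeas_coord i) (fun w => ler_coord_bound w i)
     (clamp_itv s) (clamp_itv t)) _.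
rewrite ler_wpM2l ?mulr_ge0// lerD2l ler_wpM2r//.
exact: clamp_lipschitz.
Qed.

Lemma field_bound s x : enorm (field s x) <= n%:R * M.
Proof.
apply: enorm_le_coord => // i; rewrite mxE; apply: ler_norm_tilt.
- exact: bmeas_wt.
- exact: bmeas_coord.
- by move=> w; exact: ler_coord_bound.
Qed.

(** One factor n passes from coordinates to the Euclidean norm, the other from the Euclidean to the
    sup norm; the summand 1 keeps the constant positive when n or M vanishes. *)
Definition field_cst := n%:R * (n%:R * (8 * M ^+ 2)) + 1.

Lemma field_cst_gt0 : 0 < field_cst.
Proof. by rewrite /field_cst ltr_wpDl// !mulr_ge0// sqr_ge0. Qed.

Lemma field_lipschitz_space s x y : `|field s x - field s y| <= field_cst * `|x - y|.
Proof.
rewrite (le_trans (ler_norm_enorm _))// (le_trans (field_lipschitz _ _ _ _))//.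
rewrite subrr normr0 mul0r addr0.
have := ler_enorm_norm (x - y) => h.
apply: (@le_trans _ _ (n%:R * (8 * M * (M * (n%:R * `|x - y|))))).
  by rewrite !(ler_wpM2l _ _)// mulr_ge0.
have -> : field_cst * `|x - y| =
    n%:R * (8 * M * (M * (n%:R * `|x - y|))) + `|x - y| by rewrite /field_cst; ring.
by rewrite lerDl.
Qed.

Lemma continuous_field x : continuous (field ^~ x).
Proof.
move=> s; apply/cvgrPdist_le => e e0.
pose K := n%:R * (8 * M * (M * enorm x + M ^+ 2)) + 1.
have K0 : 0 < K.
  by rewrite ltr_wpDl// !mulr_ge0// addr_ge0 ?sqr_ge0// mulr_ge0// enorm_ge0.
have eK : 0 < e / K := divr_gt0 e0 K0.
near=> t.
rewrite (le_trans (ler_norm_enorm _))// (le_trans (field_lipschitz _ _ _ _))//.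
rewrite subrr enorm0 mulr0 add0r.
have h : `|s - t| <= e / K by near: t; exists (e / K) => //= y /ltW.
apply: (@le_trans _ _ (K * `|s - t|)); last by rewrite -ler_pdivlMl// mulrC.
by have := normr_ge0 (s - t); rewrite /K; lra.
Unshelve. all: by end_near. Qed.

Lemma field_bounded x : exists C, forall s, `|field s x| <= C.
Proof.
by exists (n%:R * M) => s; rewrite (le_trans (ler_norm_enorm _))// field_bound.
Qed.

(** The first summand bounds the second-order remainder and the second one the derivative; their sum
    serves as the single constant C of [flow_linearization]. *)
Definition taylor_cst := n%:R * (16 * M * M ^+ 2) + n%:R * (2 * M * M).

Lemma taylor_cst_ge0 : 0 <= taylor_cst.
Proof. by rewrite /taylor_cst addr_ge0// !mulr_ge0// sqr_ge0. Qed.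

Let shift_bound s v w : `|clamp s * dot v (Y w)| <= M * enorm v.
Proof.
have /andP[c0 c1] := clamp_itv s.
rewrite normrM ger0_norm// -[leRHS]mul1r.
by rewrite ler_pM// ler_dot_bound.
Qed.

Lemma field_taylor s x v :
  enorm (field s (x + v) - field s x - v *m dfield s x) <= taylor_cst * enorm v ^+ 2.
Proof.
apply: (@le_trans _ _ (n%:R * (16 * M * M ^+ 2 * enorm v ^+ 2))); last first.
  rewrite mulrA ler_wpM2r ?sqr_ge0// /taylor_cst lerDl.
  by rewrite !mulr_ge0.
apply: enorm_le_coord => [|j].
  by rewrite !mulr_ge0// ?sqr_ge0 ?enorm_ge0.
have -> : (field s (x + v) - field s x - v *m dfield s x) 0 j =
   field s (x + v) 0 j - field s x 0 j - (v *m dfield s x) 0 j by rewrite !mxE.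
rewrite mul_dfield !mxE wtD -[leRHS]mulrA -exprMn.
apply: tilt_taylor.
- exact: bmeas_wt.
- by apply: bmeasZ; exact: bmeas_dot.
- exact: bmeas_coord.
- by move=> w; exact: ler_coord_bound.
- by move=> w; exact: shift_bound.
Qed.

Lemma dfield_bound s x v : enorm (v *m dfield s x) <= taylor_cst * enorm v.
Proof.
apply: (@le_trans _ _ (n%:R * (2 * M * (M * enorm v)))); last first.
  have -> : n%:R * (2 * M * (M * enorm v)) = n%:R * (2 * M * M) * enorm v by ring.
  rewrite ler_wpM2r ?enorm_ge0// /taylor_cst lerDr.
  by rewrite !mulr_ge0// sqr_ge0.
apply: enorm_le_coord => [|j].
  by rewrite !mulr_ge0// enorm_ge0.
rewrite mul_dfield; apply: ler_norm_tilt_cov.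
- exact: bmeas_wt.
- by apply: bmeasZ; exact: bmeas_dot.
- exact: bmeas_coord.
- by move=> w; exact: ler_coord_bound.
- by move=> w; exact: shift_bound.
Qed.

Lemma continuous_tilt_wt (X : R -> 'rV[R]_n) (h : T -> R) : continuous X -> bmeas h ->
  continuous (fun s => tilt P (wt (clamp s) (X s)) h).
Proof.
move=> cX mh s; have [_ [N hN]] := mh.
apply/cvgrPdist_le => e e0.
pose K := 8 * `|N| * (M * n%:R + (M * enorm (X s) + M ^+ 2)) + 1.
have b : 0 <= M * enorm (X s) + M ^+ 2.
  by rewrite addr_ge0 ?sqr_ge0// mulr_ge0 ?enorm_ge0.
have b' : 0 <= M * n%:R by rewrite mulr_ge0.
have K0 : 0 < K by rewrite ltr_wpDl// !mulr_ge0// addr_ge0.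
have eK : 0 < e / K := divr_gt0 e0 K0.
have KE z : K * z =
    8 * `|N| * (M * n%:R + (M * enorm (X s) + M ^+ 2)) * z + z by rewrite /K; ring.
near=> t.
have h1 : `|s - t| <= e / K by near: t; exists (e / K) => //= y /ltW.
have h2 : `|X s - X t| <= e / K.
  by near: t; exact: (cvgrPdist_le _ _).1 (cX s) _ eK.
have hN' w : `|h w| <= `|N| by rewrite (le_trans (hN w))// ler_norm.
rewrite distrC (le_trans (tilt_wt_lipschitz (X s) (X t) mh hN'
  (clamp_itv s) (clamp_itv t)))//.
have c1 : M * enorm (X t - X s) <= M * n%:R * (e / K).
  rewrite -mulrA ler_wpM2l// enormB (le_trans (ler_enorm_norm _))//.
  by rewrite ler_wpM2l.
have c2 : `|clamp t - clamp s| * (M * enorm (X s) + M ^+ 2) <=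
    (e / K) * (M * enorm (X s) + M ^+ 2).
  rewrite ler_wpM2r// (le_trans (clamp_lipschitz _ _))// distrC//.
rewrite (le_trans (ler_wpM2l _ (lerD c1 c2))) ?mulr_ge0//.
rewrite [leRHS](_ : e = K * (e / K)); last by rewrite mulrCA divff ?mulr1// gt_eqF.
by rewrite KE; have := ltW eK; lra.
Unshelve. all: by end_near. Qed.

Lemma continuous_mul_dfield (X : R -> 'rV[R]_n) (v : 'rV[R]_n) : continuous X ->
  continuous (fun s => v *m dfield s (X s)).
Proof.
move=> cX s; apply/cvg_coordP => j.
pose b i := continuous_tilt_wt cX (bmeas_coord i).
pose bb i := continuous_tilt_wt cX (bmeasM (bmeas_coord j) (bmeas_coord i)).
have -> : (fun s => (v *m dfield s (X s)) 0 j) = (fun s => \sum_i v 0 i * (clamp s *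
    (tilt P (wt (clamp s) (X s)) (fun w => Y w 0 j * Y w 0 i) -
     tilt P (wt (clamp s) (X s)) (fun w => Y w 0 j) *
     tilt P (wt (clamp s) (X s)) (fun w => Y w 0 i)))).
  by apply/funext => t; rewrite mxE; apply: eq_bigr => i _; rewrite mxE.
rewrite mxE; under eq_bigr do rewrite mxE.
apply: cvg_big => [|i _]; first exact: add_continuous.
apply: cvgM; first exact: cvg_cst.
apply: cvgM; first exact: continuous_clamp.
apply: cvgB; first exact: bb.
by apply: cvgM; exact: b.
Qed.

Section OneSidedLipschitz.
Variable r : R.
Hypothesis Yr : forall w w', enorm (Y w - Y w') <= r.

(** Moving x by v adds s <v, Y> to the exponent, so the claim reduces to [tilt_monotone] for the
    scalar <v, Y>, whose oscillation is at most r |v|. No matrix bound is involved. *)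
Lemma field_one_sided s x v : 0 <= s <= 1 ->
  dot v (field s (x + v) - field s x) <= s * (r ^+ 2 / 4) * enorm v ^+ 2.
Proof.
move=> s01; have /andP[s0 s1] := s01.
rewrite /field clamp_id// dotDr dotNr !dot_field0 wtD.
have -> : s * (r ^+ 2 / 4) * enorm v ^+ 2 = s * ((r * enorm v) ^+ 2 / 4) by ring.
apply: tilt_monotone => //; [exact: bmeas_wt|exact: bmeas_dot|].
move=> w w'; rewrite -dotNr -dotDr (le_trans (CauchySchwarz_dot _ _))// mulrC.
by rewrite ler_wpM2r ?enorm_ge0.
Qed.

End OneSidedLipschitz.

Definition density (s : R) (x : 'rV[R]_n) : R := partition_fun P (wt s x).

Lemma density_gt0 s x : 0 < density s x.
Proof. by apply: partition_fun_gt0; exact: bmeas_wt. Qed.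

Lemma is_derive_density s x v : is_derive (0 : R) (1 : R)
  (fun h => density s (x + h *: v)) (density s x * (s * dot v (field0 s x))).
Proof.
(* K bounds the change of the exponent per unit of h, so |h| <= 1 / (2 K) keeps it below 1/2, as
   [partition_fun_taylor] requires; the summand 1 makes K positive. *)
pose K := `|s| * (M * enorm v) + 1.
have K0 : 0 < K by rewrite ltr_wpDl// !mulr_ge0// enorm_ge0.
apply: (@is_derive_quadratic _ _ _ _ (2 * density s x * K ^+ 2) (2^-1 / K)).
  by rewrite divr_gt0.
move=> h hK; rewrite add0r scale0r addr0 /density wtD.
have mq := bmeas_wt s x.
have mdh : bmeas (fun w => s * dot (h *: v) (Y w)).
  by apply: bmeasZ; exact: bmeas_dot.
have ub w : `|s * dot (h *: v) (Y w)| <= `|h| * K.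
  rewrite dotZl mulrCA !normrM ler_wpM2l// /K (@le_trans _ _ (`|s| * (M * enorm v)))//.
    by rewrite ler_wpM2l// ler_dot_bound.
  by rewrite lerDl.
have hK2 : `|h| * K <= 2^-1 by rewrite -ler_pdivlMr.
have := partition_fun_taylor P mq mdh ub hK2.
rewrite exprMn real_normK ?num_real// [h ^+ 2 * _]mulrC mulrA.
rewrite dot_field0 (tiltZ P mq); last exact: bmeas_dot.
have -> : tilt P (wt s x) (fun w => dot (h *: v) (Y w)) =
    h * tilt P (wt s x) (fun w => dot v (Y w)).
  rewrite -(tiltZ P mq); last exact: bmeas_dot.
  have -> // : (fun w => dot (h *: v) (Y w)) = (fun w => h * dot v (Y w)).
  by apply/funext => w; rewrite dotZl.
move=> H; rewrite -[leRHS]mulrA; apply: le_trans H.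
rewrite le_eqVlt; apply/orP; left; apply/eqP; congr (`|_ - _|); ring.
Qed.

Lemma gradient_ln_density s x :
  gradient (fun z => ln (density s z)) x = s *: field0 s x.
Proof.
apply/rowP => i; rewrite mxE.
have dln : is_derive (0 : R) (1 : R)
    (fun h => ln (density s (x + h *: delta_mx 0 i))) (s * dot (delta_mx 0 i) (field0 s x)).
  have d0 := is_derive_density s x (delta_mx 0 i).
  have p : 0 < density s (x + (0 : R) *: delta_mx 0 i) by exact: density_gt0.
  have := is_derive_comp1 (is_derive1_ln p) d0.
  rewrite scale0r addr0 mulrA mulVf ?mul1r// gt_eqF//; exact: density_gt0.
have [_ ->] := @is_derive_line R n (fun z => ln (density s z)) x _ _ dln.
by rewrite [RHS]mxE dot_delta.
Qed.

(* [hflow s0 s x] is the position at time s of the trajectory that is at x at time s0. *)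
Definition hflow : R -> R -> 'rV[R]_n -> 'rV[R]_n :=
  flow field_cst_gt0 continuous_field field_lipschitz_space field_bounded.

End TiltedField.

(** * Gaussian translations and the law of Z + sY *)

Section BorelRV.
Context {R : realType} {n : nat}.
Implicit Types (A : set 'rV[R]_n).

(** A countable base of the topology made of measurable cubes: it links open sets to the coordinate
    sigma-algebra and lets null sets be covered countably. *)
Definition rat_box (p : 'rV[rat]_n * nat) : set 'rV[R]_n :=
  [set x | forall i, `|x 0 i - ratr (p.1 0 i)| < p.2.+1%:R^-1].

Lemma measurable_rat_box p : measurable (rat_box p).
Proof.
have -> : rat_box p = \bigcap_(i in [set: 'I_n])
    [set x : 'rV[R]_n | `|x 0 i - ratr (p.1 0 i)| < p.2.+1%:R^-1].
  by apply/seteqP; split=> x /= h i; [move=> _; exact: h|exact: h].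
apply: fin_bigcap_measurable => // i _.
have m : measurable_fun [set: 'rV[R]_n] (fun x : 'rV[R]_n => `|x 0 i - ratr (p.1 0 i)|).
  apply: measurableT_comp => //; apply: measurable_funB => //.
  exact: measurable_coord.
have := m measurableT `]-oo, p.2.+1%:R^-1[%classic (measurable_itv _).
by rewrite setTI; congr measurable; apply/seteqP; split=> x /=; rewrite in_itv.
Qed.

Lemma rat_box_basis (x : 'rV[R]_n) A : nbhs x A ->
  exists2 p, rat_box p x & rat_box p `<=` A.
Proof.
move=> /nbhs_ballP[e /= e0 xA].
have [k ke] : exists k : nat, 2 * k.+1%:R^-1 < e :> R.
  exists (Num.bound (2 / e)).
  rewrite ltr_pdivrMr// -ltr_pdivrMl// mulrC.
  have /lt_trans := archi_boundP (divr_ge0 (ler0n R 2) (ltW e0)); apply.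
  by rewrite ltr_nat.
have [c cE] : exists c : R, c = k.+1%:R^-1 by exists k.+1%:R^-1.
have c0 : 0 < c by rewrite cE invr_gt0.
rewrite -cE in ke.
have /choice[q hq] i : exists q : rat, `|x 0 i - ratr q| < c.
  have lt : x 0 i - c < x 0 i + c by lra.
  have [q] := rat_in_itvoo lt.
  rewrite in_itv/= => /andP[? ?]; exists q; rewrite distrC ltr_norml.
  by apply/andP; split; lra.
exists (\row_i q i, k) => [i|y hy]; first by rewrite mxE -cE.
apply: xA; rewrite -ball_normE /ball_/=.
have h : `|x - y| <= 2 * c.
  apply: norm_le_coord => [|i]; first by rewrite mulr_ge0// ltW.
  have := hy i; rewrite /= mxE -cE => hyi.
  rewrite !mxE -(subrKA (ratr (q i))) (le_trans (ler_normD _ _))//.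
  by have := hq i; rewrite [`|ratr _ - _|]distrC; lra.
exact: le_lt_trans ke.
Qed.

(** Reindexes a countable union by the natural numbers, the form in which measurable and negligible
    sets are closed under unions. *)
Lemma bigcup_pickle (I : countType) (Q : set I) (F : I -> set 'rV[R]_n) :
  \bigcup_(p in Q) F p = \bigcup_(m in [set: nat])
    if (pickle_inv m : option I) is Some p
    then (if `[<Q p>] then F p else set0) else set0.
Proof.
apply/seteqP; split=> x.
  by move=> [p Qp px]; exists (pickle p) => //; rewrite pickleK_inv asboolT.
by move=> [m _]; case: pickle_inv => // p; case: asboolP => // Qp px; exists p.
Qed.

Lemma bigcup_rat_box_measurable (Q : set ('rV[rat]_n * nat)) :
  measurable (\bigcup_(p in Q) rat_box p).
Proof.
rewrite bigcup_pickle.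
apply: bigcup_measurable => m _; case: pickle_inv => // p.
by case: asboolP => // _; exact: measurable_rat_box.
Qed.

Lemma open_bigcup_rat_box A : open A ->
  A = \bigcup_(p in [set p | rat_box p `<=` A]) rat_box p.
Proof.
move=> oA; apply/seteqP; split=> x; last by move=> [p pA /pA].
move=> Ax; have [|p px pA] := @rat_box_basis x A; last by exists p.
exact: open_nbhs_nbhs.
Qed.

Lemma open_measurable_rV A : open A -> measurable A.
Proof.
by move=> /open_bigcup_rat_box ->; exact: bigcup_rat_box_measurable.
Qed.

Lemma continuous_measurable_rV (f : 'rV[R]_n -> R) : continuous f ->
  measurable_fun [set: 'rV[R]_n] f.
Proof.
move=> /continuousP cf.
apply: (measurability _ (RGenOpens.measurableE R)) => _ [_ [a [b ->] <-]].
by rewrite setTI; apply: open_measurable_rV; apply: cf; exact: interval_open.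
Qed.

Lemma open_rat_box p : open (rat_box p).
Proof.
rewrite openE => y yp.
have : \forall z \near nbhs (y : 'rV[R]_n), forall i,
    `|(z : 'rV[R]_n) 0 i - ratr (p.1 0 i)| < p.2.+1%:R^-1.
  apply: filter_forall => i.
  have c : `|z 0 i - ratr (p.1 0 i)| @[z --> y] --> `|y 0 i - ratr (p.1 0 i)|.
    by apply: cvg_norm; apply: cvgB; [exact: coord_continuous|exact: cvg_cst].
  exact: cvgr_lt c _ (yp i).
by [].
Qed.

(** The complement of the support is the union of the rational boxes of measure zero, of which there
    are countably many. *)
Lemma msupport_full (P : probability 'rV[R]_n R) :
  measurable (msupport P) /\ P (msupport P) = 1%E.
Proof.
pose Q := [set p | P (rat_box p) = 0%E].
have E : ~` msupport P = \bigcup_(p in Q) rat_box p.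
  apply/seteqP; split=> x.
    move=> /existsNP[U] /not_implyP[oU] /not_implyP[Ux PU].
    have [|p px pU] := @rat_box_basis x U; first exact: open_nbhs_nbhs.
    exists p => //; apply/eqP; rewrite eq_le measure_ge0 andbT.
    move/negP : PU; rewrite -leNgt; apply: le_trans.
    by apply: le_measure; rewrite ?inE//; [exact: measurable_rat_box|exact: open_measurable_rV].
  move=> [p Qp px] /(_ (rat_box p)); rewrite Qp ltxx => h; apply: (notF (h _ _)) => //.
  exact: open_rat_box.
have mC : measurable (~` msupport P) by rewrite E; exact: bigcup_rat_box_measurable.
have mS : measurable (msupport P) by rewrite -[msupport P]setCK; exact: measurableC.
split=> //.
suff P0 : P (~` msupport P) = 0%E.
  by have := probability_setC P mC; rewrite setCK P0 sube0.
apply/negligibleP => //; rewrite E.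
rewrite (_ : \bigcup_(p in Q) _ = \bigcup_(m in [set: nat])
    if (pickle_inv m : option ('rV[rat]_n * nat)) is Some p
    then (if `[<Q p>] then rat_box p else set0) else set0); last first.
  exact: bigcup_pickle.
apply: negligible_bigcup => m; case: pickle_inv => [p|]; last exact: negligible_set0.
case: asboolP => [Qp|_]; last exact: negligible_set0.
by apply/negligibleP => //; exact: measurable_rat_box.
Qed.

End BorelRV.

(** * The Cameron-Martin formula *)

Section NormalTranslation.
Context {R : realType}.
Local Open Scope ereal_scope.

(** The Radon-Nikodym derivative and the explicit density have the same integrals over measurable
    sets, hence agree almost everywhere. *)
Lemma ge0_integral_normal_prob (f : measurableTypeR R -> \bar R) :
  (forall x, 0 <= f x) -> measurable_fun [set: measurableTypeR R] f ->
  \int[normal_prob (0 : R) 1]_x f x =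
  \int[lebesgue_measure]_x (f x * (normal_pdf (0 : R) 1 x)%:E).
Proof.
move=> f0 mf.
have dom := normal_prob_dominates (0 : R) 1.
rewrite -(Radon_Nikodym_SigmaFinite.change_of_variables dom)//.
apply: ae_eq_integral => //.
- apply: emeasurable_funM => //.
  exact: measurable_int (Radon_Nikodym_SigmaFinite.f_integrable dom).
- apply: emeasurable_funM => //; apply/measurable_EFinP.
  exact: measurable_normal_pdf.
- have : ae_eq lebesgue_measure [set: measurableTypeR R]
      (Radon_Nikodym_SigmaFinite.f (normal_prob (0 : R) 1) lebesgue_measure)
      (fun x => (normal_pdf (0 : R) 1 x)%:E).
    apply: integral_ae_eq => //.
    + exact: Radon_Nikodym_SigmaFinite.f_integrable dom.
    + by apply/measurable_EFinP; exact: measurable_normal_pdf.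
    + by move=> E _ mE; rewrite -Radon_Nikodym_SigmaFinite.f_integral.
  by apply: filterS => x /= h _; rewrite h.
Qed.

(** The translated measure gives half-open intervals their length, which characterises Lebesgue
    measure. *)
Lemma ge0_integral_lebesgue_shift (f : measurableTypeR R -> \bar R) (a : R) :
  (forall x, 0 <= f x) -> measurable_fun [set: measurableTypeR R] f ->
  \int[lebesgue_measure]_x f (x + a)%R = \int[lebesgue_measure]_x f x.
Proof.
move=> f0 mf.
have ms : measurable_fun [set: measurableTypeR R]
    ((fun x => x + a)%R : measurableTypeR R -> measurableTypeR R).
  exact: measurable_funD.
pose s := (fun x => x + a)%R : measurableTypeR R -> measurableTypeR R.
have E A : measurable A -> lebesgue_measure A = pushforward lebesgue_measure s A.
  apply/lebesgue_measure_unique => // _ /ocitvP[->|[[x y]/= xy ->]]; first by rewrite !measure0.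
  rewrite /= /pushforward.
  have -> : s @^-1` `]x, y]%classic = `](x - a)%R, (y - a)%R]%classic.
    by apply/seteqP; split=> z /=; rewrite !in_itv/= ltrBlDr lerBrDr.
  rewrite !lebesgue_measure_itv/= !lte_fin ltrD2r; case: ifPn => // _.
  by rewrite -!EFinB; congr (_%:E); ring.
transitivity (\int[pushforward lebesgue_measure s]_x f x).
  by rewrite (ge0_integral_pushforward ms)// preimage_setT.
by apply: eq_measure_integral => A mA _; exact/esym/E.
Qed.

Lemma normal_translation (f : measurableTypeR R -> \bar R) (a : R) :
  (forall x, 0 <= f x) -> measurable_fun [set: measurableTypeR R] f ->
  \int[normal_prob (0 : R) 1]_x f (x + a)%R =
  \int[normal_prob (0 : R) 1]_x (f x * (expR (x * a - a ^+ 2 / 2))%:E).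
Proof.
move=> f0 mf.
have ms : measurable_fun [set: measurableTypeR R]
    ((fun x => x + a)%R : measurableTypeR R -> measurableTypeR R).
  exact: measurable_funD.
have mpdf : measurable_fun [set: measurableTypeR R]
    (fun x => (normal_pdf (0 : R) 1 x)%:E).
  by apply/measurable_EFinP; exact: measurable_normal_pdf.
have pdf0 x : 0 <= (normal_pdf (0 : R) 1 x)%:E by rewrite lee_fin normal_pdf_ge0.
have me : measurable_fun [set: measurableTypeR R]
    (fun x : measurableTypeR R => (expR (x * a - a ^+ 2 / 2))%:E).
  apply/measurable_EFinP; apply: measurableT_comp => //.
  by apply: measurable_funB => //; apply: measurable_funM.
rewrite !ge0_integral_normal_prob//; last 3 first.
- by move=> x; rewrite mule_ge0// lee_fin expR_ge0.
- exact: emeasurable_funM.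
- exact: measurableT_comp mf ms.
have msub : measurable_fun [set: measurableTypeR R]
    ((fun x => x - a)%R : measurableTypeR R -> measurableTypeR R).
  exact: measurable_funB.
(* Translating the right-hand integrand by a completes the square: x^2 / 2 = (x + a)^2 / 2 - (x + a)
   a + a^2 / 2. *)
rewrite -(@ge0_integral_lebesgue_shift
  (fun x => f x * (expR (x * a - a ^+ 2 / 2))%:E * (normal_pdf (0 : R) 1 x)%:E) a).
- apply: eq_integral => x _; rewrite -muleA -EFinM; congr (_ * _%:E).
  rewrite /normal_pdf oner_eq0 mulrCA; congr (_ * _)%R.
  by rewrite /normal_fun -expRD; congr expR; field.
- by move=> x; rewrite !mule_ge0// lee_fin expR_ge0.
- by apply: emeasurable_funM => //; exact: emeasurable_funM.
Qed.

Lemma integral_gaussianS n (g : 'rV[R]_n.+1 -> \bar R) :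
  (forall x, 0 <= g x) -> measurable_fun [set: 'rV[R]_n.+1] g ->
  \int[gaussian R n.+1]_x g x =
  \int[normal_prob (0 : R) 1]_t \int[gaussian R n]_v g (rV_cons (t, v)).
Proof.
move=> g0 mg.
have mgc : measurable_fun [set: measurableTypeR R * 'rV[R]_n] (g \o @rV_cons R n).
  exact: measurableT_comp mg (@measurable_rV_cons R n).
rewrite [LHS](@ge0_integral_pushforward _ _ _ _ R _ (@measurable_rV_cons R n))//.
rewrite preimage_setT.
apply: (fubini_tonelli1 (m1 := normal_prob (0 : R) 1) (m2 := gaussian R n)
  (g \o @rV_cons R n)) => //.
by move=> p; exact: g0.
Qed.

Lemma rV_consD n t u (v w : 'rV[R]_n) :
  (rV_cons (t, v) + rV_cons (u, w))%R = rV_cons (t + u, v + w)%R :> 'rV[R]_n.+1.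
Proof. by apply/rowP => i; rewrite !mxE; case: unlift => //= j; rewrite mxE. Qed.

Lemma rV_consP n (x : 'rV[R]_n.+1) : exists t v, x = rV_cons (t, v).
Proof.
exists (x 0%R ord0), (\row_j x 0%R (lift ord0 j)); apply/rowP => i; rewrite mxE.
by case: unliftP => [j|] ->//=; rewrite mxE.
Qed.

Lemma dot_rV_cons n t u (v w : 'rV[R]_n) :
  dot (rV_cons (t, v)) (rV_cons (u, w)) = (t * u + dot v w)%R.
Proof.
rewrite /dot big_ord_recl; congr (_ + _)%R; first by rewrite !mxE unlift_none.
by apply: eq_bigr => i _; rewrite !mxE liftK.
Qed.

Lemma measurable_rV_addr n (a : 'rV[R]_n) :
  measurable_fun [set: 'rV[R]_n] (fun x => x + a)%R.
Proof.
apply: measurable_fun_coordP => i; under eq_fun do rewrite mxE.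
by apply: measurable_funD => //; exact: measurable_coord.
Qed.

Lemma measurable_dot n (a : 'rV[R]_n) : measurable_fun [set: 'rV[R]_n] (fun x => dot x a).
Proof.
apply: measurable_sum => i; apply: measurable_funM => //; exact: measurable_coord.
Qed.

(** Induction on the dimension: the first coordinate is split off by Tonelli's theorem, the
    induction hypothesis shifts the remaining ones, and [normal_translation] shifts the first. *)
Lemma gaussian_translation n (g : 'rV[R]_n -> \bar R) (a : 'rV[R]_n) :
  (forall x, 0 <= g x) -> measurable_fun [set: 'rV[R]_n] g ->
  \int[gaussian R n]_x g (x + a)%R =
  \int[gaussian R n]_x (g x * (expR (dot x a - dot a a / 2))%:E).
Proof.
elim: n g a => [|n IH] g a g0 mg.
  apply: eq_integral => x _; rewrite /dot !big_ord0 mul0r subr0 expR0 mule1.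
  by congr g; apply/rowP => -[].
have me m (b : 'rV[R]_m) : measurable_fun [set: 'rV[R]_m]
    (fun x => (expR (dot x b - dot b b / 2))%:E).
  apply/measurable_EFinP; apply: measurableT_comp => //.
  by apply: measurable_funB => //; exact: measurable_dot.
have e0 m (b x : 'rV[R]_m) : 0 <= (expR (dot x b - dot b b / 2))%:E.
  by rewrite lee_fin expR_ge0.
rewrite !integral_gaussianS//; last 3 first.
- by move=> x; rewrite mule_ge0.
- by apply: emeasurable_funM => //; exact: me.
- exact: measurableT_comp mg (measurable_rV_addr a).
have [u [w ->]] := rV_consP a.
pose G t := \int[gaussian R n]_v (g (rV_cons (t, v)) *
  (expR (dot v w - dot w w / 2))%:E).
have mgc : measurable_fun [set: measurableTypeR R * 'rV[R]_n] (g \o @rV_cons R n).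
  exact: measurableT_comp mg (@measurable_rV_cons R n).
have mF : measurable_fun [set: measurableTypeR R * 'rV[R]_n]
    (fun p => g (rV_cons p) * (expR (dot p.2 w - dot w w / 2))%:E).
  by apply: emeasurable_funM => //; exact: measurableT_comp (me n w) measurable_snd.
have F0 p : 0 <= g (rV_cons p) * (expR (dot p.2 w - dot w w / 2))%:E.
  by rewrite mule_ge0.
have mG : measurable_fun [set: measurableTypeR R] G.
  exact: (measurable_fun_fubini_tonelli_F (m2 := gaussian R n)
    (fun p => g (rV_cons p) * (expR (dot p.2 w - dot w w / 2))%:E)).
have msec (t : measurableTypeR R) :
    measurable_fun [set: 'rV[R]_n] (fun v => g (rV_cons (t, v))).
  exact: measurableT_comp mgc (pair1_measurable t).
transitivity (\int[normal_prob (0 : R) 1]_t G (t + u)%R).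
  apply: eq_integral => t _; rewrite /G.
  rewrite -(IH (fun v => g (rV_cons ((t + u)%R, v))))//.
  by apply: eq_integral => v _; rewrite rV_consD.
rewrite normal_translation//; last by move=> t; exact: integral_ge0.
apply: eq_integral => t _.
rewrite /G -ge0_integralZr//; last first.
  exact: (emeasurable_funM (msec t) (me n w)).
apply: eq_integral => v _; rewrite -muleA -EFinM -expRD; congr (_ * (expR _)%:E).
by rewrite !dot_rV_cons; field.
Qed.

End NormalTranslation.

Lemma locally_lipschitz_continuous (R : realType) n (f : 'rV[R]_n -> R) :
  (forall x, exists2 e, 0 < e & exists K, forall y, enorm (y - x) <= e ->
    `|f y - f x| <= K * enorm (y - x)) -> continuous f.
Proof.
move=> lf x; have [e e0 [K fK]] := lf x.
have [N N0 NE] : exists2 N : R, 0 < N & N = n%:R + 1.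
  by exists (n%:R + 1) => //; rewrite ltr_wpDl.
have [L L0 LE] : exists2 L : R, 0 < L & L = `|K| * n%:R + 1.
  by exists (`|K| * n%:R + 1) => //; rewrite ltr_wpDl// mulr_ge0.
apply: (@cvgrPdist_le _ _ _ _ (nbhs_filter (x : 'rV[R]_n)) f (f x)).2 => eps eps0.
have eN : 0 < e / N by exact: divr_gt0.
have eL : 0 < eps / L by exact: divr_gt0.
near=> y.
have h1 : `|y - x| <= e / N.
  near: y; apply/nbhs_ballP; exists (e / N) => // y; rewrite -ball_normE /= distrC.
  exact: ltW.
have h2 : `|y - x| <= eps / L.
  near: y; apply/nbhs_ballP; exists (eps / L) => // y; rewrite -ball_normE /= distrC.
  exact: ltW.
have h3 := ler_enorm_norm (y - x).
rewrite distrC (le_trans (fK y _))//.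
  rewrite (le_trans h3)// (@le_trans _ _ (N * (e / N)))//; last first.
    by rewrite mulrCA divff ?mulr1// gt_eqF.
  by rewrite ler_pM// NE lerDl.
rewrite (@le_trans _ _ (L * (eps / L)))//; last first.
  by rewrite mulrCA divff ?mulr1// gt_eqF.
have h4 : `|K| * enorm (y - x) <= `|K| * n%:R * `|y - x|.
  by rewrite -mulrA ler_wpM2l.
have h5 : K * enorm (y - x) <= `|K| * enorm (y - x).
  by rewrite ler_wpM2r ?enorm_ge0// ler_norm.
rewrite (le_trans h5)// (le_trans h4)// ler_pM ?mulr_ge0// LE lerDl//.
Unshelve. all: by end_near. Qed.

(** * The law of Z + sY and conditional expectations given it *)

Section Law.
Context {d : measure_display} {T : measurableType d} {R : realType} {n : nat}.
Variables (P : probability T R) (Y : T -> 'rV[R]_n) (M : R).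
Hypothesis mY : forall i, measurable_fun [set: T] (fun w => Y w 0 i).
Hypothesis YM : forall w, enorm (Y w) <= M.

Local Notation gamma := (gaussian R n).
Local Notation wt := (wt Y).
Local Notation density := (density P Y).
Local Notation bmeas_wt := (bmeas_wt mY YM).

Definition shifted (s : R) (p : 'rV[R]_n * T) : 'rV[R]_n := p.1 + s *: Y p.2.

Lemma measurable_shifted s : measurable_fun [set: 'rV[R]_n * T] (shifted s).
Proof.
apply: measurable_fun_coordP => i; under eq_fun do rewrite !mxE.
apply: measurable_funD.
  exact: (measurableT_comp (measurable_coord i) measurable_fst).
by apply: measurable_funM => //; exact: (measurableT_comp (mY i) measurable_snd).
Qed.

Lemma measurable_wt2 s :
  measurable_fun [set: 'rV[R]_n * T] (fun p => wt s p.1 p.2).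
Proof.
have mY2 i : measurable_fun [set: 'rV[R]_n * T] (fun p => Y p.2 0 i).
  exact: (measurableT_comp (mY i) measurable_snd).
apply: measurable_funB; apply: measurable_funM => //; apply: measurable_sum => i.
  by apply: measurable_funM => //; exact: (measurableT_comp (measurable_coord i) measurable_fst).
exact: measurable_funM.
Qed.

Lemma wt_dot s x w :
  wt s x w = dot x (s *: Y w) - dot (s *: Y w) (s *: Y w) / 2.
Proof. by rewrite /wt !(dotZl, dotZr); field. Qed.

Lemma Ex_EFin (h : T -> R) : bmeas h -> (\int[P]_w (h w)%:E)%E = (Ex P h)%:E.
Proof.
move=> mh; rewrite /Ex /Rintegral fineK//.
by apply: integrable_fin_num => //; exact: (bmeas_integrable P mh).
Qed.

(** For a fixed value of Y, the translation by sY becomes the factor exp([wt]); exchanging the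
    integrals then collects the expectation over Y. Taking h = 1 gives the density of Z + sY, and a
    general h the conditional expectation of h(Y). *)
Lemma law_shifted s (g : 'rV[R]_n -> R) (h : T -> R) :
  measurable_fun [set: 'rV[R]_n] g -> (forall x, 0 <= g x) ->
  bmeas h -> (forall w, 0 <= h w) ->
  (\int[gamma \x P]_p (g (shifted s p) * h p.2)%:E =
   \int[gamma]_x (g x * (density s x * tilt P (wt s x) h))%:E)%E.
Proof.
move=> mg g0 mh h0; have [mh' _] := mh.
have m1 : measurable_fun [set: 'rV[R]_n * T] (fun p => (g (shifted s p) * h p.2)%:E).
  apply/measurable_EFinP; apply: measurable_funM.
    exact: measurableT_comp mg (measurable_shifted s).
  exact: measurableT_comp mh' measurable_snd.
have m2 : measurable_fun [set: 'rV[R]_n * T]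
    (fun p => (g p.1 * (h p.2 * expR (wt s p.1 p.2)))%:E).
  apply/measurable_EFinP; apply: measurable_funM.
    exact: measurableT_comp mg measurable_fst.
  apply: measurable_funM; first exact: measurableT_comp mh' measurable_snd.
  by apply: measurableT_comp => //; exact: measurable_wt2.
rewrite (fubini_tonelli2 (m1 := gamma) (m2 := P)
  (fun p => (g (shifted s p) * h p.2)%:E))//; last first.
  by move=> p; rewrite lee_fin mulr_ge0.
transitivity (\int[P]_w \int[gamma]_x (g x * (h w * expR (wt s x w)))%:E)%E.
  apply: eq_integral => w _; rewrite /fubini_G /shifted /=.
  transitivity (\int[gamma]_x ((h w)%:E * (g (x + s *: Y w))%:E))%E.
    by apply: eq_integral => x _; rewrite mulrC EFinM.
  have mgs : measurable_fun [set: 'rV[R]_n] (EFin \o g) by exact/measurable_EFinP.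
  rewrite ge0_integralZl//; last 3 first.
  - exact: measurableT_comp mgs (measurable_rV_addr _).
  - by move=> x _; rewrite lee_fin.
  - by rewrite lee_fin.
  rewrite (gaussian_translation (g := EFin \o g))//.
  rewrite -ge0_integralZl//; last 3 first.
  - apply: emeasurable_funM => //; apply/measurable_EFinP.
    by apply: measurableT_comp => //; apply: measurable_funB => //; exact: measurable_dot.
  - by move=> x _; rewrite mule_ge0// lee_fin// expR_ge0.
  - by rewrite lee_fin.
  apply: eq_integral => x _; rewrite /= -!EFinM wt_dot; congr (_%:E); ring.
rewrite -(fubini_tonelli (m1 := gamma) (m2 := P)
  (fun p => (g p.1 * (h p.2 * expR (wt s p.1 p.2)))%:E))//; last first.
  by move=> p; rewrite lee_fin !mulr_ge0// expR_ge0.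
apply: eq_integral => x _ /=.
have mq := bmeas_wt s x.
have -> : density s x * tilt P (wt s x) h = Ex P (fun w => h w * expR (wt s x w)).
  by rewrite /tilt mulrC divfK// gt_eqF//; exact: partition_fun_gt0.
rewrite -ExZ; last by apply: bmeasM => //; exact: bmeas_expR.
rewrite -Ex_EFin//; apply: bmeasZ; apply: bmeasM => //; exact: bmeas_expR.
Qed.

Lemma bmeas_shifted s (g : 'rV[R]_n -> R) : bmeas g -> bmeas (fun p => g (shifted s p)).
Proof.
move=> [mg [N gN]]; split; last by exists N => p.
exact: measurableT_comp mg (measurable_shifted s).
Qed.

Lemma bmeas_snd (h : T -> R) : bmeas h -> bmeas (fun p : 'rV[R]_n * T => h p.2).
Proof.
move=> [mh [N hN]]; split; last by exists N => p.
exact: measurableT_comp mh measurable_snd.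
Qed.

Lemma continuous_tilt s (h : T -> R) : 0 <= s <= 1 -> bmeas h ->
  continuous ((fun x => tilt P (wt s x) h) : 'rV[R]_n -> R).
Proof.
move=> s01 mh; apply: locally_lipschitz_continuous => x; exists 1 => //.
have [_ [N hN]] := mh; exists (8 * N * M) => y _.
have := tilt_wt_lipschitz P mY YM x y mh hN s01 s01.
by rewrite subrr normr0 mul0r addr0 [8 * N * (M * _)]mulrA.
Qed.

Lemma bmeas_tilt s (h : T -> R) : 0 <= s <= 1 -> bmeas h ->
  bmeas (fun x => tilt P (wt s x) h).
Proof.
move=> s01 mh; split; first by apply: continuous_measurable_rV; exact: continuous_tilt.
have [_ [N hN]] := mh; exists N => x; apply: ler_norm_tilt => //; exact: bmeas_wt.
Qed.

Local Notation Q := (gamma \x P)%E.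

(** Both sides equal one Gaussian integral by [law_shifted], used once with h itself and once with
    the constant 1 after moving the tilted mean of h into g. *)
Lemma conditional_expectation_ge0 s (l : 'rV[R]_n -> R) (h : T -> R) : 0 <= s <= 1 ->
  bmeas l -> (forall x, 0 <= l x) -> bmeas h -> (forall w, 0 <= h w) ->
  Ex Q (fun p => l (shifted s p) * h p.2) =
  Ex Q (fun p => l (shifted s p) * tilt P (wt s (shifted s p)) h).
Proof.
move=> s01 ml l0 mh h0; have mt := bmeas_tilt s01 mh.
have t0 x : 0 <= tilt P (wt s x) h.
  rewrite -(tilt_cst P (bmeas_wt s x) 0); apply: ler_tilt => //; [exact: bmeas_wt|exact: bmeas_cst].
have m1 : bmeas (fun _ : T => 1 : R) by exact: bmeas_cst.
rewrite /Ex /Rintegral law_shifted//; last by case: ml.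
have -> : (\int[Q]_p (l (shifted s p) * tilt P (wt s (shifted s p)) h)%:E =
    \int[Q]_p (l (shifted s p) * tilt P (wt s (shifted s p)) h * 1)%:E)%E.
  by apply: eq_integral => p _; rewrite mulr1.
rewrite (law_shifted s (g := fun x => l x * tilt P (wt s x) h) _ _ m1)//; last 2 first.
- by have [] := bmeasM ml mt.
- by move=> x; rewrite mulr_ge0.
congr fine; apply: eq_integral => x _; rewrite tilt_cst//; last exact: bmeas_wt.
by rewrite mulr1 -mulrA [density s x * _]mulrC.
Qed.

(* E[h(Y) | Z + sY = x] is the tilted expectation of h. *)
Lemma conditional_expectation s (l : 'rV[R]_n -> R) (h : T -> R) : 0 <= s <= 1 ->
  bmeas l -> bmeas h ->
  Ex Q (fun p => l (shifted s p) * h p.2) =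
  Ex Q (fun p => l (shifted s p) * tilt P (wt s (shifted s p)) h).
Proof.
move=> s01 ml mh; have mt := bmeas_tilt s01 mh.
have [_ [L lL]] := ml; have [_ [K hK]] := mh.
(* Adding their bounds makes l and h nonnegative. After expansion the extra terms agree on the two
   sides, by the nonnegative case with l = 1. *)
have L0 x : 0 <= l x + L by have := lL x; rewrite ler_norml => /andP[? _]; lra.
have K0 w : 0 <= h w + K by have := hK w; rewrite ler_norml => /andP[? _]; lra.
have mlL : bmeas (fun x => l x + L) by apply: bmeasD => //; exact: bmeas_cst.
have mhK : bmeas (fun w => h w + K) by apply: bmeasD => //; exact: bmeas_cst.
have m1 : bmeas (fun _ : 'rV[R]_n => 1 : R) by exact: bmeas_cst.
have E1 := conditional_expectation_ge0 s01 mlL L0 mhK K0.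
have E2 := conditional_expectation_ge0 s01 m1 (fun=> ler01) mhK K0.
have tE x : tilt P (wt s x) (fun w => h w + K) = tilt P (wt s x) h + K.
  rewrite (tiltD P (bmeas_wt s x) mh (bmeas_cst K)) tilt_cst//; exact: bmeas_wt.
pose A p := l (shifted s p); pose H (p : 'rV[R]_n * T) := h p.2.
pose Th p := tilt P (wt s (shifted s p)) h.
have mA : bmeas A by exact: bmeas_shifted.
have mH : bmeas H by exact: bmeas_snd.
have mTh : bmeas Th by exact: (bmeas_shifted s mt).
have F1 G : bmeas G -> Ex Q (fun p => (l (shifted s p) + L) * (G p + K)) =
    Ex Q (fun p => A p * G p) + L * Ex Q G + (K * Ex Q A + L * K).
  move=> mG; rewrite -(ExZ Q L mG) -(ExZ Q K mA) -(Ex_cst Q (L * K)).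
  have mAG : bmeas (fun p => A p * G p) by exact: bmeasM.
  have mLG : bmeas (fun p => L * G p) by exact: bmeasZ.
  have mKA : bmeas (fun p => K * A p) by exact: bmeasZ.
  have mc : bmeas (fun _ : 'rV[R]_n * T => L * K) by exact: bmeas_cst.
  rewrite -(ExD Q mAG mLG) -(ExD Q mKA mc) -(ExD Q (bmeasD mAG mLG) (bmeasD mKA mc)).
  by congr (Ex Q _); apply/funext => p; rewrite /A; ring.
have F2 G : bmeas G -> Ex Q (fun p => 1 * (G p + K)) = Ex Q G + K.
  move=> mG; rewrite -[in RHS](Ex_cst Q K) -ExD//; last exact: bmeas_cst.
  by congr (Ex Q _); apply/funext => p; rewrite mul1r.
have {}E1 : Ex Q (fun p => (l (shifted s p) + L) * (H p + K)) =
    Ex Q (fun p => (l (shifted s p) + L) * (Th p + K)).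
  by rewrite E1; congr (Ex Q _); apply/funext => p; rewrite tE.
have {}E2 : Ex Q (fun p => 1 * (H p + K)) = Ex Q (fun p => 1 * (Th p + K)).
  by rewrite E2; congr (Ex Q _); apply/funext => p; rewrite tE.
move: E1 E2; rewrite !F1// !F2// => E1 /addIr E2.
by move: E1; rewrite E2 => /addIr/addIr.
Qed.

(** As s^2 + c^2 = 1, for fixed Y the integrand is exp([wt] s x) times the exponential of c <y, Y> -
    c^2 |Y|^2 / 2, which has Gaussian integral 1 in y. *)
Lemma ou_semigroup_density t : 0 <= t ->
  ou_semigroup t (density 1) = density (expR (- t)).
Proof.
move=> t0; apply/funext => x; rewrite /ou_semigroup.
set s := expR (- t); set c := Num.sqrt _.
have c2 : c ^+ 2 = 1 - s ^+ 2.
  rewrite sqr_sqrtr; first by rewrite /s -expRM_natr; congr (1 - expR _); ring.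
  by rewrite subr_ge0 -[leRHS]expR0 ler_expR; lra.
rewrite /Rintegral; apply: (congr1 fine (y := (density s x)%:E)).
have mh w := bmeas_expR (bmeas_wt 1 w).
transitivity (\int[gamma]_y \int[P]_w (expR (wt 1 (s *: x + c *: y) w))%:E)%E.
  by apply: eq_integral => y _; rewrite Ex_EFin.
pose f (p : 'rV[R]_n * T) := (expR (wt 1 (s *: x + c *: p.1) p.2))%:E.
have mf : measurable_fun [set: 'rV[R]_n * T] f.
  apply/measurable_EFinP; apply: measurableT_comp => //.
  have -> : (fun p : 'rV[R]_n * T => wt 1 (s *: x + c *: p.1) p.2) =
      (fun p => wt 1 (s *: x + c *: p.1) p.2) by [].
  have mY2 i : measurable_fun [set: 'rV[R]_n * T] (fun p => Y p.2 0 i).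
    exact: (measurableT_comp (mY i) measurable_snd).
  apply: measurable_funB; apply: measurable_funM => //; apply: measurable_sum => i.
    apply: measurable_funM => //; under eq_fun do rewrite !mxE.
    apply: measurable_funD => //; apply: measurable_funM => //.
    exact: (measurableT_comp (measurable_coord i) measurable_fst).
  exact: measurable_funM.
rewrite (fubini_tonelli (m1 := gamma) (m2 := P) f)//; last first.
  by move=> p; rewrite lee_fin expR_ge0.
rewrite /density /partition_fun -Ex_EFin; last exact: bmeas_expR (bmeas_wt s x).
apply: eq_integral => w _; rewrite /f /=.
have me : measurable_fun [set: 'rV[R]_n]
    (fun y => (expR (dot y (c *: Y w) - dot (c *: Y w) (c *: Y w) / 2))%:E).
  apply/measurable_EFinP; apply: measurableT_comp => //.
  by apply: measurable_funB => //; exact: measurable_dot.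
transitivity (\int[gamma]_y ((expR (wt s x w))%:E *
    (expR (dot y (c *: Y w) - dot (c *: Y w) (c *: Y w) / 2))%:E))%E.
  apply: eq_integral => y _; rewrite -EFinM -expRD; congr (expR _)%:E.
  by rewrite /wt !(dotDl, dotZl, dotZr) expr1n mul1r mul1r mulrA -expr2 c2; field.
rewrite ge0_integralZl//.
have E : (\int[gamma]_y
    (expR (dot y (c *: Y w) - dot (c *: Y w) (c *: Y w) / 2))%:E = 1)%E.
  transitivity (\int[gamma]_y
      (1 * (expR (dot y (c *: Y w) - dot (c *: Y w) (c *: Y w) / 2))%:E))%E.
    by apply: eq_integral => y _; rewrite mul1e.
  rewrite -(gaussian_translation (g := fun=> 1%E))//.
  by rewrite integral_cst// mul1e [X in X = _]probability_setT.
by rewrite E mule1.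
Qed.

Lemma continuous_density s : 0 <= s <= 1 -> continuous (density s : 'rV[R]_n -> R).
Proof.
move=> /andP[s0 s1]; apply: locally_lipschitz_continuous => x.
have M0 := bound_ge0 P YM.
have M1 : 0 < 2 * (M + 1) by rewrite mulr_gt0// ltr_wpDl.
exists (2 * (M + 1))^-1; first by rewrite invr_gt0.
exists (density s x * (2 * M)) => y; set v := y - x => ve.
have -> : y = x + v by rewrite addrC subrK.
rewrite /density wtD.
have mu : bmeas (fun w => s * dot v (Y w)).
  by apply: bmeasZ; exact: bmeas_dot mY YM v.
have ub w : `|s * dot v (Y w)| <= M * enorm v.
  by rewrite normrM ger0_norm// -[leRHS]mul1r ler_pM// (ler_dot_bound YM).
have v2 : M * enorm v <= 2^-1.
  have := enorm_ge0 v; move: ve; rewrite -[_^-1]mul1r ler_pdivlMr//; nra.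
have := partition_fun_taylor P (bmeas_wt s x) mu ub v2.
have := ler_norm_tilt P (bmeas_wt s x) mu ub.
have Z0 : 0 <= partition_fun P (wt s x) by rewrite ltW// partition_fun_gt0//; exact: bmeas_wt.
set Z := partition_fun P (wt s x) in Z0 *.
set t := tilt _ _ _ => t1 tay.
have -> : partition_fun P (fun w => wt s x w + s * dot v (Y w)) - Z =
  (partition_fun P (fun w => wt s x w + s * dot v (Y w)) - Z - Z * t) + Z * t by ring.
rewrite (le_trans (ler_normD _ _))// normrM [`|Z|]ger0_norm//.
have c1 : Z * `|t| <= Z * (M * enorm v) by rewrite ler_wpM2l.
have c2 : 2 * Z * (M * enorm v) ^+ 2 <= Z * (M * enorm v).
  move: (M * enorm v) v2 (mulr_ge0 M0 (enorm_ge0 v)) => a a2 a0.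
  have : 0 <= Z * (a * (1 - 2 * a)).
    by apply: mulr_ge0 => //; apply: mulr_ge0 => //; lra.
  by lra.
lra.
Qed.

End Law.

(** * Transport of the Gaussian measure *)

Section C11.
Context {R : realType} {n : nat}.
Implicit Types (k : 'rV[R]_n -> R) (p : 'rV[R]_n -> 'rV[R]_n).

(* Functions with a Lipschitz gradient [p], which is all the regularity that the
   second-order expansions below require of test functions. *)
Definition C11 k p (C : R) : Prop :=
  forall x v, `|k (x + v) - k x - dot (p x) v| <= C * enorm v ^+ 2.

Lemma enorm_delta (i : 'I_n) : enorm (delta_mx 0 i : 'rV[R]_n) = 1.
Proof.
apply/eqP; rewrite -(@eqrXn2 _ 2) ?enorm_ge0//.
by rewrite -dot_enorm dot_delta mxE !eqxx expr1n.
Qed.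

Section Bounded.
Variables (k : 'rV[R]_n -> R) (p : 'rV[R]_n -> 'rV[R]_n) (C N : R).
Hypotheses (kC : C11 k p C) (kN : forall x, `|k x| <= N).

Lemma C11_bound_ge0 : 0 <= N.
Proof. exact: le_trans (normr_ge0 _) (kN 0). Qed.

(** The expansion is tested with a unit displacement: for a bounded function, a quadratic remainder
    already bounds the gradient. *)
Lemma C11_grad_coord x i : `|p x 0 i| <= 2 * N + C.
Proof.
have := kC x (delta_mx 0 i); rewrite enorm_delta expr1n mulr1 dotC dot_delta => h.
have -> : p x 0 i = (k (x + delta_mx 0 i) - k x) -
  (k (x + delta_mx 0 i) - k x - p x 0 i) by ring.
rewrite (le_trans (ler_normB _ _))// lerD// (le_trans (ler_normB _ _))//.
by have := kN (x + delta_mx 0 i); have := kN x; lra.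
Qed.

Definition C11_grad_cst := n%:R * `|2 * N + C|.

Lemma C11_grad_dot x v : `|dot (p x) v| <= C11_grad_cst * enorm v.
Proof.
rewrite (le_trans (CauchySchwarz_dot _ _))// ler_wpM2r ?enorm_ge0//.
apply: enorm_le_coord => // i; rewrite (le_trans (C11_grad_coord x i))//.
exact: ler_norm.
Qed.

(** The first two terms serve displacements of norm at most 1, by the expansion; the last one serves
    longer displacements, by boundedness. *)
Definition C11_lip_cst := C11_grad_cst + `|C| + 2 * N.

Lemma C11_lipschitz x v : `|k (x + v) - k x| <= C11_lip_cst * enorm v.
Proof.
have v0 := enorm_ge0 v; have N0 := C11_bound_ge0.
have G0 : 0 <= C11_grad_cst by rewrite mulr_ge0.
have [v1|v1] := leP (enorm v) 1.
  have -> : k (x + v) - k x = (k (x + v) - k x - dot (p x) v) + dot (p x) v by ring.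
  rewrite (le_trans (ler_normD _ _))//.
  rewrite (le_trans (lerD (kC x v) (C11_grad_dot x v)))// /C11_lip_cst.
  have h : C * enorm v ^+ 2 <= `|C| * enorm v.
    rewrite (@le_trans _ _ (`|C| * enorm v ^+ 2))// ?ler_wpM2r ?sqr_ge0 ?ler_norm//.
    by rewrite ler_wpM2l// expr2 ler_piMl.
  have := mulr_ge0 N0 v0; lra.
rewrite (le_trans (ler_normB _ _))// /C11_lip_cst.
have := kN (x + v); have := kN x; have := normr_ge0 C.
have : 2 * N * 1 <= 2 * N * enorm v by rewrite ler_wpM2l ?mulr_ge0// ltW.
have := mulr_ge0 G0 v0; have := mulr_ge0 (normr_ge0 C) v0; lra.
Qed.

Hypothesis mk : measurable_fun [set: 'rV[R]_n] k.

(** [C11] does not ask p to be measurable, but p is the pointwise limit of difference quotients of k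
    with steps 1 / (m + 1). *)
Lemma bmeas_C11_grad i : bmeas (fun x => p x 0 i).
Proof.
split; last by exists (2 * N + C) => x; exact: C11_grad_coord.
pose h m x := m.+1%:R * (k (x + m.+1%:R^-1 *: delta_mx 0 i) - k x).
apply: (@measurable_fun_cvg _ _ _ _ h).
  move=> m; apply: measurable_funM => //; apply: measurable_funB => //.
  exact: measurableT_comp mk (measurable_rV_addr _).
move=> x _; apply/cvgrPdist_le => e e0; near=> m.
have m0 : 0 < m.+1%:R :> R by [].
have -> : p x 0 i - h m x = - (m.+1%:R * (k (x + m.+1%:R^-1 *: delta_mx 0 i) - k x -
    dot (p x) (m.+1%:R^-1 *: delta_mx 0 i))).
  rewrite /h dotZr [dot (p x) _]dotC dot_delta; field; exact: lt0r_neq0.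
rewrite normrN normrM gtr0_norm// -ler_pdivlMl//.
rewrite (le_trans (kC _ _))// enormZ enorm_delta mulr1 [`|_^-1|]gtr0_norm ?invr_gt0//.
rewrite expr2 mulrCA ler_pM2l ?invr_gt0//.
rewrite -[leRHS]mulr1 ler_pdivrMr// mulr1.
near: m; exists (Num.bound (`|C| / e)) => // m /= bm.
rewrite -ler_pdivrMl// mulrC (le_trans (_ : _ <= `|C| / e))//.
  by rewrite ler_pM2r ?invr_gt0// ler_norm.
rewrite (le_trans (ltW (archi_boundP _)))//; first by rewrite divr_ge0// ltW.
by rewrite ler_nat leqW.
Unshelve. all: by end_near. Qed.

End Bounded.

Lemma C11_mul k1 p1 C1 N1 k2 p2 C2 N2 :
  C11 k1 p1 C1 -> (forall x, `|k1 x| <= N1) ->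
  C11 k2 p2 C2 -> (forall x, `|k2 x| <= N2) ->
  C11 (fun x => k1 x * k2 x) (fun x => k1 x *: p2 x + k2 x *: p1 x)
    (N1 * C2 + N2 * C1 + C11_lip_cst C1 N1 * C11_lip_cst C2 N2).
Proof.
move=> c1 b1 c2 b2 x v.
have N10 := C11_bound_ge0 b1; have N20 := C11_bound_ge0 b2.
rewrite dotDl !dotZl.
have -> : k1 (x + v) * k2 (x + v) - k1 x * k2 x -
    (k1 x * dot (p2 x) v + k2 x * dot (p1 x) v) =
  k1 x * (k2 (x + v) - k2 x - dot (p2 x) v) +
  k2 x * (k1 (x + v) - k1 x - dot (p1 x) v) +
  (k1 (x + v) - k1 x) * (k2 (x + v) - k2 x) by ring.
rewrite (le_trans (ler_normD _ _))// [leRHS]mulrDl lerD//.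
  rewrite (le_trans (ler_normD _ _))// !normrM [leRHS]mulrDl -!mulrA lerD//.
    by rewrite ler_pM.
  by rewrite ler_pM.
rewrite normrM expr2 mulrACA ler_pM//; exact: C11_lipschitz.
Qed.

Definition smooth_test k : Prop :=
  bmeas k /\ exists p C, C11 k p C.

Lemma smooth_test_cst (c : R) : smooth_test (fun=> c).
Proof.
split; first exact: bmeas_cst.
exists (fun=> 0), 0 => x v.
by rewrite subrr sub0r mul0r -(scale0r (0 : 'rV[R]_n)) dotZl mul0r oppr0 normr0.
Qed.

Lemma smooth_testM k1 k2 : smooth_test k1 -> smooth_test k2 ->
  smooth_test (fun x => k1 x * k2 x).
Proof.
move=> [m1 [p1 [C1 c1]]] [m2 [p2 [C2 c2]]].
have [_ [N1 b1]] := m1; have [_ [N2 b2]] := m2.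
split; first exact: bmeasM.
by eexists; eexists; exact: C11_mul c1 b1 c2 b2.
Qed.

Definition qplus (u : R) : R := Num.max 0 u ^+ 2.

(* The C^{1,1} primitive of the tent function on [0, 1]. *)
Definition smoothstep (u : R) : R :=
  2 * qplus u - 4 * qplus (u - 2^-1) + 2 * qplus (u - 1).

Lemma qplus_taylor (u h : R) :
  `|qplus (u + h) - qplus u - 2 * Num.max 0 u * h| <= h ^+ 2.
Proof.
rewrite /qplus ler_norml; apply/andP.
by have [?|?] := leP 0 u; have [?|?] := leP 0 (u + h); split; nra.
Qed.

Lemma smoothstep_itv u : 0 <= smoothstep u <= 1.
Proof.
rewrite /smoothstep /qplus; apply/andP.
by have [?|?] := leP 0 u; have [?|?] := leP 0 (u - 2^-1);
  have [?|?] := leP 0 (u - 1); split; nra.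
Qed.

Lemma smoothstep_eq0 u : u <= 0 -> smoothstep u = 0.
Proof.
move=> u0; rewrite /smoothstep /qplus !max_l//; first by ring.
- by lra.
- by lra.
Qed.

Lemma smoothstep_eq1 u : 1 <= u -> smoothstep u = 1.
Proof.
move=> u1; rewrite /smoothstep /qplus !max_r//; first by field.
- by lra.
- by lra.
- by lra.
Qed.

Lemma smoothstep_taylor (u : R) : exists l, forall h,
  `|smoothstep (u + h) - smoothstep u - l * h| <= 8 * h ^+ 2.
Proof.
exists (2 * (2 * Num.max 0 u) - 4 * (2 * Num.max 0 (u - 2^-1)) +
  2 * (2 * Num.max 0 (u - 1))) => h.
have h1 := qplus_taylor u h.
have h2 := qplus_taylor (u - 2^-1) h.
have h3 := qplus_taylor (u - 1) h.
rewrite /smoothstep.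
have -> : u + h - 2^-1 = u - 2^-1 + h by ring.
have -> : u + h - 1 = u - 1 + h by ring.
move: h1 h2 h3; rewrite !ler_norml => /andP[? ?] /andP[? ?] /andP[? ?].
by apply/andP; split; lra.
Qed.

Lemma smooth_test_step (i : 'I_n) (a m : R) :
  smooth_test (fun x => smoothstep (m * (x 0 i - a))).
Proof.
have /choice[l hl] u : exists l, forall h,
  `|smoothstep (u + h) - smoothstep u - l * h| <= 8 * h ^+ 2.
  exact: smoothstep_taylor.
split.
  split; last first.
    exists 1 => x; have /andP[? ?] := smoothstep_itv (m * (x 0 i - a)).
    by rewrite ger0_norm.
  have mc : measurable_fun [set: 'rV[R]_n] (fun x => m * (x 0 i - a)).
    by apply: measurable_funM => //; apply: measurable_funB => //; exact: measurable_coord.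
  have mq (c : R) : measurable_fun [set: 'rV[R]_n] (fun x => qplus (m * (x 0 i - a) - c)).
    by apply: measurable_funX; apply: measurable_maxr => //; exact: measurable_funB.
  apply: measurable_funD; last by apply: measurable_funM.
  apply: measurable_funB; last by apply: measurable_funM.
  apply: measurable_funM => //.
  by apply: eq_measurable_fun (mq 0) => x _; rewrite subr0.
exists (fun x => (m * l (m * (x 0 i - a))) *: delta_mx 0 i), (8 * m ^+ 2) => x v.
rewrite dotZl dot_delta mxE.
have -> : m * (x 0 i + v 0 i - a) = m * (x 0 i - a) + m * v 0 i by ring.
have -> : m * l (m * (x 0 i - a)) * v 0 i = l (m * (x 0 i - a)) * (m * v 0 i) by ring.
rewrite (le_trans (hl _ _))// exprMn mulrA.
apply: ler_wpM2l; first exact: mulr_ge0 (sqr_ge0 m).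
by rewrite -[leLHS]real_normK ?num_real// ler_sqr ?nnegrE ?enorm_ge0 ?ler_coord_enorm.
Qed.

Lemma smooth_test_orthant (a : 'I_n -> R) (m : R) :
  smooth_test (fun x => \prod_(i < n) smoothstep (m * (x 0 i - a i))).
Proof.
pose F (s : seq 'I_n) (x : 'rV[R]_n) := \prod_(i <- s) smoothstep (m * (x 0 i - a i)).
suff H s : smooth_test (F s) by exact: H.
elim: s => [|i s IH].
  rewrite (_ : F [::] = fun=> 1); first exact: smooth_test_cst.
  by apply/funext => x; rewrite /F big_nil.
rewrite (_ : F (i :: s) = fun x => smoothstep (m * (x 0 i - a i)) * F s x).
  by apply: smooth_testM => //; exact: smooth_test_step.
by apply/funext => x; rewrite /F big_cons.
Qed.

End C11.

(** * Exponential and first moments of the Gaussian measure *)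

Section GaussianMoment.
Context {R : realType} {n : nat}.
Local Notation gamma := (gaussian R n).

Lemma gaussian_exp_integral (a : 'rV[R]_n) :
  (\int[gamma]_y (expR (dot y a - dot a a / 2))%:E = 1)%E.
Proof.
have me : measurable_fun [set: 'rV[R]_n]
    (fun y => (expR (dot y a - dot a a / 2))%:E).
  apply/measurable_EFinP; apply: measurableT_comp => //.
  by apply: measurable_funB => //; exact: measurable_dot.
transitivity (\int[gamma]_y (1 * (expR (dot y a - dot a a / 2))%:E))%E.
  by apply: eq_integral => y _; rewrite mul1e.
rewrite -(gaussian_translation (g := fun=> 1%E))//.
by rewrite integral_cst// mul1e [X in X = _]probability_setT.
Qed.

Lemma gaussian_exp_integrable (a : 'rV[R]_n) :
  gamma.-integrable [set: 'rV[R]_n] (fun y => (expR (dot y a - dot a a / 2))%:E).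
Proof.
apply/integrableP; split.
  apply/measurable_EFinP; apply: measurableT_comp => //.
  by apply: measurable_funB => //; exact: measurable_dot.
under eq_integral do rewrite gee0_abs ?lee_fin ?expR_ge0//.
by rewrite gaussian_exp_integral ltry.
Qed.

Lemma enorm_measurable : measurable_fun [set: 'rV[R]_n] (@enorm R n).
Proof.
apply: continuous_measurable_rV; apply: locally_lipschitz_continuous => x.
exists 1 => //; exists 1 => y _; rewrite mul1r.
have h1 := ler_enormD (y - x) x; have h2 := ler_enormD (x - y) y.
rewrite ler_norml; move: h1 h2; rewrite !subrK (enormB x y).
by move=> ? ?; apply/andP; split; lra.
Qed.

(** Coordinates satisfy |y_i| <= exp(y_i) + exp(- y_i), and exponentials are integrable by the
    Cameron-Martin formula. The factor exp(1/2) undoes the normalisation for a unit vector. *)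
Lemma gaussian_enorm_integrable : gamma.-integrable [set: 'rV[R]_n] (EFin \o @enorm R n).
Proof.
pose e (i : 'I_n) : 'rV[R]_n := delta_mx 0 i.
pose E (a y : 'rV[R]_n) : \bar R := (expR (dot y a - dot a a / 2))%:E.
have iE : gamma.-integrable [set: 'rV[R]_n]
    (fun y => (n%:R * expR 2^-1)%:E * \sum_(i < n) (E (e i) y + E (- e i)%R y))%E.
  apply: integrableZl => //.
  apply: integrable_sum => // i _.
  by apply: integrableD => //; exact: gaussian_exp_integrable.
have mE : measurable_fun [set: 'rV[R]_n] (EFin \o @enorm R n).
  by apply/measurable_EFinP; exact: enorm_measurable.
apply: (le_integrable measurableT mE _ iE).
move=> y _ /=; rewrite /E sumEFin -EFinM lee_fin ger0_norm ?enorm_ge0//.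
rewrite [leLHS]ger0_norm ?enorm_ge0// -mulrA; apply: enorm_le_coord.
  by rewrite mulr_ge0 ?expR_ge0// sumr_ge0// => i _; rewrite addr_ge0 ?expR_ge0.
move=> i; rewrite (bigD1 i)//= mulrDr.
rewrite (@le_trans _ _ (expR 2^-1 * (expR (dot y (e i) - dot (e i) (e i) / 2) +
  expR (dot y (- e i) - dot (- e i) (- e i) / 2))))//; last first.
  by rewrite lerDl mulr_ge0 ?expR_ge0// sumr_ge0.
rewrite !dotNr dotNl opprK [dot y _]dotC !dot_delta mxE !eqxx mul1r mulrDr -!expRD.
have -> : 2^-1 + (y 0 i - 2^-1) = y 0 i by ring.
have -> : 2^-1 + (- y 0 i - 2^-1) = - y 0 i by ring.
have := expR_ge1Dx (y 0 i); have := expR_ge1Dx (- y 0 i).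
have := expR_ge0 (y 0 i); have := expR_ge0 (- y 0 i).
by case: (lerP 0 (y 0 i)) => h; [rewrite ger0_norm//|rewrite ltr0_norm//]; lra.
by rewrite mulr_ge0 ?sumr_ge0// mulr_ge0 ?expR_ge0.
Qed.

End GaussianMoment.

(** * One-step comparison between Z + tY and the flow started at Z + sY *)

Section Transport.
Context {d : measure_display} {T : measurableType d} {R : realType} {n : nat}.
Variables (P : probability T R) (Y : T -> 'rV[R]_n) (M r : R).
Hypothesis mY : forall i, measurable_fun [set: T] (fun w => Y w 0 i).
Hypothesis YM : forall w, enorm (Y w) <= M.
Hypothesis Yr : forall w w', enorm (Y w - Y w') <= r.

Local Notation gamma := (gaussian R n).
Local Notation Q := (gamma \x P)%E.
Local Notation Phi := (hflow P mY YM).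
Local Notation W := (field P Y).
Local Notation sh := (shifted Y).

Lemma hflow_lipschitz s t : 0 <= s -> s <= t -> t <= 1 ->
  elipschitz (expR (r ^+ 2 / 8)) (Phi s t).
Proof.
move=> s0 st t1.
have k0 : 0 <= r ^+ 2 / 4 by rewrite divr_ge0 ?sqr_ge0.
have -> : r ^+ 2 / 8 = r ^+ 2 / 4 / 2 by field.
apply: (flow_lipschitz _ _ _ _ k0) => // x v s' s01.
exact: (field_one_sided P mY YM Yr).
Qed.

Definition hflow_taylor_cst := flow_taylor_cst (r ^+ 2 / 4) (@taylor_cst R n M).

Lemma hflow_taylor_cst_ge0 : 0 <= hflow_taylor_cst.
Proof.
have T0 := taylor_cst_ge0 P YM.
exact: mulr_ge0 (mulr_ge0 T0 (expR_ge0 _)) (expR_ge0 _).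
Qed.

Lemma hflow_linearization s t x v (a : R -> 'rV[R]_n) :
  0 <= s -> s <= t -> t <= 1 -> a s = v ->
  (forall u, is_derive u (1 : R) a (a u *m dfield P Y u (Phi s u x))) ->
  enorm (Phi s t (x + v) - Phi s t x - a t) <= hflow_taylor_cst * enorm v ^+ 2.
Proof.
move=> s0 st t1 av da.
have k0 : 0 <= r ^+ 2 / 4 by rewrite divr_ge0 ?sqr_ge0.
apply: (flow_linearization k0 _ _ _ _ s0 st t1 av da).
- by move=> u y w; exact: (field_one_sided P mY YM Yr).
- exact: (taylor_cst_ge0 P YM).
- exact: (field_taylor P mY YM).
- exact: (dfield_bound P mY YM).
Qed.

Lemma hflow_taylor s t x : 0 <= s -> s <= t -> t <= 1 ->
  exists A : 'M[R]_n, forall v,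
    enorm (Phi s t (x + v) - Phi s t x - v *m A) <= hflow_taylor_cst * enorm v ^+ 2.
Proof.
move=> s0 st t1.
have k0 : 0 <= r ^+ 2 / 4 by rewrite divr_ge0 ?sqr_ge0.
apply: (flow_taylor _ _ _ _ k0 _ _ _ _ _ x s0 st t1).
- by move=> u y w; exact: (field_one_sided P mY YM Yr).
- exact: (taylor_cst_ge0 P YM).
- exact: (field_taylor P mY YM).
- exact: (dfield_bound P mY YM).
- exact: (continuous_mul_dfield mY YM).
Qed.

Lemma continuous_hflow_coord s t i : 0 <= s -> s <= t -> t <= 1 ->
  continuous ((fun x => Phi s t x 0 i) : 'rV[R]_n -> R).
Proof.
move=> s0 st t1; apply: locally_lipschitz_continuous => x; exists 1 => //.
exists (expR (r ^+ 2 / 8)) => y _.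
have := hflow_lipschitz s0 st t1 y x; apply: le_trans.
by have := ler_coord_enorm (Phi s t y - Phi s t x) i; rewrite !mxE.
Qed.

Lemma measurable_hflow s t : 0 <= s -> s <= t -> t <= 1 ->
  measurable_fun [set: 'rV[R]_n] (Phi s t).
Proof.
move=> s0 st t1; apply: measurable_fun_coordP => i.
by apply: continuous_measurable_rV; exact: continuous_hflow_coord.
Qed.

(** Test functions are pulled back by the flow, so their class must be preserved. The constant does
    not depend on s and t, which makes the one-step errors uniform; the new gradient applies the
    transposed differential of the flow. *)
Lemma C11_hflow k p C N s t : C11 k p C -> (forall x, `|k x| <= N) ->
  0 <= C -> 0 <= s -> s <= t -> t <= 1 ->
  exists p', C11 (k \o Phi s t) p'
    (C * expR (r ^+ 2 / 8) ^+ 2 + @C11_grad_cst R n C N * hflow_taylor_cst).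
Proof.
move=> kC kN C0 s0 st t1.
have /choice[A hA] x := hflow_taylor x s0 st t1.
exists (fun x => p (Phi s t x) *m (A x)^T) => x v /=.
set D := Phi s t (x + v) - Phi s t x.
have Dv : enorm D <= expR (r ^+ 2 / 8) * enorm v.
  by have := hflow_lipschitz s0 st t1 (x + v) x; rewrite (_ : x + v - x = v)// addrC addKr.
have -> : dot (p (Phi s t x) *m (A x)^T) v = dot (p (Phi s t x)) (v *m A x).
  rewrite /dot; under eq_bigr do rewrite mxE mulr_suml.
  rewrite exchange_big; apply: eq_bigr => i _; rewrite mxE mulr_sumr.
  by apply: eq_bigr => j _; rewrite mxE; ring.
have -> : k (Phi s t (x + v)) - k (Phi s t x) - dot (p (Phi s t x)) (v *m A x) =
    (k (Phi s t x + D) - k (Phi s t x) - dot (p (Phi s t x)) D) +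
    dot (p (Phi s t x)) (D - v *m A x).
  by rewrite dotDr dotNr /D [Phi s t x + _]addrC subrK; ring.
rewrite (le_trans (ler_normD _ _))// mulrDl lerD//.
  rewrite (le_trans (kC _ _))// -mulrA ler_wpM2l// -exprMn.
  by rewrite ler_sqr ?nnegrE ?mulr_ge0 ?enorm_ge0 ?expR_ge0.
apply: le_trans (C11_grad_dot kC kN _ _) _.
rewrite -[leRHS]mulrA; apply: ler_wpM2l; first by rewrite mulr_ge0.
exact: hA.
Qed.

(** The witness is the expectation of 1 + M + |Z|; it absorbs the linear growth in Z of the
    pointwise error. *)
Lemma gaussian_moment_bound : exists2 m : R, 0 <= m &
  forall (F : 'rV[R]_n * T -> R) (c : R), 0 <= c -> bmeas F ->
    (forall p, `|F p| <= c * (1 + M + enorm p.1)) -> `|Ex Q F| <= c * m.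
Proof.
have M0 : 0 <= M := bound_ge0 P YM.
have ig : gamma.-integrable [set: 'rV[R]_n] (fun x => (1 + M + enorm x)%:E).
  apply: (@integrableD _ _ _ _ _ measurableT (fun=> (1 + M)%:E) (EFin \o @enorm R n)).
    exact: finite_measure_integrable_cst.
  exact: gaussian_enorm_integrable.
exists (fine (\int[gamma]_x (1 + M + enorm x)%:E)).
  by apply/fine_ge0/integral_ge0 => x _; rewrite lee_fin !addr_ge0 ?enorm_ge0.
move=> F c c0 mF Fc.
have [mF' [N FN]] := mF.
have mFa : bmeas (fun p => `|F p|).
  by split; [exact: measurableT_comp|exists N => p; rewrite normr_id].
apply: (@le_trans _ _ (Ex Q (fun p => `|F p|))).
  by apply: le_normr_Rintegral => //; exact: (bmeas_integrable Q mF).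
rewrite -lee_fin -Ex_EFin// EFinM fineK; last exact: integrable_fin_num.
pose f (p : 'rV[R]_n * T) := (c * (1 + M + enorm p.1))%:E.
have f0 p : (0 <= f p)%E.
  by rewrite lee_fin mulr_ge0// !addr_ge0 ?enorm_ge0.
have mf : measurable_fun [set: 'rV[R]_n * T] f.
  apply/measurable_EFinP; apply: measurable_funM => //; apply: measurable_funD => //.
  exact: measurableT_comp enorm_measurable measurable_fst.
apply: (@le_trans _ _ (\int[Q]_p f p)%E).
  apply: ge0_le_integral => //.
  - by apply/measurable_EFinP; case: mFa.
  - by move=> p _; rewrite lee_fin.
rewrite (fubini_tonelli1 (m1 := gamma) (m2 := P) f)// -integralZl//.
rewrite le_eqVlt; apply/orP; left; apply/eqP; apply: eq_integral => x _.
by rewrite /fubini_F /f /= integral_cst// [X in (_ * X)%E]probability_setT mule1 EFinM.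
Qed.

Lemma Ex_sum m (f : 'I_m -> 'rV[R]_n * T -> R) : (forall i, bmeas (f i)) ->
  Ex Q (fun w => \sum_(i < m) f i w) = \sum_(i < m) Ex Q (f i).
Proof.
elim: m f => [|m IH] f mf.
  rewrite big_ord0 -[RHS](Ex_cst Q).
  by congr (Ex Q _); apply/funext => w; rewrite big_ord0.
rewrite big_ord_recl -IH// -ExD//; last exact: bmeas_sum.
by congr (Ex Q _); apply/funext => w; rewrite big_ord_recl.
Qed.

(** The summands are the remainder of k along the step (t - s) Y, its remainder along the
    displacement by the flow, and the gradient of k applied to the second-order error of the flow in
    time. *)
Definition one_step_cst (C N : R) :=
  C * M ^+ 2 + C * (n%:R * (n%:R * M)) ^+ 2 + @C11_grad_cst R n C N *
    (n%:R * (@field_cst R n M * (n%:R * M) + n%:R * (8 * M * (M + M ^+ 2)))).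

Lemma one_step_cst_ge0 C N : 0 <= C -> 0 <= one_step_cst C N.
Proof.
move=> C0; have M0 : 0 <= M := bound_ge0 P YM.
have K0 := ltW (field_cst_gt0 P YM).
rewrite /one_step_cst; apply: addr_ge0; first by rewrite addr_ge0 ?mulr_ge0 ?sqr_ge0.
apply: mulr_ge0; first by rewrite mulr_ge0.
apply: mulr_ge0 => //; apply: addr_ge0; first exact: mulr_ge0 K0 (mulr_ge0 _ M0).
by rewrite !mulr_ge0// addr_ge0 ?sqr_ge0.
Qed.

(** From the common point X = z + s Y(w), one path moves by (t - s) Y(w) and the other by (t - s)
    W(s, X) up to second order. Once the difference of these first-order effects is subtracted, the
    rest is quadratic in t - s. *)
Lemma one_step_pointwise k p C N s t z w : C11 k p C -> (forall x, `|k x| <= N) ->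
  0 <= C -> 0 <= s -> s <= t -> t <= 1 ->
  `|k (sh t (z, w)) - k (Phi s t (sh s (z, w))) -
    (t - s) * (dot (p (sh s (z, w))) (Y w) - dot (p (sh s (z, w))) (W s (sh s (z, w))))| <=
  one_step_cst C N * (t - s) ^+ 2 * (1 + M + enorm z).
Proof.
move=> kC kN C0 s0 st t1; set X := sh s (z, w).
have M0 : 0 <= M := bound_ge0 P YM.
have G0 : 0 <= @C11_grad_cst R n C N by rewrite mulr_ge0.
have d0 : 0 <= t - s by rewrite subr_ge0.
have X1 : 1 + enorm X <= 1 + M + enorm z.
  rewrite /X /shifted /= -addrA lerD2l addrC (le_trans (ler_enormD _ _))// lerD2l.
  rewrite enormZ ger0_norm// (le_trans _ (YM w))// ler_piMl ?enorm_ge0//.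
  exact: le_trans t1.
have x1 : 1 <= 1 + M + enorm z by rewrite -addrA lerDl addr_ge0 ?enorm_ge0.
have -> : sh t (z, w) = X + (t - s) *: Y w.
  by rewrite /X /shifted /= -addrA -scalerDl [s + _]addrC subrK.
set V := Phi s t X - X.
have -> : Phi s t X = X + V by rewrite /V addrC subrK.
pose Wd := V - (t - s) *: W s X.
have -> : k (X + (t - s) *: Y w) - k (X + V) -
    (t - s) * (dot (p X) (Y w) - dot (p X) (W s X)) =
  (k (X + (t - s) *: Y w) - k X - dot (p X) ((t - s) *: Y w)) -
  (k (X + V) - k X - dot (p X) V) - dot (p X) Wd.
  by rewrite /Wd dotDr dotNr !dotZr; ring.
have h1 : `|k (X + (t - s) *: Y w) - k X - dot (p X) ((t - s) *: Y w)| <=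
    C * M ^+ 2 * (t - s) ^+ 2.
  rewrite (le_trans (kC _ _))// -mulrA ler_wpM2l// -exprMn.
  rewrite ler_sqr ?nnegrE ?mulr_ge0 ?enorm_ge0//.
  by rewrite enormZ ger0_norm// mulrC ler_wpM2r.
have Vn : enorm V <= n%:R * (n%:R * M) * (t - s).
  rewrite (le_trans (ler_enorm_norm _))// -mulrA ler_wpM2l//.
  apply: flow_time_lipschitz => // u x; exact: (field_bound P mY YM).
have h2 : `|k (X + V) - k X - dot (p X) V| <=
    C * (n%:R * (n%:R * M)) ^+ 2 * (t - s) ^+ 2.
  rewrite (le_trans (kC _ _))// -mulrA ler_wpM2l// -exprMn.
  by rewrite ler_sqr ?nnegrE ?enorm_ge0// !mulr_ge0.
have h3 : `|dot (p X) Wd| <= @C11_grad_cst R n C N *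
    (n%:R * (@field_cst R n M * (n%:R * M) + n%:R * (8 * M * (M + M ^+ 2)))) *
    (t - s) ^+ 2 * (1 + M + enorm z).
  have b0 : 0 <= 8 * M * (M + M ^+ 2).
    by rewrite !mulr_ge0// addr_ge0 ?sqr_ge0.
  have h := @flow_time_taylor R n W _ (field_cst_gt0 P YM)
    (fun x => @continuous_field _ _ _ _ P _ _ mY YM x)
    (field_lipschitz_space P mY YM) (field_bounded P mY YM) (n%:R * M)
    (field_bound P mY YM) (n%:R * (8 * M * (M + M ^+ 2))) s t X
    (mulr_ge0 (ler0n _ _) b0) st.
  have {}h : enorm Wd <= n%:R * (@field_cst R n M * (n%:R * M) +
      n%:R * (8 * M * (M + M ^+ 2))) * (1 + enorm X) * (t - s) ^+ 2.
    apply: h => u; apply: le_trans (field_lipschitz P mY YM s u X X) _.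
    rewrite subrr enorm0 mulr0 add0r -!(mulrA n%:R) ler_wpM2l// -!(mulrA (8 * M)).
    rewrite ler_wpM2l ?mulr_ge0// [leRHS]mulrC ler_wpM2l//.
    have := enorm_ge0 X; have := mulr_ge0 M0 (enorm_ge0 X); have := sqr_ge0 M.
    by have := mulr_ge0 (sqr_ge0 M) (enorm_ge0 X); nra.
  apply: le_trans (C11_grad_dot kC kN _ _) _; rewrite -!(mulrA (C11_grad_cst C N)).
  apply: ler_wpM2l => //; apply: le_trans h _.
  rewrite [leRHS]mulrAC ler_wpM2r ?sqr_ge0// ler_wpM2l// mulr_ge0// addr_ge0//.
    by rewrite !mulr_ge0// ltW// (field_cst_gt0 P YM).
  by rewrite mulr_ge0.
rewrite (le_trans (ler_normB _ _))// (le_trans (lerD (ler_normB _ _) h3))//.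
rewrite (le_trans (lerD (lerD h1 h2) (lexx _)))//.
rewrite /one_step_cst !mulrDl lerD2r.
by rewrite lerD// ler_peMr// !mulr_ge0 ?sqr_ge0.
Qed.

Lemma one_step_ex : exists2 m : R, 0 <= m & forall k p C N s t,
  C11 k p C -> bmeas k -> (forall x, `|k x| <= N) ->
  0 <= C -> 0 <= s -> s <= t -> t <= 1 ->
  `|Ex Q (fun q => k (sh t q)) - Ex Q (fun q => k (Phi s t (sh s q)))| <=
    one_step_cst C N * (t - s) ^+ 2 * m.
Proof.
have [m m0 hm] := gaussian_moment_bound; exists m => // k p C N s t.
move=> kC mk kN C0 s0 st t1.
have M0 : 0 <= M := bound_ge0 P YM.
have s01 : 0 <= s <= 1 by rewrite s0 (le_trans st).
have [mk' _] := mk.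
have mp i : bmeas (fun x => p x 0 i) by exact: (bmeas_C11_grad kC kN mk').
pose A q := k (sh t q); pose B q := k (Phi s t (sh s q)).
have mA : bmeas A by exact: (bmeas_shifted mY t mk).
have mB : bmeas B.
  apply: (bmeas_shifted mY s (g := k \o Phi s t)).
  split; last by exists N => x; exact: kN.
  exact: measurableT_comp mk' (measurable_hflow s0 st t1).
pose G (q : 'rV[R]_n * T) := dot (p (sh s q)) (Y q.2).
pose H (q : 'rV[R]_n * T) := dot (p (sh s q)) (W s (sh s q)).
have mpi i : bmeas (fun q => p (sh s q) 0 i).
  exact: (bmeas_shifted mY s (mp i)).
have mYi i : bmeas (fun q : 'rV[R]_n * T => Y q.2 0 i).
  exact: (bmeas_snd (bmeas_coord mY YM i)).
have WE x i : W s x 0 i = tilt P (wt Y s x) (fun w => Y w 0 i).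
  by rewrite /field clamp_id// mxE.
have mWi i : bmeas (fun q => W s (sh s q) 0 i).
  have := bmeas_shifted mY s (bmeas_tilt P mY YM s01 (bmeas_coord mY YM i)).
  by congr bmeas; apply/funext => q; rewrite WE.
have mG : bmeas G by apply: bmeas_sum => i; exact: bmeasM.
have mH : bmeas H by apply: bmeas_sum => i; exact: bmeasM.
(* The first-order terms cancel. *)
have GH : Ex Q G = Ex Q H.
  rewrite /G /H /dot Ex_sum; last by move=> i; exact: bmeasM.
  rewrite Ex_sum; last by move=> i; exact: bmeasM.
  apply: eq_bigr => i _.
  rewrite (conditional_expectation P mY YM s01 (mp i) (bmeas_coord mY YM i)).
  by congr (Ex Q _); apply/funext => q; rewrite WE.
have -> : Ex Q A - Ex Q B = Ex Q (fun q => A q - B q - (t - s) * (G q - H q)).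
  have mGH : bmeas (fun q => G q - H q) by exact: bmeasB.
  have mAB : bmeas (fun q => A q - B q) by exact: bmeasB.
  rewrite (ExB Q mAB (bmeasZ (t - s) mGH)) (ExB Q mA mB) ExZ// (ExB Q mG mH).
  by rewrite GH subrr mulr0 subr0.
apply: hm.
- exact: mulr_ge0 (one_step_cst_ge0 _ C0) (sqr_ge0 _).
- by apply: bmeasB; [exact: bmeasB|apply: bmeasZ; exact: bmeasB].
- by move=> [z w]; exact: one_step_pointwise.
Qed.

(** Over N equal steps the increments add up to at most N * K / N^2 = K / N. *)
Lemma quadratic_increments_constant (u : R -> R) (K : R) :
  (forall s t, 0 <= s -> s <= t -> t <= 1 -> `|u t - u s| <= K * (t - s) ^+ 2) ->
  u 0 = u 1.
Proof.
move=> uK; apply/eqP; rewrite eq_sym -subr_eq0 -normr_le0.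
have K0 : 0 <= K by have := uK 0 1 (lexx _) ler01 (lexx _); rewrite subr0 expr1n mulr1;
  exact: le_trans.
apply/ler_addgt0Pl => e e0; rewrite addr0.
pose N := Num.bound (K / e).
have N0 : 0 < N.+1%:R :> R by [].
have KN : K / N.+1%:R <= e.
  rewrite ler_pdivrMr// mulrC -ler_pdivrMr//.
  rewrite (le_trans (ltW (archi_boundP _)))//; first by rewrite divr_ge0// ltW.
  by rewrite ler_nat.
apply: le_trans KN.
have H j : (j <= N.+1)%N -> `|u (j%:R / N.+1%:R) - u 0| <= j%:R * (K / N.+1%:R ^+ 2).
  elim: j => [|j IH] jN; first by rewrite !mul0r subrr normr0.
  have -> : u (j.+1%:R / N.+1%:R) - u 0 =
    (u (j.+1%:R / N.+1%:R) - u (j%:R / N.+1%:R)) + (u (j%:R / N.+1%:R) - u 0) by ring.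
  rewrite (le_trans (ler_normD _ _))// [j.+1%:R]mulrS [leRHS]mulrDl mul1r lerD//.
    have := uK (j%:R / N.+1%:R) (j.+1%:R / N.+1%:R).
    rewrite -mulrBl [j.+1%:R]mulrS addrK mul1r exprVn; apply.
    - by rewrite divr_ge0.
    - by rewrite ler_pM2r ?invr_gt0// lerDr.
    - by rewrite ler_pdivrMr// mul1r -mulrS ler_nat.
  by apply: IH; exact: ltnW.
have := H N.+1 (leqnn _); rewrite divff ?gt_eqF//; congr (_ <= _).
by rewrite expr2 invfM mulrCA [N.+1%:R * _]mulrA divff ?gt_eqF// mul1r.
Qed.

(** For the step from s to t the one-step estimate is applied to k composed with the flow from t to
    1; the composition law of the flow turns its second term into the same expression at time s. *)
Theorem hflow_transport_ex k : smooth_test k ->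
  Ex Q (fun q => k (Phi 0 1 (sh 0 q))) = Ex Q (fun q => k (sh 1 q)).
Proof.
move=> [mk [p [C kC]]]; have [mk' [N kN]] := mk.
have {}kC : C11 k p `|C|.
  by move=> x v; rewrite (le_trans (kC x v))// ler_wpM2r ?sqr_ge0// ler_norm.
have [m m0 hm] := one_step_ex.
pose C' := `|C| * expR (r ^+ 2 / 8) ^+ 2 + @C11_grad_cst R n `|C| N * hflow_taylor_cst.
have C'0 : 0 <= C'.
  apply: addr_ge0; first by rewrite mulr_ge0 ?sqr_ge0.
  by apply: mulr_ge0; [rewrite mulr_ge0|exact: hflow_taylor_cst_ge0].
have := @quadratic_increments_constant
  (fun t => Ex Q (fun q => k (Phi t 1 (sh t q)))) (one_step_cst C' N * m).
have -> : (fun q => k (Phi 1 1 (sh 1 q))) = (fun q => k (sh 1 q)).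
  by apply/funext => q; rewrite /hflow flow_id.
apply => s t s0 st t1.
have t0 : 0 <= t := le_trans s0 st.
have [p' kC'] := C11_hflow kC kN (normr_ge0 C) t0 t1 (lexx 1).
have mk2 : bmeas (k \o Phi t 1).
  split; last by exists N => x; exact: kN.
  exact: measurableT_comp mk' (measurable_hflow t0 t1 (lexx 1)).
have := hm _ _ _ N s t kC' mk2 (fun x => kN _) C'0 s0 st t1.
rewrite [one_step_cst C' N * m * _]mulrAC; congr (`|_ - _| <= _).
by congr (Ex Q _); apply/funext => q; rewrite /= /hflow flow_comp.
Qed.

End Transport.

(** * Smooth test functions determine laws *)

Section Orthants.
Context {R : realType} {n : nat}.

Definition orthant (a : 'I_n -> R) : set 'rV[R]_n := [set x | forall i, a i < x 0 i].

Lemma measurable_orthant a : measurable (orthant a).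
Proof.
have -> : orthant a = \bigcap_(i in [set: 'I_n]) [set x : 'rV[R]_n | a i < x 0 i].
  by apply/seteqP; split=> x /= h i; [move=> _; exact: h|exact: h].
apply: fin_bigcap_measurable => // i _.
have := @measurable_coord R n i measurableT `]a i, +oo[%classic (measurable_itv _).
by rewrite setTI; congr measurable; apply/seteqP; split=> x /=; rewrite in_itv/= andbT.
Qed.

Lemma orthant_setI_closed : setI_closed (range orthant).
Proof.
move=> _ _ [a _ <-] [b _ <-]; exists (fun i => Num.max (a i) (b i)) => //.
apply/seteqP; split=> x /=.
  by move=> h; split=> i; have := h i; rewrite gt_max => /andP[].
by move=> [h1 h2] i; rewrite gt_max h1 h2.
Qed.

Lemma orthant_cover : \bigcup_k orthant (fun=> - k%:R) = setT.
Proof.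
apply/seteqP; split=> // x _; exists (Num.bound `|x|) => // i.
rewrite ltrNl (le_lt_trans (ler_norm _))// normrN.
rewrite (le_lt_trans (ler_coord_norm _ _))//.
exact: archi_boundP.
Qed.

(** An open half-space x_i > c is the union of the orthants with threshold c at i and -k at the
    other coordinates. *)
Lemma measurable_orthantE : @measurable _ 'rV[R]_n = <<s range orthant >>.
Proof.
apply/seteqP; split=> [A|]; last first.
  apply: smallest_sub; first exact: sigma_algebra_measurable.
  by move=> _ [a _ <-]; exact: measurable_orthant.
apply: smallest_sub; first exact: smallest_sigma_algebra.
rewrite -bigcup_seq => B [i _ [C mC <-]].
have mi : measurable_fun [set: g_sigma_algebraType (range orthant)]
    ((fun x : 'rV[R]_n => x 0 i) : g_sigma_algebraType (range orthant) -> R).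
  apply: (measurability _ (RGenOInfty.measurableE R)) => _ [_ [c ->] <-].
  rewrite setTI.
  pose a k (j : 'I_n) : R := if j == i then c else - k%:R.
  have -> : (fun x : 'rV[R]_n => x 0 i) @^-1` `]c, +oo[%classic = \bigcup_k orthant (a k).
    apply/seteqP; split=> x /=; rewrite in_itv/= andbT; last first.
      by move=> [k _ /(_ i)]; rewrite /a eqxx.
    move=> cx; have : (\bigcup_k orthant (fun=> - k%:R)) x by rewrite orthant_cover.
    by move=> [k _ kx]; exists k => // j; rewrite /a; case: eqP => [->|].
  by apply: bigcup_measurable => k _; apply: sub_sigma_algebra; exists (a k).
exact: mi.
Qed.

(** Off the orthant one factor is exactly 0 for every m; on it all factors are exactly 1 for large
    m, so openness of the orthant matches a step that vanishes at 0. *)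
Lemma smoothstep_orthant_cvg (a : 'I_n -> R) (x : 'rV[R]_n) :
  (\prod_(i < n) smoothstep (m%:R * (x 0 i - a i))) @[m --> \oo] --> (\1_(orthant a) x : R).
Proof.
have H : \forall m \near \oo, forall i, a i < x 0 i -> 1 <= m%:R * (x 0 i - a i).
  apply: filter_forall => j.
  exists (Num.bound (x 0 j - a j)^-1) => // m /= mb aj.
  have d0 : 0 < x 0 j - a j by rewrite subr_gt0.
  rewrite -ler_pdivrMr// div1r (le_trans (ltW (archi_boundP _)))// ?invr_ge0 ?(ltW d0)//.
  by rewrite ler_nat.
apply/cvgrPdist_le => e e0; near=> m.
have [ax|/existsNP[i /negP]] := pselect (orthant a x); last first.
  rewrite -leNgt => xi; rewrite indicE memNset; last by move=> /(_ i); rewrite ltNge xi.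
  rewrite (bigD1 i)//= smoothstep_eq0 ?mul0r ?subrr ?normr0 ?(ltW e0)//.
  by rewrite mulr_ge0_le0// subr_le0.
rewrite indicE mem_set// big1 ?subrr ?normr0 ?(ltW e0)// => i _; apply: smoothstep_eq1.
by move: i (ax i); near: m.
Unshelve. all: by end_near. Qed.

(** Dominated convergence gives equality on orthants, a generating family stable under intersection
    with an exhausting sequence, and uniqueness of measures does the rest. *)
Lemma smooth_test_law d (T : measurableType d) (Q : probability T R)
    (X X' : T -> 'rV[R]_n) :
  measurable_fun setT X -> measurable_fun setT X' ->
  (forall k, smooth_test k -> Ex Q (k \o X) = Ex Q (k \o X')) ->
  forall A, measurable A -> Q (X @^-1` A) = Q (X' @^-1` A).
Proof.
move=> mX mX' XX'.
have lim Z : measurable_fun setT Z -> forall a,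
    (Ex Q ((fun x : 'rV[R]_n => \prod_(i < n) smoothstep (m%:R * (x 0 i - a i))) \o Z))%:E
      @[m --> \oo] --> Q (Z @^-1` orthant a).
  move=> mZ a.
  pose k m (x : 'rV[R]_n) := \prod_(i < n) smoothstep (m%:R * (x 0 i - a i)).
  have k01 m x : 0 <= k m x <= 1.
    rewrite /k; apply/andP; split.
      by apply: prodr_ge0 => i _; have /andP[] := smoothstep_itv (m%:R * (x 0 i - a i)).
    by apply: prodr_ile1 => i _; exact: smoothstep_itv.
  have mk m : bmeas (k m \o Z).
    have [[mk _] _] := @smooth_test_orthant R n a m%:R.
    split; first exact: measurableT_comp mk mZ.
    by exists 1 => w /=; have /andP[? ?] := k01 m (Z w); rewrite ger0_norm.
  have mA : measurable (Z @^-1` orthant a).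
    by rewrite -[X in measurable X]setTI; apply: mZ => //; exact: measurable_orthant.
  have -> : Q (Z @^-1` orthant a) = (\int[Q]_w (\1_(orthant a) (Z w))%:E)%E.
    by rewrite -[in LHS](setIT (Z @^-1` _)) -integral_indic.
  rewrite (_ : (fun m => _) = (fun m => \int[Q]_w (k m (Z w))%:E)%E); last first.
    by apply/funext => m; rewrite (Ex_EFin Q (mk m)).
  have [] := @dominated_convergence _ _ _ Q setT measurableT
    (fun m w => (k m (Z w))%:E) (fun w => (\1_(orthant a) (Z w))%:E) (fun=> 1%E).
  - by move=> m; apply/measurable_EFinP; case: (mk m).
  - apply/measurable_EFinP; apply: (measurableT_comp _ mZ).
    by apply: measurable_indic; exact: measurable_orthant.
  - apply: aeW => w _; apply: cvg_EFin; first exact: nearW.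
    exact: smoothstep_orthant_cvg.
  - exact: finite_measure_integrable_cst.
  - apply: aeW => w m _; rewrite lee_fin; have /andP[? ?] := k01 m (Z w).
    by rewrite ger0_norm.
  - by move=> _ _.
have E a : Q (X @^-1` orthant a) = Q (X' @^-1` orthant a).
  apply: (cvg_unique _ (lim X mX a)) => //.
  rewrite (_ : (fun m => _) = fun m => (Ex Q ((fun x : 'rV[R]_n =>
      \prod_(i < n) smoothstep (m%:R * (x 0 i - a i))) \o X'))%:E); first exact: lim.
  by apply/funext => m; rewrite XX'//; exact: smooth_test_orthant.
move=> A mA.
pose m1 := pushforward Q X; pose m2 := pushforward Q X'.
apply: (@measure_unique _ _ _ (range orthant) (fun k => orthant (fun=> - k%:R))
  measurable_orthantE orthant_setI_closed _ orthant_cover m1 m2) => //.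
- by move=> _ [a _ <-]; exact: E.
- move=> k; apply: (@le_lt_trans _ _ 1%E); last exact: ltry.
  apply: probability_le1; rewrite -[X in measurable X]setTI; apply: mX => //.
  exact: measurable_orthant.
Qed.

End Orthants.

(** * Pushforward and density of the law of Z + Y *)

Section Pushforward.
Context {d : measure_display} {T : measurableType d} {R : realType} {n : nat}.
Variables (P : probability T R) (Y : T -> 'rV[R]_n) (M r : R).
Hypothesis mY : forall i, measurable_fun [set: T] (fun w => Y w 0 i).
Hypothesis YM : forall w, enorm (Y w) <= M.
Hypothesis Yr : forall w w', enorm (Y w - Y w') <= r.
Local Notation gamma := (gaussian R n).
Local Notation Phi := (hflow P mY YM).

Lemma hflow_pushforward A : measurable A ->
  gamma (Phi 0 1 @^-1` A) = (gamma \x P)%E (shifted Y 1 @^-1` A).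
Proof.
move=> mA.
have mPhi := measurable_hflow P mY YM Yr (lexx 0) ler01 (lexx 1).
have E : shifted Y 0 = fst by apply/funext => q; rewrite /shifted scale0r addr0.
rewrite -(smooth_test_law (X := Phi 0 1 \o shifted Y 0) _ _ _ mA).
- have -> : (Phi 0 1 \o shifted Y 0) @^-1` A = (Phi 0 1 @^-1` A) `*` setT.
    by rewrite E; apply/seteqP; split=> q //= -[].
  have mB : measurable (Phi 0 1 @^-1` A).
    by rewrite -[X in measurable X]setTI; exact: mPhi.
  rewrite [RHS](product_measure1E _ _ mB measurableT).
  by rewrite [X in (_ * X)%E]probability_setT mule1.
- by apply: measurableT_comp mPhi _; exact: measurable_shifted.
- exact: measurable_shifted.
- by move=> k; exact: hflow_transport_ex.
Qed.

Lemma law_shifted_density A : measurable A ->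
  (gamma \x P)%E (shifted Y 1 @^-1` A) = (\int[gamma]_(x in A) (density P Y 1 x)%:E)%E.
Proof.
move=> mA.
have mS : measurable (shifted Y 1 @^-1` A).
  by rewrite -[X in measurable X]setTI; exact: measurable_shifted.
have E := law_shifted P mY YM 1 (measurable_indic mA) (fun x => ler0n _ _)
  (bmeas_cst (1 : R)) (fun=> ler01).
transitivity (\int[gamma \x P]_p (\1_A (shifted Y 1 p) * 1)%:E)%E.
  transitivity (\int[gamma \x P]_p (\1_(shifted Y 1 @^-1` A) p)%:E)%E.
    by rewrite integral_indic// setIT.
  by apply: eq_integral => p _; rewrite mulr1 !indicE.
rewrite [RHS]integral_mkcond.
rewrite E; apply: eq_integral => x _.
rewrite tilt_cst ?mulr1; last exact: bmeas_wt.
by rewrite patchE indicE; case: ifP => _; rewrite ?mul1r ?mul0r.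
Qed.

End Pushforward.

(** * Identification of the heat flow map *)

Section FullSupport.
Context {R : realType} {n : nat}.
Local Notation gamma := (gaussian R n).

(** Boxes of equal size are translates of each other, and translations preserve Gaussian null sets
    by the Cameron-Martin formula. *)
Lemma gaussian_rat_box_null (c c' : 'rV[rat]_n) k :
  gamma (rat_box (c, k)) = 0%E -> gamma (rat_box (c', k)) = 0%E.
Proof.
move=> c0; pose B : set 'rV[R]_n := rat_box (c, k).
have mB : measurable B := measurable_rat_box _.
pose a : 'rV[R]_n := \row_i (ratr (c 0 i) - ratr (c' 0 i)).
pose e (x : 'rV[R]_n) : \bar R := (expR (dot x a - dot a a / 2))%:E.
have me : measurable_fun [set: 'rV[R]_n] e.
  apply/measurable_EFinP; apply: measurableT_comp => //.
  by apply: measurable_funB => //; exact: measurable_dot.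
have mI : measurable_fun [set: 'rV[R]_n] (fun x => (\1_B x)%:E : \bar R).
  by apply/measurable_EFinP; exact: measurable_indic.
transitivity (\int[gamma]_x (\1_B (x + a))%:E)%E.
  rewrite -[in LHS](setIT (rat_box (c', k))) -integral_indic//; last exact: measurable_rat_box.
  apply: eq_integral => x _; rewrite !indicE; congr ((nat_of_bool _)%:R%:E).
  apply: asbool_equiv_eq; split=> h i; have := h i; rewrite /= !mxE.
    by congr (`|_| < _); ring.
  by congr (`|_| < _); ring.
rewrite (gaussian_translation (g := fun x => (\1_B x)%:E))//.
rewrite -[RHS](null_set_integral mB (measurable_funTS me) c0) [RHS]integral_mkcond.
apply: eq_integral => x _; rewrite patchE indicE.
by case: ifP => _; rewrite ?mul1e ?mul0e.
Qed.

(** If a rational box inside U were null, so would be all boxes of its size; countably many of them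
    cover the space, which has measure 1. *)
Lemma gaussian_open_gt0 (U : set 'rV[R]_n) : open U -> U !=set0 -> (0 < gamma U)%E.
Proof.
move=> oU [x Ux].
have [|[c k] _ cU] := @rat_box_basis R n x U; first exact: open_nbhs_nbhs.
have mc p : measurable (rat_box p : set 'rV[R]_n) := measurable_rat_box p.
apply: (@lt_le_trans _ _ (gamma (rat_box (c, k)))); last first.
  by apply: le_measure; rewrite ?inE//; exact: open_measurable_rV.
rewrite lt_neqAle measure_ge0 andbT eq_sym; apply/eqP => c0.
have N : gamma.-negligible [set: 'rV[R]_n].
  pose F (c' : 'rV[rat]_n) : set 'rV[R]_n := rat_box (c', k).
  have -> : [set: 'rV[R]_n] = \bigcup_(c' in setT) F c'.
    apply/seteqP; split=> // y _.
    have H i : exists q : rat, `|y 0 i - ratr q| < k.+1%:R^-1.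
      have [|q] := @rat_in_itvoo R (y 0 i - k.+1%:R^-1) (y 0 i).
        by rewrite ltrBlDr ltrDl invr_gt0.
      rewrite in_itv/= => /andP[h1 h2]; exists q.
      by rewrite gtr0_norm ?subr_gt0// ltrBlDr -ltrBlDl.
    have [q hq] := choice H; exists (\row_i q i) => // i /=.
    by rewrite mxE.
  rewrite bigcup_pickle; apply: negligible_bigcup => m; case: pickle_inv => [c'|]; last first.
    exact: negligible_set0.
  case: asboolP => _; last exact: negligible_set0.
  by apply/negligibleP; [exact: mc|exact: gaussian_rat_box_null c0].
have := measure_negligible measurableT N.
by rewrite [X in X = _]probability_setT => /eqP; rewrite eqe oner_eq0.
Qed.

(** Applied both to the density and to the coordinates of the limit map, this makes them unique at
    every point and not only up to a null set. *)
Lemma continuous_ae_eq (f g : 'rV[R]_n -> R) : continuous f -> continuous g ->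
  {ae gamma, forall x, f x = g x} -> f = g.
Proof.
move=> cf cg fg; apply/funext => x; apply/eqP/negP => /negP xfg.
pose U := (fun y => f y - g y) @^-1` [set z : R | z != 0].
have oU : open U.
  apply: open_comp; last exact: open_neq.
  by move=> y _; apply: continuousB; [exact: cf|exact: cg].
have := gaussian_open_gt0 oU (ex_intro _ x _).
rewrite /U /= subr_eq0 => /(_ xfg).
rewrite (measure_negligible (open_measurable_rV oU)) ?ltxx//.
by apply: negligibleS fg => y Uy fgy; move: Uy; rewrite /U /= fgy subrr eqxx.
Qed.

Lemma elipschitz_continuous_coord (L : R) (phi : 'rV[R]_n -> 'rV[R]_n) i :
  elipschitz L phi -> continuous ((fun x => phi x 0 i) : 'rV[R]_n -> R).
Proof.
move=> Lphi; apply: locally_lipschitz_continuous => x; exists 1 => //.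
exists L => y _; apply: le_trans (Lphi y x).
by have := ler_coord_enorm (phi y - phi x) i; rewrite !mxE.
Qed.

Lemma gaussian_density_unique (mu : probability 'rV[R]_n R) f g :
  gaussian_density mu f -> gaussian_density mu g -> f = g.
Proof.
move=> [cf muf] [cg mug]; apply: continuous_ae_eq => //.
move: muf mug; apply: filterS2 => x /(_ I) -> /(_ I)[].
by [].
Qed.

Lemma gaussian_densityP (mu : probability 'rV[R]_n R) (f : 'rV[R]_n -> R) :
  continuous f -> (forall x, 0 <= f x) ->
  (forall A, measurable A -> mu A = (\int[gamma]_(x in A) (f x)%:E)%E) ->
  gaussian_density mu f.
Proof.
move=> cf f0 muf; split=> //.
have mf : measurable_fun [set: 'rV[R]_n] (EFin \o f).
  by apply/measurable_EFinP; exact: continuous_measurable_rV.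
have dom : charge_of_finite_measure mu `<< gamma.
  apply/null_content_dominatesP => A mA A0.
  rewrite [LHS]muf// null_set_integral//; exact: measurable_funTS.
apply: integral_ae_eq => //; first exact: Radon_Nikodym_integrable.
move=> E _ mE; rewrite -Radon_Nikodym_integral//.
exact: muf.
Qed.

End FullSupport.

(** * Realising nu as the law of a bounded random vector *)

Section Truncation.
Context {R : realType} {n : nat} (nu : probability 'rV[R]_n R).
Variable y0 : 'rV[R]_n.
Hypothesis nu_y0 : msupport nu y0.

(* Equal to [y] on the support of [nu] and to [y0] elsewhere: a bounded version of
   the identity. *)
Definition truncation (y : 'rV[R]_n) : 'rV[R]_n :=
  y0 + \1_(msupport nu) y *: (y - y0).

Lemma truncation_id y : msupport nu y -> truncation y = y.
Proof.
by move=> ys; rewrite /truncation indicE mem_set// scale1r addrC subrK.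
Qed.

(** The field requires bounds on Y at every point, not almost surely; this is why the default value
    y0 is itself taken in the support. *)
Lemma truncation_support y : msupport nu (truncation y).
Proof.
have [ys|yn] := pselect (msupport nu y); first by rewrite truncation_id.
by rewrite /truncation indicE memNset// scale0r addr0.
Qed.

Lemma measurable_truncation i : measurable_fun [set: 'rV[R]_n] (fun y => truncation y 0 i).
Proof.
under eq_fun do rewrite !mxE.
apply: measurable_funD => //; apply: measurable_funM.
  by apply: measurable_indic; have [] := msupport_full nu.
by apply: measurable_funB => //; exact: measurable_coord.
Qed.

Lemma convolution_truncation A : measurable A ->
  convolution (gaussian R n) nu A = (gaussian R n \x nu)%E (shifted truncation 1 @^-1` A).
Proof.
move=> mA; have [mS S1] := msupport_full nu.
have S0 : nu (~` msupport nu) = 0%E by rewrite probability_setC// S1 subee.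
have E B : measurable B -> nu B = nu (B `&` msupport nu).
  move=> mB; rewrite -[in LHS](setIT B) -(setUv (msupport nu)) setIUr measureU//.
  - rewrite [X in (_ + X)%E](_ : _ = 0%E) ?adde0//.
    apply/eqP; rewrite -measure_le0 -S0 le_measure ?inE//; last exact: measurableC.
    by apply: measurableI => //; exact: measurableC.
  - exact: measurableI.
  - by apply: measurableI => //; exact: measurableC.
  - by rewrite setIACA setICr setI0.
have mT : measurable_fun [set: 'rV[R]_n * 'rV[R]_n] (shifted truncation 1).
  exact: measurable_shifted measurable_truncation _.
have m1 : measurable (@rV_add R n @^-1` A).
  by rewrite -[X in measurable X]setTI; exact: measurable_rV_add.
have m2 : measurable (shifted truncation 1 @^-1` A).
  by rewrite -[X in measurable X]setTI; exact: mT.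
apply: eq_integral => x _ /=.
rewrite E; last exact: measurable_xsection.
rewrite [RHS]E; last exact: measurable_xsection.
congr (nu _); apply/seteqP; split=> y [xy ys]; split=> //; move: xy.
  by rewrite /xsection/= !inE /= /shifted/= truncation_id// scale1r.
by rewrite /xsection/= !inE /= /shifted/= truncation_id// scale1r.
Qed.

End Truncation.

(** * Existence and uniqueness of the heat flow map *)

Section HeatFlowMap.
Context {d : measure_display} {T : measurableType d} {R : realType} {n : nat}.
Variables (P : probability T R) (Y : T -> 'rV[R]_n) (M r : R).
Hypothesis mY : forall i, measurable_fun [set: T] (fun w => Y w 0 i).
Hypothesis YM : forall w, enorm (Y w) <= M.
Hypothesis Yr : forall w w', enorm (Y w - Y w') <= r.
Local Notation gamma := (gaussian R n).
Local Notation Phi := (hflow P mY YM).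
Local Notation W := (field P Y).
Local Notation f := (density P Y 1).

Lemma expR_oppr_itv (t : R) : 0 <= t -> 0 <= expR (- t) <= 1.
Proof. by move=> t0; rewrite expR_ge0/= -[leRHS]expR0 ler_expR oppr_le0. Qed.

Lemma velocity_density t x : 0 <= t ->
  velocity f t x = - (expR (- t) *: W (expR (- t)) x).
Proof.
move=> t0; rewrite /velocity (ou_semigroup_density P mY YM t0).
by rewrite (gradient_ln_density P mY YM) /field clamp_id// expR_oppr_itv.
Qed.

Lemma is_derive_backward_flow s0 x t :
  is_derive t (1 : R) (fun t => Phi s0 (expR (- t)) x)
    (- (expR (- t) *: W (expR (- t)) (Phi s0 (expR (- t)) x))).
Proof.
apply/is_derive_coordP => i; rewrite !mxE.
have de : is_derive t (1 : R) (fun t => expR (- t)) (- 1 * expR (- t)).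
  exact: is_derive_expR_comp (is_deriveN (is_derive_id _ _)).
have dF := (is_derive_coordP _ _ _).1 (is_derive_flow (field_cst_gt0 P YM)
  (fun y => @continuous_field _ _ _ _ P _ _ mY YM y)
  (field_lipschitz_space P mY YM) (field_bounded P mY YM) s0 (expR (- t)) x) i.
have := @is_derive_comp1 R (fun s => Phi s0 s x 0 i) (fun t => expR (- t)) t _ _ dF de.
by congr (is_derive _ _ _ _); rewrite mulN1r mulrN mulrC !mxE.
Qed.

Lemma is_derive_right (X : R -> 'rV[R]_n) (t : R) (dX : 'rV[R]_n) :
  is_derive t (1 : R) X dX ->
  h^-1 *: (X (h + t) - X t) @[h --> 0^'+] --> dX.
Proof.
move=> [cX <-].
have c : (fun h => h^-1 *: ((X \o shift t) (h *: (1 : R)) - X t)) @ 0^' --> 'D_1 X t := cX.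
have E : (fun h => h^-1 *: ((X \o shift t) (h *: (1 : R)) - X t)) =
    (fun h => h^-1 *: (X (h + t) - X t)).
  by apply/funext => h /=; rewrite /GRing.scale/= mulr1.
rewrite E in c; apply: cvg_trans c; apply: cvg_app => A [e e0 eA].
by exists e => // y ye y0; apply: eA => //; rewrite /= gt_eqF.
Qed.

Lemma hflow_is_flow : is_flow (velocity f) (fun t x => Phi 1 (expR (- t)) x).
Proof.
move=> x; have F1 : Phi 1 (expR (- 0)) x = x by rewrite oppr0 expR0 /hflow flow_id.
split=> //.
  have := is_derive_right (is_derive_backward_flow 1 x 0).
  by rewrite velocity_density//; under eq_fun do rewrite addr0.
move=> t t0; rewrite velocity_density ?ltW//; exact: is_derive_backward_flow.
Qed.

Lemma hflowK t : cancel (Phi 1 (expR (- t))) (Phi (expR (- t)) 1) /\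
  cancel (Phi (expR (- t)) 1) (Phi 1 (expR (- t))).
Proof. by split=> x; rewrite /hflow flow_comp flow_id. Qed.

(** A flow in the sense of [is_flow] is constrained only for t >= 0 and has a one-sided derivative
    at 0, so [ODE_unique] does not apply; Gronwall's lemma is used directly on [0, t]. *)
Lemma flow_velocity_unique S t x : is_flow (velocity f) S -> 0 <= t ->
  S t x = Phi 1 (expR (- t)) x.
Proof.
move=> /(_ x)[S0 Sr dS]; rewrite le_eqVlt => /predU1P[<-|t0].
  by rewrite S0 oppr0 expR0 /hflow flow_id.
have M0 : 0 <= M := bound_ge0 P YM.
pose X s := Phi 1 (expR (- s)) x.
have X0 : X 0 = x by rewrite /X oppr0 expR0 /hflow flow_id.
pose D (s : R) : 'rV[R]_n := S s x - X s.
pose D' (s : R) : 'rV[R]_n := velocity f s (S s x) + (expR (- s) *: W (expR (- s)) (X s)).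
have dD (s : R) : 0 < s -> is_derive s (1 : R) D (D' s).
  move=> s0; have := is_deriveB (dS s s0) (is_derive_backward_flow 1 x s).
  by rewrite opprK.
pose K := n%:R * (8 * M * M).
have K0 : 0 <= K by rewrite !mulr_ge0.
have D'K s : 0 < s -> enorm (D' s) <= K * enorm (D s).
  move=> s0; rewrite /D' velocity_density ?(ltW s0)// addrC -scalerBr enormZ.
  have /andP[e0 e1] := expR_oppr_itv (ltW s0).
  rewrite ger0_norm// (le_trans (ler_piMl (enorm_ge0 _) e1))// enormB.
  rewrite (le_trans (field_lipschitz P mY YM _ _ _ _))// subrr normr0 mul0r addr0.
  by rewrite /K -!mulrA.
(* Right continuity at 0 is extracted from the right derivatives: D(h) is h times a convergent
   difference quotient. *)
have Dr : D h @[h --> 0^'+] --> D 0.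
  have -> : D 0 = 0 by rewrite /D S0 X0 subrr.
  have h0 : h @[h --> (0 : R)^'+] --> (0 : R).
    by apply: cvg_at_right_filter; exact: cvg_id.
  pose q (h : R) := h^-1 *: (S h x - S 0 x) - h^-1 *: (X (h + 0) - X 0).
  have hq : q h @[h --> 0^'+] --> _ :=
    cvgB Sr (is_derive_right (is_derive_backward_flow 1 x 0)).
  apply/cvg_coordP => i; have hqi : h * q h 0 i @[h --> (0 : R)^'+] --> (0 : R) * _ :=
    cvgM h0 ((cvg_coordP _ _ _).1 (hq _) i).
  rewrite mul0r in hqi; rewrite mxE; refine (cvg_trans _ (hqi _ _ _)).
  apply: near_eq_cvg; near=> h; rewrite /q addr0 -scalerBr mxE mulrA divff ?mul1r.
    by rewrite /D S0 X0 !mxE; ring.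
  by rewrite gt_eqF.
pose u s := dot (D s) (D s); pose u' s := dot (D' s) (D s) + dot (D s) (D' s).
have du (s : R) : 0 < s -> is_derive s (1 : R) u (u' s).
  by move=> s0; apply: is_derive_dot; exact: dD.
have u_le0 : u t <= u 0 * expR (2 * K * t - 2 * K * 0).
  apply: (@Gronwall R u u' (fun=> 2 * K) (fun s => 2 * K * s)) => //.
  - exact: ltW.
  - apply/continuous_within_itvP => //; split.
    + move=> s; rewrite in_itv/= => /andP[s0 _]; exact: is_derive_continuous (du s s0).
    + have /cvg_coordP Dri := Dr; rewrite /u /dot.
      apply: cvg_big => [|i _]; first exact: add_continuous.
      by apply: cvgM; exact: Dri.
    + by apply: cvg_at_left_filter; exact: is_derive_continuous (du t t0).
  - by move=> s /andP[s0 _]; exact: du.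
  - move=> s; have := is_deriveZ (2 * K) (is_derive_id s (1 : R)).
    by rewrite /GRing.scale/= mulr1.
  - move=> s /andP[s0 _]; rewrite /u' [dot (D' s) _]dotC.
    have -> : dot (D s) (D' s) + dot (D s) (D' s) = 2 * dot (D s) (D' s) by ring.
    rewrite -[leRHS]mulrA ler_wpM2l// /u dot_enorm expr2 mulrCA.
    rewrite (le_trans (ler_norm _))// (le_trans (CauchySchwarz_dot _ _))//.
    by rewrite ler_wpM2l ?enorm_ge0// D'K.
move: u_le0; have -> : u 0 = 0.
  by rewrite /u /D S0 X0 subrr dot_enorm enorm0 expr0n.
rewrite mul0r /u dot_enorm => h; apply/eqP; rewrite -subr_eq0; apply/eqP.
have : enorm (D t) = 0.
  by apply/eqP; rewrite -sqrf_eq0 eq_le h sqr_ge0.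
by move=> /enorm_eq0.
Unshelve. all: by end_near. Qed.

(** Starting at x at time s or at time 0 makes a difference of order s, because W is bounded, and
    the flow from s to 1 expands it by at most exp(r^2 / 8). *)
Lemma cvg_hflow (t_ : R^nat) x : t_ @ \oo --> +oo ->
  Phi (expR (- t_ k)) 1 x @[k --> \oo] --> Phi 0 1 x.
Proof.
move=> toy; have M0 : 0 <= M := bound_ge0 P YM.
pose C := expR (r ^+ 2 / 8) * (n%:R * (n%:R * M)).
have C0 : 0 <= C by rewrite !mulr_ge0// expR_ge0.
apply/cvgrPdist_le => e e0.
have : \forall k \near \oo, C / e <= t_ k.
  by move/cvgryPger : toy; apply; exact: num_real.
apply: filterS => k tk; have t0 : 0 <= t_ k by rewrite (le_trans _ tk)// divr_ge0// ltW.
have /andP[s0 s1] := expR_oppr_itv t0; set s := expR (- t_ k) in s0 s1 *.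
have -> : Phi 0 1 x = Phi s 1 (Phi 0 s x) by rewrite /hflow flow_comp.
rewrite (le_trans (ler_norm_enorm _))//.
rewrite (le_trans (hflow_lipschitz P mY YM Yr s0 s1 (lexx 1) _ _))//.
apply: (@le_trans _ _ (C * s)).
  rewrite /C -!mulrA ler_wpM2l ?expR_ge0// (le_trans (ler_enorm_norm _))//.
  rewrite ler_wpM2l// mulrA -[s in leRHS]subr0.
  by apply: flow_time_lipschitz => // v y; exact: (field_bound P mY YM).
(* As exp(-t) <= 1 / (1 + t), the error C s is at most e as soon as t >= C / e. *)
have := @expR_le_inv R (- t_ k); rewrite opprK -/s => es.
have t1 : 0 < 1 + t_ k by rewrite ltr_wpDr.
apply: (@le_trans _ _ (C / (1 + t_ k))).
  by apply: ler_wpM2l => //; apply: es; rewrite (le_lt_trans _ ltr01)// oppr_le0.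
rewrite ler_pdivrMr// mulrDr mulr1; move: tk; rewrite ler_pdivrMr// mulrC => h.
by rewrite (le_trans h)// lerDr ltW.
Qed.

Variable mu : probability 'rV[R]_n R.
Hypothesis muf : gaussian_density mu f.

Lemma heat_flow_map_hflow : heat_flow_map mu (Phi 0 1).
Proof.
exists f, (fun t x => Phi 1 (expR (- t)) x), (fun t x => Phi (expR (- t)) 1 x),
  (fun k => k%:R); split.
- exact: muf.
- exact: hflow_is_flow.
- by move=> t _; exact: hflowK.
- split; first exact: cvgr_idn.
    by apply: aeW => x; apply: cvg_hflow; exact: cvgr_idn.
  by exists (expR (r ^+ 2 / 8)); exact: hflow_lipschitz.
Qed.

(** The density is unique, hence the velocity, hence S on nonnegative times and its inverse. The
    limit then agrees with the flow almost everywhere, and everywhere by continuity. *)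
Lemma heat_flow_map_unique phi : heat_flow_map mu phi -> phi = Phi 0 1.
Proof.
move=> [g [S [T' [t_ [mug flowS ST [toy Tphi [L Lphi]]]]]]].
rewrite (gaussian_density_unique mug muf) in flowS.
have T'E t x : 0 <= t -> T' t x = Phi (expR (- t)) 1 x.
  move=> t0; have [_ /(_ x)] := ST t t0; rewrite (flow_velocity_unique _ flowS t0) => E.
  by rewrite -[in RHS]E (hflowK t).1.
have ae_phi : {ae gamma, forall x, phi x = Phi 0 1 x}.
  apply: filterS Tphi => x Tx.
  have Thx : T' (t_ k) x @[k --> \oo] --> Phi 0 1 x; last first.
    exact: (cvg_unique (@norm_hausdorff _ _) Tx Thx).
  refine (cvg_trans _ (cvg_hflow (x := x) toy)); apply: near_eq_cvg.
  have : \forall k \near \oo, 0 <= t_ k.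
    by move/cvgryPger : toy; apply; exact: num_real.
  by apply: filterS => k tk; rewrite T'E.
apply/funext => x; apply/rowP => i.
have /funeqP/(_ x)// : (fun x => phi x 0 i) = (fun x => Phi 0 1 x 0 i).
apply: continuous_ae_eq.
- exact: elipschitz_continuous_coord Lphi.
- exact: elipschitz_continuous_coord (hflow_lipschitz P mY YM Yr (lexx 0) ler01 (lexx 1)).
- by apply: filterS ae_phi => y ->.
Qed.

End HeatFlowMap.

(** * From a quadratic expansion to the Jacobian *)

Section Differential.
Context {R : realType} {n : nat}.
Variables (phi : 'rV[R]_n -> 'rV[R]_n) (x : 'rV[R]_n) (A : 'M[R]_n) (C : R).
Hypothesis phiA : forall v, enorm (phi (x + v) - phi x - v *m A) <= C * enorm v ^+ 2.

Let continuous_mulmxr : continuous (mulmxr A : 'rV[R]_n -> 'rV[R]_n).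
Proof.
move=> v; apply: (@cvg_coordP _ _ _ _ (nbhs_filter (v : 'rV[R]_n)) (mulmxr A) (v *m A)).2 => i /=.
have -> : (fun w : 'rV[R]_n => (w *m A) 0 i) = fun w => \sum_j w 0 j * A j i.
  by apply/funext => w; rewrite mxE.
rewrite mxE; apply: cvg_big => [|j _]; first exact: add_continuous.
by apply: cvgM; [exact: coord_continuous|exact: cvg_cst].
Qed.

Let taylor_littleo :
  phi \o shift x = cst (phi x) + (mulmxr A : 'rV[R]_n -> 'rV[R]_n) +o_ (0 : 'rV[R]_n) id.
Proof.
apply/eqaddoP => e e0.
have [K K0 CK] : exists2 K, 0 < K & `|C| * (n%:R * n%:R) <= K.
  by exists (`|C| * (n%:R * n%:R) + 1); [rewrite ltr_wpDl// !mulr_ge0|rewrite lerDl].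
have eK : 0 < e / K by rewrite divr_gt0.
near=> v.
rewrite /= !fctE /= /cst opprD addrA [v + x]addrC.
rewrite (le_trans (ler_norm_enorm _))// (le_trans (phiA v))//.
apply: (@le_trans _ _ (K * `|v| ^+ 2)).
  apply: (@le_trans _ _ (`|C| * (n%:R * n%:R) * `|v| ^+ 2)); last first.
    by rewrite ler_wpM2r ?sqr_ge0.
  apply: (@le_trans _ _ (`|C| * enorm v ^+ 2)).
    by rewrite ler_wpM2r ?sqr_ge0 ?ler_norm.
  rewrite -mulrA ler_wpM2l// -expr2 -exprMn ler_sqr ?nnegrE ?mulr_ge0 ?enorm_ge0//.
  exact: ler_enorm_norm.
rewrite expr2 mulrA ler_wpM2r// -ler_pdivlMl// mulrC.
near: v; apply/nbhs_ballP; exists (e / K) => // w /=.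
by rewrite -ball_normE/= sub0r normrN => /ltW.
Unshelve. all: by end_near. Qed.

Let diff_taylor : 'd phi x = mulmxr A :> ('rV[R]_n -> 'rV[R]_n).
Proof. exact: diff_unique continuous_mulmxr taylor_littleo. Qed.

Lemma taylor_differentiable : differentiable phi x.
Proof. apply/diff_locallyP; rewrite diff_taylor.
by split; [exact: continuous_mulmxr|exact: taylor_littleo]. Qed.

Lemma taylor_jacobian (v : 'rV[R]_n) : v *m 'J phi x = v *m A.
Proof. by rewrite /jacobian mul_rV_lin1 diff_taylor. Qed.

(** Used in both directions: it bounds the Jacobian of the transport map from above, and in the
    two-point case every Lipschitz constant from below. *)
Lemma taylor_elipschitz L : 0 <= L -> elipschitz L phi ->
  forall v, enorm (v *m A) <= L * enorm v.
Proof.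
move=> L0 Lphi v; apply/ler_addgt0Pr => e e0.
have [K K0 CK] : exists2 K, 0 < K & C * enorm v ^+ 2 <= K.
  exists (`|C| * enorm v ^+ 2 + 1).
    by rewrite ltr_wpDl// mulr_ge0// sqr_ge0.
  by rewrite (@le_trans _ _ (`|C| * enorm v ^+ 2)) ?lerDl// ler_wpM2r ?sqr_ge0 ?ler_norm.
(* With this step the quadratic remainder along h v is at most h e. *)
have [h h0 hE] : exists2 h, 0 < h & h = e / K by exists (e / K) => //; rewrite divr_gt0.
rewrite -(ler_pM2l h0).
have := phiA (h *: v); rewrite -scalemxAl enormZ gtr0_norm// exprMn => H.
have -> : h * enorm (v *m A) = enorm (h *: (v *m A)) by rewrite enormZ gtr0_norm.
have -> : h *: (v *m A) = (phi (x + h *: v) - phi x) -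
  (phi (x + h *: v) - phi x - h *: (v *m A)) by rewrite opprB addrC subrK.
rewrite (le_trans (ler_enormD _ _))// enormN mulrDr lerD//.
  rewrite (le_trans (Lphi _ _))// [x + _]addrC addrK enormZ gtr0_norm//.
  by rewrite mulrCA.
rewrite (le_trans H)//.
have -> : C * (h ^+ 2 * enorm v ^+ 2) = h * (h * (C * enorm v ^+ 2)) by ring.
rewrite ler_pM2l// (le_trans (ler_wpM2l (ltW h0) CK))// hE divfK//.
by rewrite gt_eqF.
Qed.

Lemma opnorm_le (B : 'M[R]_n) L : (forall v, enorm (v *m B) <= L * enorm v) ->
  0 <= L -> opnorm B <= L.
Proof.
move=> BL L0; apply: ge_sup.
  by exists (enorm (0 *m B)); exists 0; rewrite /= ?enorm0.
move=> _ [v /= v1 <-]; rewrite (le_trans (BL v))//.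
by rewrite -[leRHS]mulr1 ler_wpM2l.
Qed.

End Differential.

(** * The upper bound for Gaussian mixtures *)

Section GaussianMixture.
Context {R : realType} {n : nat} (nu : probability 'rV[R]_n R) (r : R).
Hypothesis diam_nu : (ediam (msupport nu) <= r%:E)%E.
Local Notation mu := (convolution (gaussian R n) nu).

Lemma msupport_nonempty : msupport nu !=set0.
Proof.
apply/set0P/eqP => S0; have [_] := msupport_full nu.
by rewrite S0 measure0 => /eqP; rewrite eqe eq_sym oner_eq0.
Qed.

Lemma msupport_dist x y : msupport nu x -> msupport nu y -> enorm (x - y) <= r.
Proof.
move=> xs ys; rewrite -lee_fin; apply: le_trans diam_nu.
by apply: ereal_sup_ubound; exists (x, y).
Qed.

Section Base.
Variable y0 : 'rV[R]_n.
Hypothesis nu_y0 : msupport nu y0.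
Local Notation Y := (truncation nu y0).

Lemma truncation_bound y : enorm (Y y) <= enorm y0 + r.
Proof.
have -> : Y y = y0 + (Y y - y0) by rewrite addrC subrK.
rewrite (le_trans (ler_enormD _ _))// lerD2l.
by apply: msupport_dist => //; exact: truncation_support.
Qed.

Lemma truncation_dist y y' : enorm (Y y - Y y') <= r.
Proof. by apply: msupport_dist; exact: truncation_support. Qed.

Local Notation mY := (measurable_truncation nu y0).
Local Notation Phi := (hflow nu mY truncation_bound).

Lemma convolution_density A : measurable A ->
  mu A = (\int[gaussian R n]_(x in A) (density nu Y 1 x)%:E)%E.
Proof.
move=> mA; rewrite (convolution_truncation nu y0 mA).
exact: (law_shifted_density nu mY truncation_bound).
Qed.

Lemma gaussian_density_convolution : gaussian_density mu (density nu Y 1).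
Proof.
apply: gaussian_densityP; last exact: convolution_density.
- have s1 : 0 <= (1 : R) <= 1 by rewrite ler01 lexx.
  exact: (@continuous_density _ _ R n nu Y _ mY truncation_bound 1 s1).
- by move=> x; rewrite ltW// (density_gt0 nu mY truncation_bound).
Qed.

Lemma heat_flow_map_convolution phi : heat_flow_map mu phi <-> phi = Phi 0 1.
Proof.
split=> [|->].
  exact: (heat_flow_map_unique mY truncation_bound truncation_dist gaussian_density_convolution).
exact: (heat_flow_map_hflow mY truncation_bound truncation_dist gaussian_density_convolution).
Qed.

Lemma hflow_convolution A : measurable A ->
  pushforward (gaussian R n) (Phi 0 1) A = mu A.
Proof.
move=> mA; rewrite (convolution_truncation nu y0 mA).
exact: (hflow_pushforward nu mY truncation_bound truncation_dist).
Qed.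

Lemma hflow_jacobian x :
  differentiable (Phi 0 1) x /\ opnorm ('J (Phi 0 1) x) <= expR (r ^+ 2 / 8).
Proof.
have [A hA] := hflow_taylor nu mY truncation_bound truncation_dist x (lexx 0) ler01 (lexx 1).
split; first exact: taylor_differentiable hA.
apply: opnorm_le; last exact: expR_ge0.
move=> v; rewrite (taylor_jacobian hA).
apply: (taylor_elipschitz hA); first exact: expR_ge0.
by apply: hflow_lipschitz => //; exact: truncation_dist.
Qed.

End Base.
End GaussianMixture.

(** * Sharpness *)

Section TwoPoint.
Context {R : realType} (r : R).
Hypothesis r_ge0 : 0 <= r.
Local Notation a := (const_mx (- (r / 2)) : 'rV[R]_1).
Local Notation b := (const_mx (r / 2) : 'rV[R]_1).
Local Notation nu := (two_point a b).

Lemma enorm1 (x : 'rV[R]_1) : enorm x = `|x 0 0|.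
Proof. by rewrite /enorm big_ord_recl big_ord0 addr0 sqrtr_sqr. Qed.

Lemma rV1_eq (x y : 'rV[R]_1) : x 0 0 = y 0 0 -> x = y.
Proof. by move=> xy; apply/rowP => i; rewrite ord1. Qed.

Lemma two_pointE A : nu A = ((2^-1)%:E * \d_a A + (2^-1)%:E * \d_b A)%E.
Proof. by rewrite /two_point measure_addE. Qed.

Lemma msupport_two_point x : msupport nu x -> x = a \/ x = b.
Proof.
move=> xs; apply: contrapT => /not_orP[xa xb].
pose U : set 'rV[R]_1 := [set y | y 0 0 != a 0 0] `&` [set y | y 0 0 != b 0 0].
have cc : continuous (fun y : 'rV[R]_1 => y 0 0) by exact: coord_continuous.
have oU : open U.
  by apply: openI; apply: (open_comp (D := [set z | z != _])) => [y _|];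
    [exact: cc|exact: open_neq|exact: cc|exact: open_neq].
have Ux : U x by split; apply/eqP => /rV1_eq.
have := xs U oU Ux; rewrite -[X in (_ < X)%E]/(two_point a b U) two_pointE !diracE !memNset ?mule0 ?adde0 ?ltxx//.
  by move=> [_]; rewrite /= eqxx.
by move=> []; rewrite /= eqxx.
Qed.

Lemma two_point_msupport x : x = a \/ x = b -> msupport nu x.
Proof.
move=> xab U oU Ux; rewrite -[X in (_ < X)%E]/(two_point a b U) two_pointE !diracE.
rewrite -!EFinM -EFinD lte_fin.
have := ler0n R (a \in U : bool); have := ler0n R (b \in U : bool).
by case: xab Ux => -> Ux; rewrite (mem_set Ux) /=; lra.
Qed.

Lemma ediam_two_point : (ediam (msupport nu) <= r%:E)%E.
Proof.
apply: ge_ereal_sup => _ [[x y] [/= xs ys] <-]; rewrite lee_fin enorm1 !mxE.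
by case: (msupport_two_point xs) => ->; case: (msupport_two_point ys) => ->;
  rewrite !mxE ler_norml; apply/andP; split; move: r_ge0; lra.
Qed.

Lemma Ex_two_point h : bmeas h -> Ex nu h = (h a + h b) / 2.
Proof.
move=> mh; have [_ [N hN]] := mh.
have h0 w : 0 <= h w + N by have := hN w; rewrite ler_norml => /andP[]; lra.
have mhN : bmeas (fun w => h w + N) by apply: bmeasD => //; exact: bmeas_cst.
have mE : measurable_fun [set: 'rV[R]_1] (fun w => (h w + N)%:E).
  by apply/measurable_EFinP; case: mhN.
have E0 w : [set: 'rV[R]_1] w -> (0 <= (h w + N)%:E)%E by rewrite lee_fin.
(* Adding the bound N makes the integrand nonnegative, so that its integral splits over the sum of
   the two measures. *)
suff H : Ex nu (fun w => h w + N) = (h a + h b) / 2 + N.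
  move: H; rewrite ExD//; last exact: bmeas_cst.
  by rewrite Ex_cst => /addIr.
apply: EFin_inj; rewrite -Ex_EFin// [LHS]ge0_integral_measure_add//.
rewrite !ge0_integral_mscale// !integral_dirac// !diracT !mul1e -!EFinM -EFinD.
transitivity (2^-1 * (h a + N) + 2^-1 * (h b + N))%:E => //.
by congr EFin; field.
Qed.

Local Notation Y := (truncation nu a).
Local Notation nu_a := (two_point_msupport (or_introl (erefl a))).
Local Notation mY := (measurable_truncation nu a).
Local Notation YM := (truncation_bound ediam_two_point nu_a).
Local Notation Yr := (truncation_dist ediam_two_point nu_a).
Local Notation Phi := (hflow nu mY YM).

Lemma truncation_two_point : Y a = a /\ Y b = b.
Proof. by split; apply: truncation_id; apply: two_point_msupport; [left|right]. Qed.

(** At x = 0 both atoms have the same exponent, since |a| = |b|, so tilting leaves the law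
    unchanged. *)
Lemma tilt_two_point s h : bmeas h -> tilt nu (wt Y s 0) h = (h a + h b) / 2.
Proof.
move=> mh; have [Ya Yb] := truncation_two_point.
have mw := bmeas_wt mY YM s 0.
have wab : wt Y s 0 a = wt Y s 0 b.
  rewrite /wt Ya Yb !dot_enorm !enorm1 !mxE normrN.
  by congr (_ * _ - _); rewrite /dot !big1// => i _; rewrite !mxE mul0r.
rewrite /tilt /partition_fun !Ex_two_point; last first.
- by apply: bmeasM => //; exact: bmeas_expR.
- exact: bmeas_expR.
by rewrite wab; field; rewrite gt_eqF// addr_gt0 ?expR_gt0.
Qed.

Lemma field_two_point s : field nu Y s 0 = 0.
Proof.
have [Ya Yb] := truncation_two_point.
apply/rowP => i; rewrite mxE tilt_two_point ?Ya ?Yb ?mxE.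
  by rewrite addNr mul0r.
exact: (bmeas_coord mY YM).
Qed.

(** Two equal masses at distance r attain equality in Popoviciu's inequality. *)
Lemma dfield_two_point s : dfield nu Y s 0 = (clamp s * (r ^+ 2 / 4))%:M.
Proof.
have [Ya Yb] := truncation_two_point.
apply/matrixP => i j; rewrite !mxE !ord1 eqxx mulr1n; congr (_ * _).
have mi := bmeas_coord mY YM 0.
rewrite /tilt_cov !tilt_two_point ?Ya ?Yb ?mxE//; last exact: bmeasM.
by field.
Qed.

Lemma hflow_two_point s : Phi 0 s 0 = 0.
Proof.
have := @flow_unique R 1 (field nu Y) _ (field_cst_gt0 nu YM)
  (fun x => @continuous_field _ _ _ _ nu _ _ mY YM x)
  (field_lipschitz_space nu mY YM) (field_bounded nu mY YM) (fun=> 0) 0.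
move=> /(_ _)/(congr1 (fun f => f s)); apply => t.
by rewrite field_two_point; exact: is_derive_cst.
Qed.

Lemma hflow_two_point_taylor v :
  enorm (Phi 0 1 (0 + v) - Phi 0 1 0 - v *m (expR (r ^+ 2 / 8))%:M) <=
  @hflow_taylor_cst R 1 (enorm a + r) r * enorm v ^+ 2.
Proof.
(* Along the zero trajectory the variational equation is scalar with rate [clamp s] * r^2 / 4, so G
   replaces s^2 / 2 outside [0, 1]; only G(1) = 1/2 enters the value exp(r^2 / 8). *)
have [G G0 dG] := @antiderivative R _ 0 (@continuous_clamp R).
have G1 : G 1 = 2^-1.
  have dQ s : is_derive s (1 : R) (fun s => G s - 2^-1 * (s * s)) (clamp s - s).
    have d2 := is_derive_mul (is_derive_id s (1 : R)) (is_derive_id s (1 : R)).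
    have := is_deriveB (dG s) (is_deriveZ 2^-1 d2).
    by congr (is_derive _ _ _ _); rewrite /GRing.scale/= /GRing.scale/=; field.
  have := ler_norm_is_derive (c := 0) ler01 dQ.
  rewrite G0 !mul0r mulr0 !subr0 !mulr1 normr_le0 subr_eq0 => /(_ _)/eqP; apply.
  by move=> s s01; rewrite clamp_id// subrr normr0.
pose u s := expR (r ^+ 2 / 4 * G s) *: v.
have du s : is_derive s (1 : R) u (u s *m dfield nu Y s (Phi 0 s 0)).
  rewrite hflow_two_point dfield_two_point mul_mx_scalar /u scalerA.
  apply/is_derive_coordP => i; rewrite mxE.
  have de : is_derive s (1 : R) (fun s => expR (r ^+ 2 / 4 * G s))
      (r ^+ 2 / 4 * clamp s * expR (r ^+ 2 / 4 * G s)).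
    by apply: is_derive_expR_comp; exact: is_deriveZ.
  have := is_derive_mul de (is_derive_cst (v 0 i) s 1).
  congr (is_derive _ _ _ _).
    by apply/funext => t; rewrite mxE.
  by rewrite mulr0 addr0 /cst; ring.
have := hflow_linearization Yr (lexx 0) ler01 (lexx 1) _ du.
rewrite {1}/u G0 mulr0 expR0 scale1r => /(_ _ erefl).
have <- : u 1 = v *m (expR (r ^+ 2 / 8))%:M.
  by rewrite /u G1 mul_mx_scalar; congr (expR _ *: _); field.
exact.
Qed.

Lemma two_point_optimal phi : heat_flow_map (convolution (gaussian R 1) nu) phi ->
  is_optimal_lipschitz (expR (r ^+ 2 / 8)) phi.
Proof.
move=> /(heat_flow_map_convolution ediam_two_point nu_a) ->; split.
  exact: (hflow_lipschitz nu mY YM Yr (lexx 0) ler01 (lexx 1)).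
move=> L' L'phi; pose v : 'rV[R]_1 := const_mx 1.
have v1 : enorm v = 1 by rewrite enorm1 mxE normr1.
have L'0 : 0 <= L'.
  by have := le_trans (enorm_ge0 _) (L'phi v 0); rewrite subr0 v1 mulr1.
have := taylor_elipschitz hflow_two_point_taylor L'0 L'phi v.
by rewrite mul_mx_scalar enormZ v1 !mulr1 ger0_norm// expR_ge0.
Qed.

End TwoPoint.

Theorem theorem2 (R : realType) (r : R) (r_ge0 : 0 <= r) :
  (forall (d : nat) (nu : probability 'rV[R]_d R),
    (ediam (msupport nu) <= r%:E)%E ->
    let mu := convolution (gaussian R d) nu in
    (exists phi, heat_flow_map mu phi) /\
    (forall phi, heat_flow_map mu phi ->
      (forall A, measurable A -> pushforward (gaussian R d) phi A = mu A) /\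
      {ae lebesgue_rV R d, forall x,
        differentiable phi x /\ opnorm ('J phi x) <= expR (r ^+ 2 / 8)})) /\
  (forall phi,
    heat_flow_map
      (convolution (gaussian R 1)
        (two_point (const_mx (- (r / 2))) (const_mx (r / 2)))) phi ->
    is_optimal_lipschitz (expR (r ^+ 2 / 8)) phi).
Proof.
split=> [d nu diam_nu mu|phi]; last exact: two_point_optimal.
have [y0 nu_y0] := msupport_nonempty nu.
have phiE phi := heat_flow_map_convolution diam_nu nu_y0 phi.
split=> [|phi /phiE ->]; first by eexists; apply/phiE.
split=> [A|]; first exact: hflow_convolution.
by apply: aeW => x; exact: hflow_jacobian.
Qed.
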